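(* In the calculus $\Pi^D_1$, normal bisimilarity coincides with context bisimilarity: for all closed processes $P,Q$ of $\Pi^D_1$, $P\cong Q$ if and only if $P\approx Q$.
   Context: The calculus $\Pi^D_1$ (strictly higher-order pi-calculus with unary process parameterization). Names: channel names $a,b,c,d,m,\dots$; process variables $X,Y,Z$. Terms: $T ::= 0 \mid X \mid a(X).T \mid \overline{a}T'.T \mid T\,|\,T' \mid (c)T \mid \langle X\rangle T \mid T\langle T'\rangle$. In $a(X).T$ the variable $X$ is bound; in $(c)T$ the name $c$ is bound; in the parameterization (abstraction) $\langle X\rangle T$ the variable $X$ is bound; $T\langle T'\rangle$ is application. Free names $fn$, free variables $fv$ are defined as usual; closed processes have no free variables; a process is non-parameterized if it is not of the form $\langle X\rangle T$. Processes are well-typed and strictly abstraction-passing: every transmitted object and every process variable has the type of an abstraction $\langle Y\rangle T$, so variables occur applied, $X\langle T'\rangle$. $T\{A/X\}$ is capture-avoiding substitution; for a term $E[X]$ with a distinguished variable $X$, $E[A]$ denotes $E\{A/X\}$. Abbreviations: $\overline{m}A$ means $\overline{m}A.0$; replication is the derived operator $!\phi.P := (c)(Q_c\,|\,\overline{c}Q_c)$ with $Q_c := c(X).(\phi.(X\,|\,P)\,|\,\overline{c}X)$, $c$ fresh. Structural congruence $\equiv$: $\alpha$-conversion, $T|0\equiv T$, associativity and commutativity of $|$, $(c)(d)T\equiv(d)(c)T$, $(c)\lambda.T\equiv 0$ if the subject of prefix $\lambda$ is $c$, $(c)(T|T')\equiv (c)T\,|\,T'$ if $c\notin fn(T')$,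 and $(\langle X\rangle T)\langle T'\rangle\equiv T\{T'/X\}$. Labelled transitions (plus symmetric versions): $a(X).T\xrightarrow{a(A)}T\{A/X\}$; $\overline{a}A.T\xrightarrow{\overline{a}A}T$; if $T\xrightarrow{\lambda}T'$ and $c\notin n(\lambda)$ then $(c)T\xrightarrow{\lambda}(c)T'$; if $T\xrightarrow{(\vec c)\overline{a}A}T'$ and $d\in fn(A)\setminus\{\vec c,a\}$ then $(d)T\xrightarrow{(d\vec c)\overline{a}A}T'$; if $T\xrightarrow{\lambda}T'$ and $bn(\lambda)\cap fn(T_1)=\emptyset$ then $T|T_1\xrightarrow{\lambda}T'|T_1$; if $T_1\xrightarrow{a(A)}T_1'$ and $T_2\xrightarrow{(\vec c)\overline{a}A}T_2'$ then $T_1|T_2\xrightarrow{\tau}(\vec c)(T_1'|T_2')$; and transitions are closed under $\equiv$. $\Rightarrow$ is the reflexive-transitive closure of $\xrightarrow{\tau}$, $\stackrel{\lambda}{\Rightarrow}$ is $\Rightarrow\xrightarrow{\lambda}\Rightarrow$, and $\stackrel{\hat\lambda}{\Rightarrow}$ is $\Rightarrow$ if $\lambda=\tau$ and $\stackrel{\lambda}{\Rightarrow}$ otherwise. Context bisimulation: a symmetric relation $\mathcal R$ on closed processes such that whenever $P\mathcal R Q$: (1) if $P\xrightarrow{\alpha}P'$ with $\alpha$ equal to $\tau$ or $a(A)$, then $Q\stackrel{\hat\alpha}{\Rightarrow}Q'$ with $P'\mathcal R Q'$; (2) if $P\xrightarrow{(\vec c)\overline{a}A}P'$ then $Q\stackrel{(\vec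 d)\overline{a}B}{\Rightarrow}Q'$ for some $\vec d,B,Q'$ such that for every $E[X]$ with $\{\vec c,\vec d\}\cap fn(E)=\emptyset$, $(\vec c)(E[A]\,|\,P')\,\mathcal R\,(\vec d)(E[B]\,|\,Q')$. Context bisimilarity $\approx$ is the union of all context bisimulations. Normal bisimulation: with the trigger $Tr_m := \langle Z\rangle\overline{m}Z$, a symmetric relation $\mathcal R$ on closed $\Pi^D_1$ processes such that whenever $P\mathcal R Q$: (1) if $P\xrightarrow{\tau}P'$ then $Q\Rightarrow Q'$ with $P'\mathcal R Q'$; (2) if $P\xrightarrow{a(Tr_m)}P'$ with $m$ fresh, then $Q\stackrel{a(Tr_m)}{\Rightarrow}Q'$ with $P'\mathcal R Q'$; (3) if $P\xrightarrow{(\vec c)\overline{a}A}P'$ then $Q\stackrel{(\vec d)\overline{a}B}{\Rightarrow}Q'$ for some $\vec d,B,Q'$ with $(\vec c)(P'\,|\,!m(Z).A\langle Z\rangle)\,\mathcal R\,(\vec d)(Q'\,|\,!m(Z).B\langle Z\rangle)$ for fresh $m$. Normal bisimilarity $\cong$ is the union of all normal bisimulations.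
   Formalization: Restricted channels may also carry processes (free channels carry only abstractions), since the derived replication passes processes on its private channel c; and the communication rule requires the extruded names not to be free in the receiver. *)

(* Defs.v *)
(* Syntax, structural congruence, LTS, context bisimilarity
   and normal bisimilarity for the strictly higher-order pi-calculus Pi^D_1.
   Named (raw) syntax; alpha-conversion is part of structural congruence and
   transitions are closed under structural congruence, so every
   capture-avoiding substitution is realised on a suitable alpha-variant. *)
From Stdlib Require Import List Arith PeanoNat Relations.
Import ListNotations.

Definition name := nat.
Definition var := nat.

Inductive term : Type :=
| Nil : term
| Var : var -> term
| Inp : name -> var -> term -> term
| Out : name -> term -> term -> term
| Par : term -> term -> term
| Res : name -> term -> term
| Abs : var -> term -> term
| App : term -> term -> term.

Fixpoint fn (T : term) : list name :=
  match T with
  | Nil | Var _ => []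
  | Inp a _ T => a :: fn T
  | Out a A T => a :: fn A ++ fn T
  | Par T1 T2 => fn T1 ++ fn T2
  | Res c T => remove Nat.eq_dec c (fn T)
  | Abs _ T => fn T
  | App T1 T2 => fn T1 ++ fn T2
  end.

Fixpoint fv (T : term) : list var :=
  match T with
  | Nil => []
  | Var X => [X]
  | Inp _ X T => remove Nat.eq_dec X (fv T)
  | Out _ A T => fv A ++ fv T
  | Par T1 T2 => fv T1 ++ fv T2
  | Res _ T => fv T
  | Abs X T => remove Nat.eq_dec X (fv T)
  | App T1 T2 => fv T1 ++ fv T2
  end.

Fixpoint names (T : term) : list name :=
  match T with
  | Nil | Var _ => []
  | Inp a _ T => a :: names T
  | Out a A T => a :: names A ++ names T
  | Par T1 T2 => names T1 ++ names T2
  | Res c T => c :: names T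
  | Abs _ T => names T
  | App T1 T2 => names T1 ++ names T2
  end.

Fixpoint vars (T : term) : list var :=
  match T with
  | Nil => []
  | Var X => [X]
  | Inp _ X T => X :: vars T
  | Out _ A T => vars A ++ vars T
  | Par T1 T2 => vars T1 ++ vars T2
  | Res _ T => vars T
  | Abs X T => X :: vars T
  | App T1 T2 => vars T1 ++ vars T2
  end.

Fixpoint bnames (T : term) : list name :=
  match T with
  | Nil | Var _ => []
  | Inp _ _ T => bnames T
  | Out _ A T => bnames A ++ bnames T
  | Par T1 T2 => bnames T1 ++ bnames T2
  | Res c T => c :: bnames T
  | Abs _ T => bnames T
  | App T1 T2 => bnames T1 ++ bnames T2
  end.

Fixpoint bvars (T : term) : list var :=
  match T with
  | Nil | Var _ => []
  | Inp _ X T => X :: bvars T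
  | Out _ A T => bvars A ++ bvars T
  | Par T1 T2 => bvars T1 ++ bvars T2
  | Res _ T => bvars T
  | Abs X T => X :: bvars T
  | App T1 T2 => bvars T1 ++ bvars T2
  end.

Fixpoint subst (A : term) (X : var) (T : term) : term :=
  match T with
  | Nil => Nil
  | Var Y => if Nat.eqb X Y then A else Var Y
  | Inp a Y T => if Nat.eqb X Y then Inp a Y T else Inp a Y (subst A X T)
  | Out a B T => Out a (subst A X B) (subst A X T)
  | Par T1 T2 => Par (subst A X T1) (subst A X T2)
  | Res c T => Res c (subst A X T)
  | Abs Y T => if Nat.eqb X Y then Abs Y T else Abs Y (subst A X T)
  | App T1 T2 => App (subst A X T1) (subst A X T2)
  end.

(* no binder of T can capture a free name or free variable of A: then the
   naive substitution is the capture-avoiding substitution T{A/X} *)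
Definition subst_safe (A T : term) : Prop :=
  (forall c, In c (bnames T) -> ~ In c (fn A)) /\
  (forall Y, In Y (bvars T) -> ~ In Y (fv A)).

Fixpoint rename_name (c d : name) (T : term) : term :=
  let r a := if Nat.eqb a c then d else a in
  match T with
  | Nil => Nil
  | Var X => Var X
  | Inp a X T => Inp (r a) X (rename_name c d T)
  | Out a A T => Out (r a) (rename_name c d A) (rename_name c d T)
  | Par T1 T2 => Par (rename_name c d T1) (rename_name c d T2)
  | Res e T => if Nat.eqb e c then Res e T else Res e (rename_name c d T)
  | Abs X T => Abs X (rename_name c d T)
  | App T1 T2 => App (rename_name c d T1) (rename_name c d T2)
  end.

Fixpoint rename_var (X Y : var) (T : term) : term :=
  match T with
  | Nil => Nil
  | Var Z => if Nat.eqb Z X then Var Y else Var Z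
  | Inp a Z T => if Nat.eqb Z X then Inp a Z T else Inp a Z (rename_var X Y T)
  | Out a A T => Out a (rename_var X Y A) (rename_var X Y T)
  | Par T1 T2 => Par (rename_var X Y T1) (rename_var X Y T2)
  | Res c T => Res c (rename_var X Y T)
  | Abs Z T => if Nat.eqb Z X then Abs Z T else Abs Z (rename_var X Y T)
  | App T1 T2 => App (rename_var X Y T1) (rename_var X Y T2)
  end.

Inductive scong : term -> term -> Prop :=
| sc_alpha_res : forall c d T, ~ In d (names T) ->
    scong (Res c T) (Res d (rename_name c d T))
| sc_alpha_inp : forall a X Y T, ~ In Y (vars T) ->
    scong (Inp a X T) (Inp a Y (rename_var X Y T))
| sc_alpha_abs : forall X Y T, ~ In Y (vars T) ->
    scong (Abs X T) (Abs Y (rename_var X Y T))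
| sc_par_nil : forall T, scong (Par T Nil) T
| sc_par_assoc : forall T1 T2 T3, scong (Par T1 (Par T2 T3)) (Par (Par T1 T2) T3)
| sc_par_comm : forall T1 T2, scong (Par T1 T2) (Par T2 T1)
| sc_res_comm : forall c d T, scong (Res c (Res d T)) (Res d (Res c T))
| sc_res_inp : forall c X T, scong (Res c (Inp c X T)) Nil
| sc_res_out : forall c A T, scong (Res c (Out c A T)) Nil
| sc_res_par : forall c T1 T2, ~ In c (fn T2) ->
    scong (Res c (Par T1 T2)) (Par (Res c T1) T2)
| sc_beta : forall X T T', subst_safe T' T ->
    scong (App (Abs X T) T') (subst T' X T)
| sc_refl : forall T, scong T T
| sc_sym : forall T1 T2, scong T1 T2 -> scong T2 T1
| sc_trans : forall T1 T2 T3, scong T1 T2 -> scong T2 T3 -> scong T1 T3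
| sc_inp : forall a X T T', scong T T' -> scong (Inp a X T) (Inp a X T')
| sc_out_obj : forall a A A' T, scong A A' -> scong (Out a A T) (Out a A' T)
| sc_out_cont : forall a A T T', scong T T' -> scong (Out a A T) (Out a A T')
| sc_par_l : forall T1 T1' T2, scong T1 T1' -> scong (Par T1 T2) (Par T1' T2)
| sc_par_r : forall T1 T2 T2', scong T2 T2' -> scong (Par T1 T2) (Par T1 T2')
| sc_res : forall c T T', scong T T' -> scong (Res c T) (Res c T')
| sc_abs : forall X T T', scong T T' -> scong (Abs X T) (Abs X T')
| sc_app_l : forall T1 T1' T2, scong T1 T1' -> scong (App T1 T2) (App T1' T2)
| sc_app_r : forall T1 T2 T2', scong T2 T2' -> scong (App T1 T2) (App T1 T2').

Inductive label : Type :=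
| LTau : label
| LIn : name -> term -> label
| LOut : list name -> name -> term -> label.

Definition lnames (l : label) : list name :=
  match l with
  | LTau => []
  | LIn a A => a :: fn A
  | LOut cs a A => cs ++ a :: fn A
  end.

Definition lbn (l : label) : list name :=
  match l with
  | LOut cs _ _ => cs
  | _ => []
  end.

Definition news (cs : list name) (T : term) : term := fold_right Res T cs.

Inductive step : term -> label -> term -> Prop :=
| st_inp : forall a X T A, subst_safe A T ->
    step (Inp a X T) (LIn a A) (subst A X T)
| st_out : forall a A T, step (Out a A T) (LOut [] a A) T
| st_res : forall c T l T', step T l T' -> ~ In c (lnames l) ->
    step (Res c T) l (Res c T')
| st_open : forall d T cs a A T', step T (LOut cs a A) T' ->
    In d (fn A) -> ~ In d cs -> d <> a ->
    step (Res d T) (LOut (d :: cs) a A) T'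
| st_par_l : forall T T' T1 l, step T l T' ->
    (forall c, In c (lbn l) -> ~ In c (fn T1)) ->
    step (Par T T1) l (Par T' T1)
| st_par_r : forall T T' T1 l, step T l T' ->
    (forall c, In c (lbn l) -> ~ In c (fn T1)) ->
    step (Par T1 T) l (Par T1 T')
| st_comm_l : forall T1 T1' T2 T2' a A cs,
    step T1 (LIn a A) T1' -> step T2 (LOut cs a A) T2' ->
    (forall c, In c cs -> ~ In c (fn T1)) ->
    step (Par T1 T2) LTau (news cs (Par T1' T2'))
| st_comm_r : forall T1 T1' T2 T2' a A cs,
    step T1 (LIn a A) T1' -> step T2 (LOut cs a A) T2' ->
    (forall c, In c cs -> ~ In c (fn T1)) ->
    step (Par T2 T1) LTau (news cs (Par T2' T1'))
| st_struct : forall P P1 l P1' P', scong P P1 -> step P1 l P1' -> scong P1' P' ->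
    step P l P'.

Definition tau_star : term -> term -> Prop :=
  clos_refl_trans term (fun P P' => step P LTau P').

Definition weak (P : term) (l : label) (P' : term) : Prop :=
  exists P1 P2, tau_star P P1 /\ step P1 l P2 /\ tau_star P2 P'.

(* Two sorts: processes and abstractions (<Y>T, the type of all
   transmitted objects and of variables bound by abstraction).  Channels
   are sorted by the sort of the objects they carry; all free channels of a
   process carry abstractions.  Restricted channels may carry processes
   (this is needed for the derived replication operator of the paper). *)
Inductive ty : Type := TProc | TAbs.

Definition upd {A : Type} (f : nat -> A) (x : nat) (v : A) : nat -> A :=
  fun y => if Nat.eqb y x then v else f y.

Inductive wt : (name -> ty) -> (var -> ty) -> term -> ty -> Prop :=
| wt_nil : forall D G, wt D G Nil TProc
| wt_var : forall D G X, wt D G (Var X) (G X)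
| wt_inp : forall D G a X T, wt D (upd G X (D a)) T TProc -> wt D G (Inp a X T) TProc
| wt_out : forall D G a A T, wt D G A (D a) -> wt D G T TProc -> wt D G (Out a A T) TProc
| wt_par : forall D G T1 T2, wt D G T1 TProc -> wt D G T2 TProc -> wt D G (Par T1 T2) TProc
| wt_res : forall D G c T s, wt (upd D c s) G T TProc -> wt D G (Res c T) TProc
| wt_abs : forall D G X T, wt D (upd G X TAbs) T TProc -> wt D G (Abs X T) TAbs
| wt_app : forall D G T1 T2, wt D G T1 TAbs -> wt D G T2 TAbs -> wt D G (App T1 T2) TProc.

Definition D0 : name -> ty := fun _ => TAbs.
Definition G0 : var -> ty := fun _ => TAbs.

Definition proc (P : term) : Prop := fv P = [] /\ wt D0 G0 P TProc.

Definition absobj (A : term) : Prop := fv A = [] /\ wt D0 G0 A TAbs.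

Definition context (X : var) (E : term) : Prop :=
  (forall Y, In Y (fv E) -> Y = X) /\ wt D0 (upd G0 X TAbs) E TProc.

Definition ctx_bisimulation (R : term -> term -> Prop) : Prop :=
  (forall P Q, R P Q -> R Q P) /\
  (forall P Q, R P Q -> proc P /\ proc Q) /\
  (forall P Q, R P Q ->
    (forall P', step P LTau P' -> proc P' ->
       exists Q', tau_star Q Q' /\ R P' Q') /\
    (forall a A P', absobj A -> step P (LIn a A) P' -> proc P' ->
       exists Q', weak Q (LIn a A) Q' /\ R P' Q') /\
    (forall cs a A P', step P (LOut cs a A) P' -> proc (news cs (Out a A P')) ->
       exists ds B Q', weak Q (LOut ds a B) Q' /\
         forall X E, context X E ->
           (forall c, In c cs \/ In c ds -> ~ In c (fn E)) ->
           subst_safe A E -> subst_safe B E ->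
           R (news cs (Par (subst A X E) P')) (news ds (Par (subst B X E) Q')))).

Definition ctx_bisimilar (P Q : term) : Prop :=
  exists R, ctx_bisimulation R /\ R P Q.

Definition trig (m : name) : term := Abs 0 (Out m (Var 0) Nil).

(* the derived replication !phi.P := (c)(Q_c | \bar c Q_c),
   Q_c := c(X).(phi.(X | P) | \bar c X), instantiated to !m(Z).A<Z>,
   with Z := 0, X := 1 and c a name fresh for m and A. *)
Definition fresh_for (l : list name) : name := S (fold_right Nat.max 0 l).

Definition rep_trig (m : name) (A : term) : term :=
  let c := fresh_for (m :: names A) in
  let Qc := Inp c 1 (Par (Inp m 0 (Par (Var 1) (App A (Var 0)))) (Out c (Var 1) Nil)) in
  Res c (Par Qc (Out c Qc Nil)).

Definition normal_bisimulation (R : term -> term -> Prop) : Prop :=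
  (forall P Q, R P Q -> R Q P) /\
  (forall P Q, R P Q -> proc P /\ proc Q) /\
  (forall P Q, R P Q ->
    (forall P', step P LTau P' -> proc P' ->
       exists Q', tau_star Q Q' /\ R P' Q') /\
    (forall a m P', ~ In m (fn P) -> ~ In m (fn Q) ->
       step P (LIn a (trig m)) P' -> proc P' ->
       exists Q', weak Q (LIn a (trig m)) Q' /\ R P' Q') /\
    (forall cs a A P', step P (LOut cs a A) P' -> proc (news cs (Out a A P')) ->
       exists ds B Q', weak Q (LOut ds a B) Q' /\
         forall m, ~ In m (a :: cs ++ ds ++ fn P ++ fn Q ++ fn P' ++ fn Q'
                              ++ fn A ++ fn B) ->
           R (news cs (Par P' (rep_trig m A))) (news ds (Par Q' (rep_trig m B))))).

Definition normal_bisimilar (P Q : term) : Prop :=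
  exists R, normal_bisimulation R /\ R P Q.

(* Main.v *)
(** Context bisimilarity gives normal bisimilarity because the server [!m(Z).A<Z>] is a particular
    receiving context.

    For the converse, a process [P] running in an arbitrary environment is factored into a part
    [p] descending from [P] and a part [s] descending from the receiving contexts and received
    objects.  The two parts share the list of abstractions exchanged so far: variable [i] of [p]
    and [s] stands for the [i]-th of them, which may itself mention the earlier variables.
    Substituting the stored abstractions gives the real system.  Substituting triggers in [p]
    alone, in parallel with servers for the abstractions owned by [P], gives a process which is
    required to be normally bisimilar to its counterpart, while [s] is the same on both sides.
    Every transition of the real system is matched by moves of that process under which the
    environment sends and receives only triggers.  A transition may unfold stored abstractions
    many times; this is handled by induction on the number of beta steps it needs, then on
    the index of the variable being called, since an abstraction may be a bare variable.

    The argument is carried out on de Bruijn terms with a late transition system that is not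
    closed under structural congruence; the congruence is shown to be a strong bisimulation
    for it, beta-expansion being dealt with by standardization. *)
From Stdlib Require Import List Arith PeanoNat Relations Lia FunctionalExtensionality Setoid Morphisms.
Require Import Defs.
Import ListNotations.

(** A trigger turns the call of a variable into an output of its argument, so whoever owns the
    stored abstraction can receive that argument. The argument is again an abstraction and may call
    back later; it is therefore never substituted across the border but stored as a further
    variable. This is why the list grows with calls as well as with ordinary communications, and why
    its entries may refer to one another.

    Since beta belongs to structural congruence, calls cost nothing in the real system, while every
    call that involves [p] is an explicit communication of the tested process. A single transition
    may hide many such calls; each is first answered by weak moves of the other side, and only then
    the transition itself.

    Private names exposed by an output or by a call across the border stay free indices and are
    bound again around the whole configuration. Giving the two parts disjoint residue classes modulo
    4 means that they share only names of class 0 and that triggers never clash with anything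
    else. *)

(* Channel names and process variables have separate de Bruijn indices: [Nu] binds a name,
   [In_] and [La] bind a variable. *)
Inductive dtm : Type :=
| N0 : dtm
| V : nat -> dtm
| In_ : nat -> dtm -> dtm
| Ou : nat -> dtm -> dtm -> dtm
| Pr : dtm -> dtm -> dtm
| Nu : dtm -> dtm
| La : dtm -> dtm
| Ap : dtm -> dtm -> dtm.

Definition scons {A} (a : A) (f : nat -> A) : nat -> A :=
  fun x => match x with 0 => a | S y => f y end.

Definition upn (f : nat -> nat) : nat -> nat := scons 0 (fun x => S (f x)).

Fixpoint nren (f : nat -> nat) (T : dtm) : dtm :=
  match T with
  | N0 => N0
  | V x => V x
  | In_ a T => In_ (f a) (nren f T)
  | Ou a A T => Ou (f a) (nren f A) (nren f T)
  | Pr T U => Pr (nren f T) (nren f U)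
  | Nu T => Nu (nren (upn f) T)
  | La T => La (nren f T)
  | Ap T U => Ap (nren f T) (nren f U)
  end.

Fixpoint vren (g : nat -> nat) (T : dtm) : dtm :=
  match T with
  | N0 => N0
  | V x => V (g x)
  | In_ a T => In_ a (vren (upn g) T)
  | Ou a A T => Ou a (vren g A) (vren g T)
  | Pr T U => Pr (vren g T) (vren g U)
  | Nu T => Nu (vren g T)
  | La T => La (vren (upn g) T)
  | Ap T U => Ap (vren g T) (vren g U)
  end.

Definition up (s : nat -> dtm) : nat -> dtm := scons (V 0) (fun x => vren S (s x)).
Definition nup (s : nat -> dtm) : nat -> dtm := fun x => nren S (s x).

Fixpoint vsub (s : nat -> dtm) (T : dtm) : dtm :=
  match T with
  | N0 => N0
  | V x => s x
  | In_ a T => In_ a (vsub (up s) T)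
  | Ou a A T => Ou a (vsub s A) (vsub s T)
  | Pr T U => Pr (vsub s T) (vsub s U)
  | Nu T => Nu (vsub (nup s) T)
  | La T => La (vsub (up s) T)
  | Ap T U => Ap (vsub s T) (vsub s U)
  end.

Definition inst (F N : dtm) : dtm := vsub (scons N V) F.

(** * Algebra of renaming and instantiation *)

Lemma upn_id : upn (fun x => x) = (fun x => x).
Proof. extensionality x; destruct x; reflexivity. Qed.
Lemma upn_comp f g : (fun x => upn f (upn g x)) = upn (fun x => f (g x)).
Proof. extensionality x; destruct x; reflexivity. Qed.

Lemma nren_id T : nren (fun x => x) T = T.
Proof. induction T; simpl; rewrite ?upn_id; congruence. Qed.
Lemma nren_nren T : forall f g, nren f (nren g T) = nren (fun x => f (g x)) T.
Proof. induction T; intros; simpl; f_equal; auto; rewrite IHT, upn_comp; auto. Qed.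
Lemma vren_vren T : forall f g, vren f (vren g T) = vren (fun x => f (g x)) T.
Proof. induction T; intros; simpl; f_equal; auto; rewrite IHT, upn_comp; auto. Qed.
Lemma nren_vren T : forall f g, nren f (vren g T) = vren g (nren f T).
Proof. induction T; intros; simpl; congruence. Qed.

Lemma up_ren s g : (fun x => up s (upn g x)) = up (fun x => s (g x)).
Proof. extensionality x; destruct x; reflexivity. Qed.
Lemma vsub_vren T : forall s g, vsub s (vren g T) = vsub (fun x => s (g x)) T.
Proof. induction T; intros; simpl; f_equal; auto; rewrite IHT, ?up_ren; reflexivity. Qed.
Lemma ren_up s g : (fun x => vren (upn g) (up s x)) = up (fun x => vren g (s x)).
Proof. extensionality x; destruct x; simpl; auto. rewrite !vren_vren. reflexivity. Qed.
Lemma vren_nup s g : (fun x => vren g (nup s x)) = nup (fun x => vren g (s x)).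
Proof. extensionality x; unfold nup. symmetry; apply nren_vren. Qed.
Lemma vren_vsub T : forall s g, vren g (vsub s T) = vsub (fun x => vren g (s x)) T.
Proof.
  induction T; intros; simpl; f_equal; auto; rewrite IHT, ?ren_up, ?vren_nup; auto.
Qed.
Lemma nren_up s f : (fun x => nren f (up s x)) = up (fun x => nren f (s x)).
Proof. extensionality x; destruct x; simpl; auto. apply nren_vren. Qed.
Lemma nren_nup s f : (fun x => nren (upn f) (nup s x)) = nup (fun x => nren f (s x)).
Proof. extensionality x; unfold nup. rewrite !nren_nren. reflexivity. Qed.
Lemma nren_vsub T : forall s f, nren f (vsub s T) = vsub (fun x => nren f (s x)) (nren f T).
Proof.
  induction T; intros; simpl; f_equal; auto; rewrite IHT, ?nren_up, ?nren_nup; auto.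
Qed.
Lemma up_up s t : (fun x => vsub (up s) (up t x)) = up (fun x => vsub s (t x)).
Proof.
  extensionality x; destruct x; simpl; auto. rewrite vsub_vren, vren_vsub. reflexivity.
Qed.
Lemma nup_nup s t : (fun x => vsub (nup s) (nup t x)) = nup (fun x => vsub s (t x)).
Proof. extensionality x; unfold nup. rewrite nren_vsub. reflexivity. Qed.
Lemma vsub_vsub T : forall s t, vsub s (vsub t T) = vsub (fun x => vsub s (t x)) T.
Proof. induction T; intros; simpl; f_equal; auto; rewrite IHT, ?up_up, ?nup_nup; auto. Qed.
Lemma up_V : up V = V.
Proof. extensionality x; destruct x; reflexivity. Qed.
Lemma nup_V : nup V = V.
Proof. reflexivity. Qed.
Lemma vsub_V T : vsub V T = T.
Proof. induction T; simpl; rewrite ?up_V, ?nup_V; congruence. Qed.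
Lemma up_Vren g : up (fun x => V (g x)) = (fun x => V (upn g x)).
Proof. extensionality x; destruct x; reflexivity. Qed.
Lemma vren_V T : forall g, vren g T = vsub (fun x => V (g x)) T.
Proof.
  induction T; intros; simpl; rewrite ?up_Vren; f_equal; auto.
Qed.

Lemma vsub_inst s F N : vsub s (inst F N) = inst (vsub (up s) F) (vsub s N).
Proof.
  unfold inst. rewrite !vsub_vsub. f_equal. extensionality x; destruct x; simpl; auto.
  rewrite vsub_vren. symmetry; apply vsub_V.
Qed.
Lemma nren_inst f F N : nren f (inst F N) = inst (nren f F) (nren f N).
Proof.
  unfold inst. rewrite nren_vsub. f_equal. extensionality x; destruct x; reflexivity.
Qed.
Lemma inst_wk U N : inst (vren S U) N = U.
Proof. unfold inst. rewrite vsub_vren. apply vsub_V. Qed.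
Lemma vsub_wk s U : vsub (up s) (vren S U) = vren S (vsub s U).
Proof. rewrite vsub_vren, vren_vsub. reflexivity. Qed.
Lemma vsub_nup s U : vsub (nup s) (nren S U) = nren S (vsub s U).
Proof. rewrite nren_vsub. reflexivity. Qed.
Lemma up_nup s : up (nup s) = nup (up s).
Proof. extensionality x; destruct x; simpl; auto. unfold nup; simpl. symmetry; apply nren_vren. Qed.
Lemma nren_S_upn f T : nren (upn f) (nren S T) = nren S (nren f T).
Proof. rewrite !nren_nren. reflexivity. Qed.

(** * Structural congruence *)

Definition sw : nat -> nat := fun x => match x with 0 => 1 | 1 => 0 | S (S y) => S (S y) end.

Lemma sw_sw T : nren sw (nren sw T) = T.
Proof.
  rewrite nren_nren. etransitivity; [|apply nren_id]. f_equal.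
  extensionality x; destruct x as [|[|x]]; reflexivity.
Qed.
Lemma sw_upn2 f : (fun x => upn (upn f) (sw x)) = (fun x => sw (upn (upn f) x)).
Proof. extensionality x; destruct x as [|[|x]]; reflexivity. Qed.

(* [b] allows beta, which is oriented: transitions of the left-hand side carry over to the
   right-hand side without an increase of the beta count. *)
Inductive fw (b : bool) : dtm -> dtm -> Prop :=
| fw_nil T : fw b (Pr T N0) T
| fw_nil' T : fw b T (Pr T N0)
| fw_assoc T U W : fw b (Pr T (Pr U W)) (Pr (Pr T U) W)
| fw_comm T U : fw b (Pr T U) (Pr U T)
| fw_swap T : fw b (Nu (Nu T)) (Nu (Nu (nren sw T)))
| fw_ri T : fw b (Nu (In_ 0 T)) N0
| fw_ri' T : fw b N0 (Nu (In_ 0 T))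
| fw_ro A T : fw b (Nu (Ou 0 A T)) N0
| fw_ro' A T : fw b N0 (Nu (Ou 0 A T))
| fw_ext T U : fw b (Nu (Pr T (nren S U))) (Pr (Nu T) U)
| fw_ext' T U : fw b (Pr (Nu T) U) (Nu (Pr T (nren S U)))
| fw_beta T N : b = true -> fw b (Ap (La T) N) (inst T N)
| fw_refl T : fw b T T
| fw_trans T U W : fw b T U -> fw b U W -> fw b T W
| fw_in a T T' : fw b T T' -> fw b (In_ a T) (In_ a T')
| fw_ou a A A' T T' : fw b A A' -> fw b T T' -> fw b (Ou a A T) (Ou a A' T')
| fw_pr T T' U U' : fw b T T' -> fw b U U' -> fw b (Pr T U) (Pr T' U')
| fw_nu T T' : fw b T T' -> fw b (Nu T) (Nu T')
| fw_la T T' : fw b T T' -> fw b (La T) (La T')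
| fw_ap T T' U U' : fw b T T' -> fw b U U' -> fw b (Ap T U) (Ap T' U').

(** Derived through commutativity, so that the analysis of transitions at the root needs only one
    orientation of associativity. *)
Lemma fw_assoc' b T U W : fw b (Pr (Pr T U) W) (Pr T (Pr U W)).
Proof.
  eapply fw_trans; [apply fw_comm|]. eapply fw_trans; [apply fw_assoc|].
  eapply fw_trans; [apply fw_comm|]. eapply fw_trans; [apply fw_assoc|]. apply fw_comm.
Qed.

(** Apart from beta, each generator comes with its converse or has one derivable; swapping two
    restrictions is its own inverse. *)
Lemma fw_sym T U : fw false T U -> fw false U T.
Proof.
  induction 1; try (constructor; assumption).
  - apply fw_assoc'.
  - rewrite <- (sw_sw T) at 2. constructor.
  - discriminate.
  - econstructor; eassumption.
Qed.

Lemma fw_nren b T U : fw b T U -> forall f, fw b (nren f T) (nren f U).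
Proof.
  induction 1; intros; simpl; try (constructor; auto; fail).
  - replace (nren (upn (upn f)) (nren sw T)) with (nren sw (nren (upn (upn f)) T)); [constructor|].
    rewrite !nren_nren, sw_upn2. reflexivity.
  - rewrite nren_S_upn. constructor.
  - rewrite nren_S_upn. constructor.
  - rewrite nren_inst. constructor; auto.
  - econstructor; eauto.
Qed.

Lemma nup_sw s : (fun x => nren sw (nup (nup s) x)) = nup (nup s).
Proof. extensionality x; unfold nup. rewrite !nren_nren. reflexivity. Qed.

Lemma fw_vsub b T U : fw b T U -> forall s, fw b (vsub s T) (vsub s U).
Proof.
  induction 1; intros; simpl; try (constructor; auto; fail).
  - replace (vsub (nup (nup s)) (nren sw T)) with (nren sw (vsub (nup (nup s)) T)); [constructor|].
    rewrite nren_vsub, nup_sw. reflexivity.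
  - rewrite vsub_nup. constructor.
  - rewrite vsub_nup. constructor.
  - rewrite vsub_inst. constructor; auto.
  - econstructor; eauto.
Qed.

Lemma fw_vren b T U g : fw b T U -> fw b (vren g T) (vren g U).
Proof. rewrite !vren_V. intros; apply fw_vsub; auto. Qed.

Lemma fw_vsub_arg b T : forall s t, (forall x, fw b (s x) (t x)) -> fw b (vsub s T) (vsub t T).
Proof.
  assert (U : forall s t, (forall x, fw b (s x) (t x)) -> forall x, fw b (up s x) (up t x)).
  { intros s t H [|x]; simpl; [constructor|apply fw_vren; auto]. }
  induction T; intros; simpl; try (constructor; auto; fail); auto.
  constructor. apply IHT. intros; apply fw_nren; auto.
Qed.

Lemma fw_inst b F F' N N' : fw b F F' -> fw b N N' -> fw b (inst F N) (inst F' N').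
Proof.
  intros. eapply fw_trans; [apply fw_vsub; eassumption|].
  apply fw_vsub_arg. intros [|x]; simpl; auto. constructor.
Qed.

Lemma fw_weaken b T U : fw b T U -> fw true T U.
Proof. induction 1; try (constructor; auto; fail). econstructor; eauto. Qed.

Definition dsc : dtm -> dtm -> Prop := clos_refl_sym_trans dtm (fw true).

#[global] Instance dsc_equiv : Equivalence dsc.
Proof.
  split; red; unfold dsc; intros.
  - apply rst_refl.
  - apply rst_sym; auto.
  - eapply rst_trans; eauto.
Qed.

Lemma dsc_fw T U : fw true T U -> dsc T U.
Proof. apply rst_step. Qed.

Lemma dsc_map (C : dtm -> dtm) : (forall T U, fw true T U -> fw true (C T) (C U)) ->
  forall T U, dsc T U -> dsc (C T) (C U).
Proof.
  intros H T U; induction 1.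
  - apply rst_step; auto.
  - reflexivity.
  - symmetry; auto.
  - etransitivity; eauto.
Qed.

#[global] Instance Pr_dsc : Proper (dsc ==> dsc ==> dsc) Pr.
Proof.
  intros T T' H U U' H'. transitivity (Pr T' U).
  - apply (dsc_map (fun x => Pr x U)); auto. intros; constructor; auto; constructor.
  - apply (dsc_map (fun x => Pr T' x)); auto. intros; constructor; auto; constructor.
Qed.
#[global] Instance Ap_dsc : Proper (dsc ==> dsc ==> dsc) Ap.
Proof.
  intros T T' H U U' H'. transitivity (Ap T' U).
  - apply (dsc_map (fun x => Ap x U)); auto. intros; constructor; auto; constructor.
  - apply (dsc_map (fun x => Ap T' x)); auto. intros; constructor; auto; constructor.
Qed.
#[global] Instance Ou_dsc a : Proper (dsc ==> dsc ==> dsc) (Ou a).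
Proof.
  intros T T' H U U' H'. transitivity (Ou a T' U).
  - apply (dsc_map (fun x => Ou a x U)); auto. intros; constructor; auto; constructor.
  - apply (dsc_map (fun x => Ou a T' x)); auto. intros; constructor; auto; constructor.
Qed.
#[global] Instance Nu_dsc : Proper (dsc ==> dsc) Nu.
Proof. intros T T' H. apply (dsc_map Nu); auto. intros; constructor; auto. Qed.
#[global] Instance La_dsc : Proper (dsc ==> dsc) La.
Proof. intros T T' H. apply (dsc_map La); auto. intros; constructor; auto. Qed.
#[global] Instance In_dsc a : Proper (dsc ==> dsc) (In_ a).
Proof. intros T T' H. apply (dsc_map (In_ a)); auto. intros; constructor; auto. Qed.
#[global] Instance nren_dsc f : Proper (dsc ==> dsc) (nren f).
Proof. intros T T' H. apply (dsc_map (nren f)); auto. intros; apply fw_nren; auto. Qed.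
#[global] Instance vsub_dsc s : Proper (dsc ==> dsc) (vsub s).
Proof. intros T T' H. apply (dsc_map (vsub s)); auto. intros; apply fw_vsub; auto. Qed.
#[global] Instance vren_dsc s : Proper (dsc ==> dsc) (vren s).
Proof. intros T T' H. apply (dsc_map (vren s)); auto. intros; apply fw_vren; auto. Qed.

Lemma dsc_vsub_arg T : forall s t, (forall x, dsc (s x) (t x)) -> dsc (vsub s T) (vsub t T).
Proof.
  assert (U : forall s t, (forall x, dsc (s x) (t x)) -> forall x, dsc (up s x) (up t x)).
  { intros s t H [|x]; simpl; [reflexivity|apply vren_dsc; auto]. }
  induction T; intros; simpl; auto; try reflexivity.
  - apply In_dsc; auto.
  - apply Ou_dsc; auto.
  - apply Pr_dsc; auto.
  - apply Nu_dsc. apply IHT. intros; apply nren_dsc; auto.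
  - apply La_dsc; auto.
  - apply Ap_dsc; auto.
Qed.
#[global] Instance inst_dsc : Proper (dsc ==> dsc ==> dsc) inst.
Proof.
  intros F F' H N N' H'. unfold inst. rewrite H. apply dsc_vsub_arg.
  intros [|x]; simpl; auto. reflexivity.
Qed.

Lemma dsc_nil T : dsc (Pr T N0) T.
Proof. apply dsc_fw; constructor. Qed.
Lemma dsc_comm T U : dsc (Pr T U) (Pr U T).
Proof. apply dsc_fw; constructor. Qed.
Lemma dsc_assoc T U W : dsc (Pr T (Pr U W)) (Pr (Pr T U) W).
Proof. apply dsc_fw; constructor. Qed.
Lemma dsc_ext T U : dsc (Nu (Pr T (nren S U))) (Pr (Nu T) U).
Proof. apply dsc_fw; constructor. Qed.
Lemma dsc_ext_r T U : dsc (Nu (Pr (nren S U) T)) (Pr U (Nu T)).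
Proof. rewrite (dsc_comm (nren S U)), dsc_ext. apply dsc_comm. Qed.
Lemma dsc_swap T : dsc (Nu (Nu T)) (Nu (Nu (nren sw T))).
Proof. apply dsc_fw; constructor. Qed.
Lemma dsc_beta T N : dsc (Ap (La T) N) (inst T N).
Proof. apply dsc_fw; constructor; auto. Qed.

(** * Concretions and transitions *)

(** A concretion in the sense of Milner: each [CN] binds one extruded name over both the object and
    the continuation stored in [CB]. *)
Inductive conc : Type := CB (A T : dtm) | CN (C : conc).
Inductive res : Type := RP (T : dtm) | RI (F : dtm) | RO (C : conc).
(* [LI None] is the transition of an abstraction offering its parameter. *)
Inductive lab : Type := LT | LI (s : option nat) | LO (a : nat).

Fixpoint cnren f C := match C with
  | CB A T => CB (nren f A) (nren f T) | CN C => CN (cnren (upn f) C) end.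
Fixpoint cvsub s C := match C with
  | CB A T => CB (vsub s A) (vsub s T) | CN C => CN (cvsub (nup s) C) end.
Fixpoint cpl C U := match C with
  | CB A T => CB A (Pr T U) | CN C => CN (cpl C (nren S U)) end.
Fixpoint cpr U C := match C with
  | CB A T => CB A (Pr U T) | CN C => CN (cpr (nren S U) C) end.
(** Application of a concretion to an abstraction whose parameter is variable 0 of [F]; [F] is
    weakened past every extruded name. *)
Fixpoint cap C F := match C with
  | CB A T => Pr (inst F A) T | CN C => Nu (cap C (nren S F)) end.

Definition rparl r U := match r with
  | RP T => RP (Pr T U) | RI F => RI (Pr F (vren S U)) | RO C => RO (cpl C U) end.
Definition rparr U r := match r with
  | RP T => RP (Pr U T) | RI F => RI (Pr (vren S U) F) | RO C => RO (cpr U C) end.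
Definition rnu r := match r with
  | RP T => RP (Nu T) | RI F => RI (Nu F) | RO C => RO (CN C) end.
Definition rnren f r := match r with
  | RP T => RP (nren f T) | RI F => RI (nren f F) | RO C => RO (cnren f C) end.
Definition rvsub s r := match r with
  | RP T => RP (vsub s T) | RI F => RI (vsub (up s) F) | RO C => RO (cvsub s C) end.
Definition lren f l := match l with
  | LT => LT | LI (Some a) => LI (Some (f a)) | LI None => LI None | LO a => LO (f a) end.

(* The index counts the beta steps.  Every enclosing restriction is extruded by an output,
   whether or not it occurs in the object. *)
Inductive tr : nat -> dtm -> lab -> res -> Prop :=
| tr_in a T : tr 0 (In_ a T) (LI (Some a)) (RI T)
| tr_la T : tr 0 (La T) (LI None) (RI T)
| tr_ou a A T : tr 0 (Ou a A T) (LO a) (RO (CB A T))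
| tr_pl n T U l r : tr n T l r -> tr n (Pr T U) l (rparl r U)
| tr_pr n T U l r : tr n U l r -> tr n (Pr T U) l (rparr T r)
| tr_nu n T l r : tr n T (lren S l) r -> tr n (Nu T) l (rnu r)
| tr_ap n k M N F l r : tr n M (LI None) (RI F) -> tr k (inst F N) l r ->
    tr (S (n + k)) (Ap M N) l r
| tr_cl n k T U a F C : tr n T (LI (Some a)) (RI F) -> tr k U (LO a) (RO C) ->
    tr (n + k) (Pr T U) LT (RP (cap C F))
| tr_cr n k T U a F C : tr n U (LI (Some a)) (RI F) -> tr k T (LO a) (RO C) ->
    tr (n + k) (Pr T U) LT (RP (cap C F)).

Lemma tr_shape n T l r : tr n T l r ->
  match l with LT => exists T', r = RP T' | LI _ => exists F, r = RI F | LO _ => exists C, r = RO C end.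
Proof.
  induction 1; simpl; eauto.
  - destruct l; destruct IHtr as [? ->]; simpl; eauto.
  - destruct l; destruct IHtr as [? ->]; simpl; eauto.
  - destruct l as [|[a|]|a]; simpl in *; destruct IHtr as [? ->]; simpl; eauto.
Qed.

(** Extruding every restriction would separate congruent terms. [ceq_scope] returns a name absent
    from the object to the continuation, and [ceq_swap] forgets the order of extrusion. *)
Inductive ceq : conc -> conc -> Prop :=
| ceq_b A A' T T' : dsc A A' -> dsc T T' -> ceq (CB A T) (CB A' T')
| ceq_n C C' : ceq C C' -> ceq (CN C) (CN C')
| ceq_scope A T : ceq (CN (CB (nren S A) T)) (CB A (Nu T))
| ceq_swap C : ceq (CN (CN C)) (CN (CN (cnren sw C)))
| ceq_sym C C' : ceq C C' -> ceq C' C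
| ceq_trans C C' C'' : ceq C C' -> ceq C' C'' -> ceq C C''.

Lemma ceq_refl C : ceq C C.
Proof. induction C; constructor; auto; reflexivity. Qed.
#[global] Instance ceq_equiv : Equivalence ceq.
Proof.
  split; red; intros; [apply ceq_refl|apply ceq_sym; auto|eapply ceq_trans; eauto].
Qed.

#[global] Instance CN_ceq : Proper (ceq ==> ceq) CN.
Proof. intros C C' H; apply ceq_n; auto. Qed.

Lemma cnren_cnren C : forall f g, cnren f (cnren g C) = cnren (fun x => f (g x)) C.
Proof. induction C; intros; simpl; rewrite ?nren_nren; auto; rewrite IHC, upn_comp; auto. Qed.
Lemma cnren_id C : cnren (fun x => x) C = C.
Proof. induction C; simpl; rewrite ?nren_id, ?upn_id; congruence. Qed.
Lemma cnren_cap C : forall f F, nren f (cap C F) = cap (cnren f C) (nren f F).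
Proof.
  induction C; intros; simpl; rewrite ?nren_inst; auto.
  rewrite IHC, nren_S_upn. reflexivity.
Qed.
Lemma cvsub_cap C : forall s F, vsub s (cap C F) = cap (cvsub s C) (vsub (up s) F).
Proof.
  induction C; intros; simpl; rewrite ?vsub_inst; auto.
  rewrite IHC, up_nup, vsub_nup. reflexivity.
Qed.
Lemma cnren_cpl C : forall f U, cnren f (cpl C U) = cpl (cnren f C) (nren f U).
Proof. induction C; intros; simpl; auto. rewrite IHC, nren_S_upn; auto. Qed.
Lemma cnren_cpr C : forall f U, cnren f (cpr U C) = cpr (nren f U) (cnren f C).
Proof. induction C; intros; simpl; auto. rewrite IHC, nren_S_upn; auto. Qed.
Lemma cvsub_cpl C : forall s U, cvsub s (cpl C U) = cpl (cvsub s C) (vsub s U).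
Proof. induction C; intros; simpl; auto. rewrite IHC, vsub_nup; auto. Qed.
Lemma cvsub_cpr C : forall s U, cvsub s (cpr U C) = cpr (vsub s U) (cvsub s C).
Proof. induction C; intros; simpl; auto. rewrite IHC, vsub_nup; auto. Qed.

Lemma sw_SS T : nren sw (nren S (nren S T)) = nren S (nren S T).
Proof. rewrite !nren_nren. reflexivity. Qed.

Lemma ceq_nren C C' : ceq C C' -> forall f, ceq (cnren f C) (cnren f C').
Proof.
  induction 1; intros; simpl.
  - constructor; apply nren_dsc; auto.
  - constructor; auto.
  - rewrite nren_S_upn. constructor.
  - replace (cnren (upn (upn f)) (cnren sw C)) with (cnren sw (cnren (upn (upn f)) C)); [apply ceq_swap|].
    rewrite !cnren_cnren. f_equal. extensionality x; destruct x as [|[|x]]; reflexivity.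
  - apply ceq_sym; auto.
  - eapply ceq_trans; eauto.
Qed.
Lemma ceq_cpl C C' : ceq C C' -> forall U U', dsc U U' -> ceq (cpl C U) (cpl C' U').
Proof.
  assert (R : forall C U U', dsc U U' -> ceq (cpl C U) (cpl C U')).
  { induction C0; simpl; intros; constructor; try reflexivity.
    - rewrite H; reflexivity.
    - apply IHC0. rewrite H; reflexivity. }
  assert (L : ceq C C' -> forall U, ceq (cpl C U) (cpl C' U)).
  { induction 1; intros; simpl.
    - constructor; auto. rewrite H0; reflexivity.
    - constructor; auto.
    - eapply ceq_trans; [apply ceq_scope|]. constructor; [reflexivity|]. apply dsc_ext.
    - rewrite <- (sw_SS U) at 2. rewrite <- cnren_cpl. apply ceq_swap.
    - apply ceq_sym; auto.
    - eapply ceq_trans; eauto. }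
  intros. eapply ceq_trans; [apply L; auto|]. apply R; auto.
Qed.
Lemma cpl_cpr C : forall U, ceq (cpl C U) (cpr U C).
Proof.
  induction C; intros; simpl; constructor; auto; try reflexivity. apply dsc_comm.
Qed.
Lemma ceq_cpr C C' U U' : ceq C C' -> dsc U U' -> ceq (cpr U C) (cpr U' C').
Proof.
  intros. rewrite <- !cpl_cpr. apply ceq_cpl; auto.
Qed.
Lemma ceq_cap C C' : ceq C C' -> forall F F', dsc F F' -> dsc (cap C F) (cap C' F').
Proof.
  assert (R : forall C F F', dsc F F' -> dsc (cap C F) (cap C F')).
  { induction C0; simpl; intros F F' H.
    - rewrite H; reflexivity.
    - apply Nu_dsc. apply IHC0. rewrite H; reflexivity. }
  assert (L : ceq C C' -> forall F, dsc (cap C F) (cap C' F)).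
  { induction 1; intros; simpl.
    - rewrite H, H0; reflexivity.
    - apply Nu_dsc; auto.
    - rewrite <- nren_inst. apply dsc_ext_r.
    - rewrite dsc_swap. rewrite cnren_cap, sw_SS. reflexivity.
    - symmetry; auto.
    - etransitivity; eauto. }
  intros. etransitivity; [apply L; auto|]. apply R; auto.
Qed.

Lemma lren_lren f g l : lren f (lren g l) = lren (fun x => f (g x)) l.
Proof. destruct l as [|[a|]|a]; reflexivity. Qed.
Lemma lren_inj f l l' : (forall x y, f x = f y -> x = y) -> lren f l = lren f l' -> l = l'.
Proof.
  intros H. destruct l as [|[a|]|a], l' as [|[a'|]|a']; simpl; intros E; try discriminate; auto;
  injection E as E; apply H in E; congruence.
Qed.
Lemma rnren_rparl f r U : rnren f (rparl r U) = rparl (rnren f r) (nren f U).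
Proof. destruct r; simpl; rewrite ?nren_vren, ?cnren_cpl; auto. Qed.
Lemma rnren_rparr f r U : rnren f (rparr U r) = rparr (nren f U) (rnren f r).
Proof. destruct r; simpl; rewrite ?nren_vren, ?cnren_cpr; auto. Qed.
Lemma rnren_rnu f r : rnren f (rnu r) = rnu (rnren (upn f) r).
Proof. destruct r; reflexivity. Qed.
Lemma rvsub_rparl s r U : rvsub s (rparl r U) = rparl (rvsub s r) (vsub s U).
Proof. destruct r; simpl; rewrite ?vsub_wk, ?cvsub_cpl; auto. Qed.
Lemma rvsub_rparr s r U : rvsub s (rparr U r) = rparr (vsub s U) (rvsub s r).
Proof. destruct r; simpl; rewrite ?vsub_wk, ?cvsub_cpr; auto. Qed.
Lemma rvsub_rnu s r : rvsub s (rnu r) = rnu (rvsub (nup s) r).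
Proof. destruct r; simpl; rewrite ?up_nup; reflexivity. Qed.
Lemma lren_upn_S f l : lren (upn f) (lren S l) = lren S (lren f l).
Proof. rewrite !lren_lren. reflexivity. Qed.

Lemma tr_nren n T l r : tr n T l r -> forall f, tr n (nren f T) (lren f l) (rnren f r).
Proof.
  induction 1; intros g; simpl; try (constructor; auto; fail).
  - rewrite rnren_rparl. constructor; auto.
  - rewrite rnren_rparr. constructor; auto.
  - rewrite rnren_rnu. constructor. rewrite <- lren_upn_S. auto.
  - econstructor; [apply IHtr1|]. rewrite <- nren_inst. auto.
  - rewrite cnren_cap. eapply tr_cl; [apply IHtr1|apply IHtr2].
  - rewrite cnren_cap. eapply tr_cr; [apply IHtr1|apply IHtr2].
Qed.

Lemma tr_vsub n T l r : tr n T l r -> forall s, tr n (vsub s T) l (rvsub s r).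
Proof.
  induction 1; intros; simpl; try (constructor; auto; fail).
  - rewrite rvsub_rparl. constructor; auto.
  - rewrite rvsub_rparr. constructor; auto.
  - rewrite rvsub_rnu. constructor. auto.
  - econstructor; [apply IHtr1|]. rewrite <- vsub_inst. auto.
  - rewrite cvsub_cap. eapply tr_cl; [apply IHtr1|apply IHtr2].
  - rewrite cvsub_cap. eapply tr_cr; [apply IHtr1|apply IHtr2].
Qed.

Lemma upn_inj f : (forall x y, f x = f y -> x = y) -> forall x y, upn f x = upn f y -> x = y.
Proof. intros H [|x] [|y]; simpl; intros; try discriminate; auto. Qed.

(** Injectivity guarantees that subjects which coincide after renaming coincided before it, so
    renaming creates no communication. *)
Lemma tr_nren_inv n T' l r : tr n T' l r -> forall f T, (forall x y, f x = f y -> x = y) ->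
  T' = nren f T -> exists l' r', tr n T l' r' /\ l = lren f l' /\ r = rnren f r'.
Proof.
  induction 1; intros f T0 Hf E; destruct T0; simpl in E; try discriminate; injection E; intros; subst.
  - exists (LI (Some n)), (RI T0); repeat split; constructor.
  - exists (LI None), (RI T0); repeat split; constructor.
  - exists (LO n), (RO (CB T0_1 T0_2)); repeat split; constructor.
  - edestruct IHtr as (l' & r' & ? & -> & ->); eauto.
    exists l', (rparl r' T0_2). repeat split; [constructor; auto|]. rewrite rnren_rparl; auto.
  - edestruct IHtr as (l' & r' & ? & -> & ->); eauto.
    exists l', (rparr T0_1 r'). repeat split; [constructor; auto|]. rewrite rnren_rparr; auto.
  - edestruct (IHtr (upn f)) as (l' & r' & ? & E1 & ->); eauto using upn_inj.
    (* The label of the body avoids the bound index 0 because its image under [upn f] is a shifted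
       label. *)
    assert (exists l0, l' = lren S l0) as [l0 ->].
    { destruct l as [|[a|]|a], l' as [|[a'|]|a']; simpl in *; try discriminate.
      - exists LT; auto.
      - destruct a'; [discriminate|]. exists (LI (Some a')); auto.
      - exists (LI None); auto.
      - destruct a'; [discriminate|]. exists (LO a'); auto. }
    exists l0, (rnu r'). repeat split; [constructor; auto| |rewrite rnren_rnu; auto].
    rewrite lren_upn_S in E1. apply lren_inj in E1; auto.
  - edestruct IHtr1 as (l1 & r1 & ? & E1 & E2); eauto.
    destruct l1 as [|[a|]|a]; try discriminate. destruct r1; try discriminate.
    injection E2; intros; subst.
    edestruct (IHtr2 f) as (l' & r' & ? & -> & ->); eauto. { rewrite nren_inst. auto. }
    exists l', r'. repeat split; auto. econstructor; eauto.
  - edestruct IHtr1 as (l1 & r1 & ? & E1 & E2); eauto.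
    destruct l1 as [|[a1|]|a1]; try discriminate. destruct r1; try discriminate.
    edestruct IHtr2 as (l2 & r2 & ? & E3 & E4); eauto.
    destruct l2 as [|[a2|]|a2]; try discriminate. destruct r2; try discriminate.
    simpl in *. injection E1; injection E3; injection E2; injection E4; intros; subst.
    match goal with H : f _ = f _ |- _ => apply Hf in H; subst end. exists LT, (RP (cap C0 F0)). repeat split.
    + eapply tr_cl; eauto.
    + simpl. rewrite cnren_cap; auto.
  - edestruct IHtr1 as (l1 & r1 & ? & E1 & E2); eauto.
    destruct l1 as [|[a1|]|a1]; try discriminate. destruct r1; try discriminate.
    edestruct IHtr2 as (l2 & r2 & ? & E3 & E4); eauto.
    destruct l2 as [|[a2|]|a2]; try discriminate. destruct r2; try discriminate.
    simpl in *. injection E1; injection E3; injection E2; injection E4; intros; subst.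
    match goal with H : f _ = f _ |- _ => apply Hf in H; subst end. exists LT, (RP (cap C0 F0)). repeat split.
    + eapply tr_cr; eauto.
    + simpl. rewrite cnren_cap; auto.
Qed.

Lemma S_inj x y : S x = S y -> x = y.
Proof. congruence. Qed.

Lemma tr_S_inv n U l r : tr n (nren S U) (lren S l) r -> exists r', tr n U l r' /\ r = rnren S r'.
Proof.
  intros H. eapply tr_nren_inv in H as (l' & r' & H & E & ->); eauto using S_inj.
  apply lren_inj in E; [|apply S_inj]. subst. eauto.
Qed.

Lemma cap_cpl C : forall F U, dsc (cap (cpl C U) F) (Pr (cap C F) U).
Proof.
  induction C; intros; simpl. { apply dsc_assoc. }
  rewrite IHC. apply dsc_ext.
Qed.
Lemma cap_cpr C F U : dsc (cap (cpr U C) F) (Pr U (cap C F)).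
Proof.
  rewrite dsc_comm, <- cap_cpl. apply ceq_cap; [|reflexivity]. symmetry; apply cpl_cpr.
Qed.
Lemma inst_Pr F G N : inst (Pr F G) N = Pr (inst F N) (inst G N).
Proof. reflexivity. Qed.
Lemma inst_Nu F N : inst (Nu F) N = Nu (inst F (nren S N)).
Proof.
  unfold inst; simpl. do 2 f_equal. extensionality x; destruct x; reflexivity.
Qed.
Lemma cap_wkr C : forall F U, dsc (cap C (Pr F (vren S U))) (Pr (cap C F) U).
Proof.
  induction C; intros; simpl.
  - rewrite inst_Pr, inst_wk. rewrite <- !dsc_assoc. rewrite (dsc_comm U T). reflexivity.
  - rewrite nren_vren, IHC. apply dsc_ext.
Qed.
Lemma cap_wkl C F U : dsc (cap C (Pr (vren S U) F)) (Pr U (cap C F)).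
Proof.
  rewrite (dsc_comm U), <- cap_wkr. apply ceq_cap; [reflexivity|]. apply dsc_comm.
Qed.
Lemma sw_upnS : (fun x => sw (upn S x)) = S.
Proof. extensionality x; destruct x; reflexivity. Qed.
Lemma sw_S : (fun x => sw (S x)) = upn S.
Proof. extensionality x; destruct x; reflexivity. Qed.
(** Scope extension seen by a neighbour's output: on the left the restriction on [T] is extruded
    although the emitted object does not mention it, so it can be pushed back onto the
    continuation. *)
Lemma CN_cpr C : forall T, ceq (CN (cpr T (cnren S C))) (cpr (Nu T) C).
Proof.
  induction C; intros; simpl.
  - rewrite ceq_scope. constructor; [reflexivity|]. apply dsc_ext.
  - rewrite ceq_swap, cnren_cpr, cnren_cnren, sw_upnS, nren_nren, sw_S. constructor. apply IHC.
Qed.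
Lemma Nu_cap C : forall F, dsc (Nu (cap (cnren S C) F)) (cap C (Nu F)).
Proof.
  induction C; intros; simpl.
  - rewrite inst_Nu. apply dsc_ext.
  - rewrite dsc_swap, cnren_cap, cnren_cnren, sw_upnS, nren_nren, sw_S, IHC. reflexivity.
Qed.
Lemma cpl_N0 C : ceq (cpl C N0) C.
Proof. induction C; simpl; constructor; auto; try reflexivity. apply dsc_nil. Qed.
Lemma cpl_cpl C : forall U W, ceq (cpl C (Pr U W)) (cpl (cpl C U) W).
Proof. induction C; intros; simpl; constructor; auto; try reflexivity. apply dsc_assoc. Qed.
Lemma cpr_cpl C : forall U W, ceq (cpr U (cpl C W)) (cpl (cpr U C) W).
Proof. induction C; intros; simpl; constructor; auto; try reflexivity. apply dsc_assoc. Qed.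
Lemma cpr_cpr C : forall U W, ceq (cpr U (cpr W C)) (cpr (Pr U W) C).
Proof. induction C; intros; simpl; constructor; auto; try reflexivity. apply dsc_assoc. Qed.

(** Inputs are compared by a parameter [R] because [tr_ap] feeds the body of an abstraction into a
    further transition, where an oriented relation is required. For processes and concretions the
    symmetric congruence suffices. *)
Definition rrel (R : dtm -> dtm -> Prop) r r' := match r, r' with
  | RP T, RP T' => dsc T T' | RI F, RI F' => R F F' | RO C, RO C' => ceq C C' | _, _ => False end.
Notation rfw := (rrel (fw true)).

Lemma rfw_refl r : rfw r r.
Proof. destruct r; simpl; try reflexivity. constructor. Qed.
Lemma rfw_trans r r' r'' : rfw r r' -> rfw r' r'' -> rfw r r''.
Proof.
  destruct r, r', r''; simpl; try tauto; intros; try (etransitivity; eauto; fail). econstructor; eauto.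
Qed.
Lemma rfw_rparl r r' U U' : rfw r r' -> fw true U U' -> rfw (rparl r U) (rparl r' U').
Proof.
  destruct r, r'; simpl; try tauto; intros.
  - apply Pr_dsc; auto. apply dsc_fw; auto.
  - constructor; auto. apply fw_vren; auto.
  - apply ceq_cpl; auto. apply dsc_fw; auto.
Qed.
Lemma rfw_rparr r r' U U' : rfw r r' -> fw true U U' -> rfw (rparr U r) (rparr U' r').
Proof.
  destruct r, r'; simpl; try tauto; intros.
  - apply Pr_dsc; auto. apply dsc_fw; auto.
  - constructor; auto. apply fw_vren; auto.
  - apply ceq_cpr; auto. apply dsc_fw; auto.
Qed.
Lemma rfw_rnu r r' : rfw r r' -> rfw (rnu r) (rnu r').
Proof.
  destruct r, r'; simpl; try tauto; intros.
  - apply Nu_dsc; auto.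
  - constructor; auto.
  - constructor; auto.
Qed.

Ltac inv H := inversion H; subst; clear H.

(** * Transitions of the two sides of each congruence axiom *)

Lemma root_nil n T l r : tr n (Pr T N0) l r -> exists r', tr n T l r' /\ rfw r r'.
Proof.
  intros H; inv H; try (match goal with H : tr _ N0 _ _ |- _ => inv H end).
  eexists; split; eauto. destruct r0; simpl.
  - apply dsc_nil.
  - constructor.
  - apply cpl_N0.
Qed.
Lemma root_nil' n T l r : tr n T l r -> exists r', tr n (Pr T N0) l r' /\ rfw r r'.
Proof.
  intros H. eexists; split; [apply tr_pl; eauto|]. destruct r; simpl.
  - symmetry. apply dsc_nil.
  - constructor.
  - symmetry. apply cpl_N0.
Qed.
Lemma root_comm n T U l r : tr n (Pr T U) l r -> exists r', tr n (Pr U T) l r' /\ rfw r r'.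
Proof.
  intros H; inv H.
  - eexists; split; [apply tr_pr; eauto|]. destruct r0; simpl; [apply dsc_comm|constructor|apply cpl_cpr].
  - eexists; split; [apply tr_pl; eauto|]. destruct r0; simpl; [apply dsc_comm|constructor|symmetry; apply cpl_cpr].
  - eexists; split; [eapply tr_cr; eauto|]. simpl; reflexivity.
  - eexists; split; [eapply tr_cl; eauto|]. simpl; reflexivity.
Qed.
Lemma tr_pl_i n T U s F : tr n T (LI s) (RI F) -> tr n (Pr T U) (LI s) (RI (Pr F (vren S U))).
Proof. intros H; apply tr_pl with (U := U) in H; auto. Qed.
Lemma tr_pr_i n T U s F : tr n U (LI s) (RI F) -> tr n (Pr T U) (LI s) (RI (Pr (vren S T) F)).
Proof. intros H; apply tr_pr with (T := T) in H; auto. Qed.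
Lemma tr_pl_o n T U s C : tr n T (LO s) (RO C) -> tr n (Pr T U) (LO s) (RO (cpl C U)).
Proof. intros H; apply tr_pl with (U := U) in H; auto. Qed.
Lemma tr_pr_o n T U s C : tr n U (LO s) (RO C) -> tr n (Pr T U) (LO s) (RO (cpr T C)).
Proof. intros H; apply tr_pr with (T := T) in H; auto. Qed.
Lemma tr_pl_t n T U T' : tr n T LT (RP T') -> tr n (Pr T U) LT (RP (Pr T' U)).
Proof. intros H; apply tr_pl with (U := U) in H; auto. Qed.
Lemma tr_pr_t n T U T' : tr n U LT (RP T') -> tr n (Pr T U) LT (RP (Pr T T')).
Proof. intros H; apply tr_pr with (T := T) in H; auto. Qed.

Lemma root_assoc n T U W l r : tr n (Pr T (Pr U W)) l r ->
  exists r', tr n (Pr (Pr T U) W) l r' /\ rfw r r'.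
Proof.
  intros H; inv H.
  - eexists; split; [apply tr_pl, tr_pl; eauto|].
    destruct r0; simpl; [apply dsc_assoc|constructor|apply cpl_cpl].
  - match goal with H : tr _ (Pr U W) _ _ |- _ => inv H end.
    + eexists; split; [apply tr_pl, tr_pr; eauto|].
      destruct r; simpl; [apply dsc_assoc|constructor|apply cpr_cpl].
    + eexists; split; [apply tr_pr; eauto|].
      destruct r; simpl; [apply dsc_assoc|constructor|apply cpr_cpr].
    + eexists; split; [eapply tr_cl; [apply tr_pr_i; eauto|eauto]|].
      simpl. symmetry; apply cap_wkl.
    + eexists; split; [eapply tr_cr; [eauto|apply tr_pr_o; eauto]|].
      simpl. symmetry; apply cap_cpr.
  - match goal with H : tr _ (Pr U W) _ _ |- _ => inversion H; subst end; destruct r; try discriminate;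
    match goal with H : _ = RO _ |- _ => injection H as <- end.
    + eexists; split; [eapply tr_pl_t, tr_cl; eauto|]. simpl. apply cap_cpl.
    + eexists; split; [eapply tr_cl; [apply tr_pl_i; eauto|eauto]|]. simpl.
      rewrite cap_wkr, cap_cpr. apply dsc_comm.
  - match goal with H : tr _ (Pr U W) _ _ |- _ => inversion H; subst end; destruct r; try discriminate;
    match goal with H : _ = RI _ |- _ => injection H as <- end.
    + eexists; split; [eapply tr_pl_t, tr_cr; eauto|]. simpl. apply cap_wkr.
    + eexists; split; [eapply tr_cr; [eauto|apply tr_pl_o; eauto]|]. simpl.
      rewrite cap_wkl, cap_cpl. apply dsc_comm.
Qed.

Lemma lren_sw_SS l : lren sw (lren S (lren S l)) = lren S (lren S l).
Proof. rewrite !lren_lren. reflexivity. Qed.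
Lemma root_swap n T l r : tr n (Nu (Nu T)) l r -> exists r', tr n (Nu (Nu (nren sw T))) l r' /\ rfw r r'.
Proof.
  intros H; inv H. match goal with H : tr _ (Nu _) _ _ |- _ => inv H end.
  match goal with H : tr _ T _ _ |- _ => apply (tr_nren _ _ _ _) with (f := sw) in H; rewrite lren_sw_SS in H end.
  eexists; split; [apply tr_nu, tr_nu; eauto|].
  destruct r; simpl; [apply dsc_swap|constructor|apply ceq_swap].
Qed.
Lemma root_ext n T U l r : tr n (Nu (Pr T (nren S U))) l r ->
  exists r', tr n (Pr (Nu T) U) l r' /\ rfw r r'.
Proof.
  intros H; inv H. match goal with H : tr _ (Pr _ _) _ _ |- _ => inv H end.
  - eexists; split; [apply tr_pl, tr_nu; eauto|].
    destruct r; simpl; [apply dsc_ext| |reflexivity].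
    rewrite <- nren_vren. constructor.
  - match goal with H : tr _ (nren S U) _ _ |- _ => apply tr_S_inv in H as (r' & H & ->) end.
    eexists; split; [apply tr_pr; eauto|].
    destruct r'; simpl; [apply dsc_ext|constructor|apply CN_cpr].
  - destruct l as [|[?|]|]; try discriminate.
    match goal with H : tr _ (nren S U) _ _ |- _ =>
      eapply tr_nren_inv in H as (l' & r' & H & E1 & E2); eauto using S_inj end.
    destruct l' as [|[?|]|]; try discriminate. destruct r'; try discriminate.
    injection E1; injection E2; intros; subst.
    match goal with H : tr _ T _ _ |- _ => apply (tr_nu _ _ (LI (Some _))) in H end.
    eexists; split; [eapply tr_cl; eauto|]. simpl. apply Nu_cap.
  - destruct l as [|[?|]|]; try discriminate.
    match goal with H : tr _ (nren S U) _ _ |- _ =>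
      eapply tr_nren_inv in H as (l' & r' & H & E1 & E2); eauto using S_inj end.
    destruct l' as [|[?|]|]; try discriminate. destruct r'; try discriminate.
    injection E1; injection E2; intros; subst.
    match goal with H : tr _ T _ _ |- _ => apply (tr_nu _ _ (LO _)) in H end.
    eexists; split; [eapply tr_cr; eauto|]. simpl; reflexivity.
Qed.
Lemma root_ext' n T U l r : tr n (Pr (Nu T) U) l r ->
  exists r', tr n (Nu (Pr T (nren S U))) l r' /\ rfw r r'.
Proof.
  intros H; inv H.
  - match goal with H : tr _ (Nu _) _ _ |- _ => inv H end.
    eexists; split; [apply tr_nu, tr_pl; eauto|].
    destruct r; simpl; [symmetry; apply dsc_ext| |reflexivity].
    rewrite <- nren_vren. constructor.
  - eexists; split; [apply tr_nu, tr_pr, tr_nren; eauto|].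
    destruct r0; simpl; [symmetry; apply dsc_ext|constructor|symmetry; apply CN_cpr].
  - match goal with H : tr _ (Nu _) _ _ |- _ => inversion H; subst end. destruct r; try discriminate.
    match goal with H : _ = RI _ |- _ => injection H as <- end.
    match goal with H : tr _ U _ _ |- _ => apply (tr_nren _ _ _ _) with (f := S) in H end.
    eexists; split; [apply tr_nu; simpl; eapply tr_cl; eauto|]. simpl. symmetry; apply Nu_cap.
  - match goal with H : tr _ (Nu _) _ _ |- _ => inversion H; subst end. destruct r; try discriminate.
    match goal with H : _ = RO _ |- _ => injection H as <- end.
    match goal with H : tr _ U _ _ |- _ => apply (tr_nren _ _ _ _) with (f := S) in H end.
    eexists; split; [apply tr_nu; simpl; eapply tr_cr; eauto|]. simpl; reflexivity.
Qed.

(** Outer induction on a bound for the beta count, inner induction on the derivation of [fw]. The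
    application case needs the outer one: its second premise concerns an instance, related by
    [fw_inst] rather than by a subderivation, but both premises have smaller counts. *)
Lemma fw_tr_aux K : forall T U, fw true T U -> forall n l r, n <= K -> tr n T l r ->
  exists n' r', n' <= n /\ tr n' U l r' /\ rfw r r'.
Proof.
  induction K as [K IHK] using lt_wf_ind.
  induction 1; intros n0 l r Hn Ht.
  - apply root_nil in Ht as (? & ? & ?); eauto 6.
  - apply root_nil' in Ht as (? & ? & ?); eauto 6.
  - apply root_assoc in Ht as (? & ? & ?); eauto 6.
  - apply root_comm in Ht as (? & ? & ?); eauto 6.
  - apply root_swap in Ht as (? & ? & ?); eauto 6.
  - inv Ht. match goal with H : tr _ _ _ _ |- _ => inv H end. destruct l as [|[?|]|]; discriminate.
  - inv Ht.
  - inv Ht. match goal with H : tr _ _ _ _ |- _ => inv H end. destruct l as [|[?|]|]; discriminate.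
  - inv Ht.
  - apply root_ext in Ht as (? & ? & ?); eauto 6.
  - apply root_ext' in Ht as (? & ? & ?); eauto 6.
  (* Contracting the redex in advance saves the step that [tr_ap] counted. *)
  - inv Ht. match goal with H : tr _ (La _) _ _ |- _ => inv H end.
    exists k, r. repeat split; auto using rfw_refl; lia.
  - exists n0, r; auto using rfw_refl.
  - apply IHfw1 in Ht as (n1 & r1 & ? & Ht & ?); auto.
    apply IHfw2 in Ht as (n2 & r2 & ? & Ht & ?); [|lia].
    exists n2, r2. repeat split; auto; [lia|]. eapply rfw_trans; eauto.
  - inv Ht. exists 0, (RI T'). split; [lia|split; [constructor|simpl; auto]].
  - inv Ht. exists 0, (RO (CB A' T')). split; [lia|split; [constructor|]].
    simpl. constructor; apply dsc_fw; auto.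
  - inv Ht.
    + match goal with H : tr _ T _ _ |- _ => apply IHfw1 in H as (n1 & r1 & ? & ? & ?); auto end.
      exists n1, (rparl r1 U'). repeat split; auto using tr_pl, tr_pr, tr_nu, rfw_rparl.
    + match goal with H : tr _ U _ _ |- _ => apply IHfw2 in H as (n1 & r1 & ? & ? & ?); auto end.
      exists n1, (rparr T' r1). repeat split; auto using tr_pl, tr_pr, tr_nu, rfw_rparr.
    + match goal with H : tr _ T _ _ |- _ => apply IHfw1 in H as (n1 & r1 & ? & ? & ?); [|lia] end.
      match goal with H : tr _ U _ _ |- _ => apply IHfw2 in H as (n2 & r2 & ? & ? & ?); [|lia] end.
      destruct r1; try contradiction. destruct r2; try contradiction.
      eexists _, _. repeat split; [|eapply tr_cl; eauto|]; [lia|].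
      simpl in *. apply ceq_cap; auto. apply dsc_fw; auto.
    + match goal with H : tr _ T _ _ |- _ => apply IHfw1 in H as (n1 & r1 & ? & ? & ?); [|lia] end.
      match goal with H : tr _ U _ _ |- _ => apply IHfw2 in H as (n2 & r2 & ? & ? & ?); [|lia] end.
      destruct r1; try contradiction. destruct r2; try contradiction.
      eexists _, _. repeat split; [|eapply tr_cr; eauto|]; [lia|].
      simpl in *. apply ceq_cap; auto. apply dsc_fw; auto.
  - inv Ht. match goal with H : tr _ T _ _ |- _ => apply IHfw in H as (n1 & r1 & ? & ? & ?); [|lia] end.
    exists n1, (rnu r1). repeat split; auto using tr_pl, tr_pr, tr_nu, rfw_rnu.
  - inv Ht. exists 0, (RI T'). split; [lia|split; [constructor|simpl; auto]].
  - inv Ht.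
    match goal with H1 : tr _ T _ _, H2 : tr _ (inst _ _) _ _ |- _ => rename H1 into Ht1; rename H2 into Ht2 end.
    assert (K1 : K - 1 < K) by lia. assert (Hn1 : n <= K - 1) by lia. assert (Hk1 : k <= K - 1) by lia.
    destruct (IHK _ K1 _ _ H _ _ _ Hn1 Ht1) as (n1 & r1 & ? & ? & R1).
    destruct r1 as [|F'|]; try contradiction. simpl in R1.
    destruct (IHK _ K1 _ _ (fw_inst _ _ _ _ _ R1 H0) _ _ _ Hk1 Ht2) as (n2 & r2 & ? & ? & ?).
    eexists _, _. repeat split; [|eapply tr_ap; eauto|auto]. lia.
Qed.

Lemma fw_tr T U n l r : fw true T U -> tr n T l r ->
  exists n' r', n' <= n /\ tr n' U l r' /\ rfw r r'.
Proof. intros; eapply fw_tr_aux; eauto. Qed.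

(** * Standardization *)

(** Weak head reduction: it works only along the operator position, the one that [tr_ap]
    inspects. *)
Inductive hred : dtm -> dtm -> Prop :=
| hr_beta T N : hred (Ap (La T) N) (inst T N)
| hr_ap M M' N : hred M M' -> hred (Ap M N) (Ap M' N).
Notation hreds := (clos_refl_trans_1n dtm hred).

(* A standard reduction sequence: head steps, then reductions below the head constructor. *)
Inductive std_red : dtm -> dtm -> Prop :=
| k_n T : hreds T N0 -> std_red T N0
| k_v T x : hreds T (V x) -> std_red T (V x)
| k_in T a F F' : hreds T (In_ a F) -> std_red F F' -> std_red T (In_ a F')
| k_ou T a A U A' U' : hreds T (Ou a A U) -> std_red A A' -> std_red U U' -> std_red T (Ou a A' U')
| k_pr T A U A' U' : hreds T (Pr A U) -> std_red A A' -> std_red U U' -> std_red T (Pr A' U')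
| k_nu T F F' : hreds T (Nu F) -> std_red F F' -> std_red T (Nu F')
| k_la T F F' : hreds T (La F) -> std_red F F' -> std_red T (La F')
| k_ap T A U A' U' : hreds T (Ap A U) -> std_red A A' -> std_red U U' -> std_red T (Ap A' U').

Lemma hreds_trans T U W : hreds T U -> hreds U W -> hreds T W.
Proof. induction 1; auto. intros. econstructor; eauto. Qed.
Lemma std_red_hreds T U W : hreds T U -> std_red U W -> std_red T W.
Proof.
  intros H K; inversion K; subst; clear K; econstructor; eauto using hreds_trans.
Qed.
Lemma std_red_refl T : std_red T T.
Proof. induction T; econstructor; eauto using rt1n_refl. Qed.
Lemma hreds_map (C : dtm -> dtm) : (forall T U, hred T U -> hred (C T) (C U)) ->
  forall T U, hreds T U -> hreds (C T) (C U).
Proof. intros H T U; induction 1; econstructor; eauto. Qed.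
Lemma hred_nren f T U : hred T U -> hred (nren f T) (nren f U).
Proof. induction 1; simpl; [rewrite nren_inst|]; constructor; auto. Qed.
Lemma hred_vsub s T U : hred T U -> hred (vsub s T) (vsub s U).
Proof. induction 1; simpl; [rewrite vsub_inst|]; constructor; auto. Qed.
Lemma hred_vren s T U : hred T U -> hred (vren s T) (vren s U).
Proof. rewrite !vren_V. apply hred_vsub. Qed.
Lemma std_red_nren T U : std_red T U -> forall f, std_red (nren f T) (nren f U).
Proof.
  induction 1; intros; simpl; econstructor; eauto;
  match goal with H : hreds _ _ |- _ => apply (hreds_map _ (hred_nren f)) in H; exact H end.
Qed.
Lemma std_red_vren T U : std_red T U -> forall f, std_red (vren f T) (vren f U).
Proof.
  induction 1; intros; simpl; econstructor; eauto;
  match goal with H : hreds _ _ |- _ => apply (hreds_map _ (hred_vren f)) in H; exact H end.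
Qed.
(** The substituted values reduce together with the term, because expanding a [tr_ap] derivation
    reduces both the abstraction and its argument. *)
Lemma std_red_vsub T U : std_red T U -> forall s t, (forall x, std_red (s x) (t x)) -> std_red (vsub s T) (vsub t U).
Proof.
  assert (Up : forall s t, (forall x, std_red (s x) (t x)) -> forall x, std_red (up s x) (up t x)).
  { intros s t H [|x]; simpl; [apply std_red_refl|apply std_red_vren; auto]. }
  induction 1; intros s t Hs; simpl;
  match goal with H : hreds _ _ |- _ => apply (hreds_map _ (hred_vsub s)) in H end;
  try (econstructor; eauto; fail).
  - eapply std_red_hreds; eauto.
  - econstructor; eauto. apply IHstd_red. intros; apply std_red_nren; auto.
Qed.
Lemma std_red_inst F F' N N' : std_red F F' -> std_red N N' -> std_red (inst F N) (inst F' N').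
Proof. intros; apply std_red_vsub; auto. intros [|x]; simpl; auto. apply std_red_refl. Qed.

Lemma hreds_fw T U : hreds T U -> fw true T U.
Proof.
  assert (forall T U, hred T U -> fw true T U).
  { induction 1; constructor; auto. constructor. }
  induction 1; [constructor|econstructor; eauto].
Qed.
Lemma std_red_dsc T U : std_red T U -> dsc T U.
Proof.
  induction 1; match goal with H : hreds _ _ |- _ => apply hreds_fw, dsc_fw in H; rewrite H end;
  try reflexivity; repeat match goal with H : dsc _ _ |- _ => rewrite H; clear H end; reflexivity.
Qed.

Lemma tr_hreds T U : hreds T U -> forall n l r, tr n U l r -> exists m, tr m T l r.
Proof.
  assert (S1 : forall T U, hred T U -> forall n l r, tr n U l r -> exists m, tr m T l r).
  { induction 1; intros n l r Ht.
    - eexists. eapply tr_ap; eauto. constructor.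
    - inv Ht. match goal with H : tr _ M' _ _ |- _ => apply IHhred in H as [m H] end.
      eexists. eapply tr_ap; eauto. }
  induction 1; eauto. intros. apply IHclos_refl_trans_1n in H1 as [m H1]; eauto.
Qed.

Notation rkas := (rrel std_red).
(** This is transport of transitions along beta-expansion. Induction on the transition of the
    reduct: the leading head steps expose in [T] the head constructor of [U] and are absorbed by
    [tr_hreds]; the reductions below it go to the induction hypotheses. *)
Lemma std_red_tr n U l r : tr n U l r -> forall T, std_red T U -> exists m r', tr m T l r' /\ rkas r' r.
Proof.
  assert (Fin : forall T U l r, hreds T U -> (exists m r', tr m U l r' /\ rkas r' r) ->
     exists m r', tr m T l r' /\ rkas r' r).
  { intros T U' l' r' H (m & r'' & H1 & H2). destruct (tr_hreds _ _ H _ _ _ H1); eauto. }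
  induction 1; intros T0 K; inversion K; subst; eapply Fin; eauto.
  - exists 0, (RI F). split; simpl; auto. constructor.
  - exists 0, (RI F). split; simpl; auto. constructor.
  - exists 0, (RO (CB A0 U)). split; simpl; auto; constructor; apply std_red_dsc; auto.
  - match goal with K1 : std_red _ T, K2 : std_red _ U |- _ => rename K1 into KT, K2 into KU end.
    destruct (IHtr _ KT) as (m & r' & ? & R). eexists m, (rparl r' _). split; [constructor; auto|].
    destruct r', r; simpl in *; try contradiction.
    + rewrite R, (std_red_dsc _ _ KU); reflexivity.
    + econstructor; [apply rt1n_refl| |]; auto using std_red_vren.
    + apply ceq_cpl; auto using std_red_dsc.
  - match goal with K1 : std_red _ T, K2 : std_red _ U |- _ => rename K1 into KT, K2 into KU end.
    destruct (IHtr _ KU) as (m & r' & ? & R). eexists m, (rparr _ r'). split; [constructor; auto|].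
    destruct r', r; simpl in *; try contradiction.
    + rewrite R, (std_red_dsc _ _ KT); reflexivity.
    + econstructor; [apply rt1n_refl| |]; auto using std_red_vren.
    + apply ceq_cpr; auto using std_red_dsc.
  - match goal with K1 : std_red _ T |- _ => rename K1 into KT end.
    destruct (IHtr _ KT) as (m & r' & ? & R). exists m, (rnu r'). split; [constructor; auto|].
    destruct r', r; simpl in *; try contradiction.
    + rewrite R; reflexivity.
    + econstructor; [apply rt1n_refl|]; auto.
    + constructor; auto.
  - match goal with K1 : std_red _ M, K2 : std_red _ N |- _ => rename K1 into KT, K2 into KU end.
    destruct (IHtr1 _ KT) as (m & r' & ? & R). destruct r' as [|F'|]; try contradiction.
    destruct (IHtr2 _ (std_red_inst _ _ _ _ R KU)) as (m' & r' & ? & ?).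
    eexists _, r'. split; auto. eapply tr_ap; eauto.
  - match goal with K1 : std_red _ T, K2 : std_red _ U |- _ => rename K1 into KT, K2 into KU end.
    destruct (IHtr1 _ KT) as (m & r' & ? & R). destruct r' as [|F'|]; try contradiction.
    destruct (IHtr2 _ KU) as (m' & r' & ? & R'). destruct r' as [| |C']; try contradiction.
    eexists _, _. split; [eapply tr_cl; eauto|]. simpl in *. apply ceq_cap; auto using std_red_dsc.
  - match goal with K1 : std_red _ T, K2 : std_red _ U |- _ => rename K1 into KT, K2 into KU end.
    destruct (IHtr1 _ KU) as (m & r' & ? & R). destruct r' as [|F'|]; try contradiction.
    destruct (IHtr2 _ KT) as (m' & r' & ? & R'). destruct r' as [| |C']; try contradiction.
    eexists _, _. split; [eapply tr_cr; eauto|]. simpl in *. apply ceq_cap; auto using std_red_dsc.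
Qed.

Notation chain := (clos_refl_trans dtm (fun T U => fw false T U \/ std_red T U)).

Lemma chain_map (C : dtm -> dtm) : (forall T U, fw false T U -> fw false (C T) (C U)) ->
  (forall T U, std_red T U -> std_red (C T) (C U)) -> forall T U, chain T U -> chain (C T) (C U).
Proof.
  intros H1 H2 T U; induction 1.
  - apply rt_step. destruct H; auto.
  - apply rt_refl.
  - eapply rt_trans; eauto.
Qed.

(** A derivation may mix beta with the structural axioms at any depth. Cut into links, it consists
    of reversible steps and of standard reductions, and transitions can be carried backwards along
    either kind. *)
Lemma fw_chain T U : fw true T U -> chain T U.
Proof.
  assert (R := rt1n_refl dtm hred).
  induction 1; try (apply rt_step; left; constructor; fail).
  - apply rt_step. right. eapply std_red_hreds; [|apply std_red_refl]. econstructor; constructor.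
  - eapply rt_trans; eauto.
  - apply (chain_map (In_ a)); auto; intros; apply fw_in || eapply k_in; eauto.
  - eapply rt_trans.
    + apply (chain_map (fun x => Ou a x T)); eauto; intros; apply fw_ou || eapply k_ou; eauto using std_red_refl, fw_refl.
    + apply (chain_map (fun x => Ou a A' x)); eauto; intros; apply fw_ou || eapply k_ou; eauto using std_red_refl, fw_refl.
  - eapply rt_trans.
    + apply (chain_map (fun x => Pr x U)); eauto; intros; apply fw_pr || eapply k_pr; eauto using std_red_refl, fw_refl.
    + apply (chain_map (fun x => Pr T' x)); eauto; intros; apply fw_pr || eapply k_pr; eauto using std_red_refl, fw_refl.
  - apply (chain_map Nu); auto; intros; apply fw_nu || eapply k_nu; eauto.
  - apply (chain_map La); auto; intros; apply fw_la || eapply k_la; eauto.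
  - eapply rt_trans.
    + apply (chain_map (fun x => Ap x U)); eauto; intros; apply fw_ap || eapply k_ap; eauto using std_red_refl, fw_refl.
    + apply (chain_map (fun x => Ap T' x)); eauto; intros; apply fw_ap || eapply k_ap; eauto using std_red_refl, fw_refl.
Qed.

Notation req := (rrel dsc).
Lemma req_refl r : req r r.
Proof. destruct r; simpl; reflexivity. Qed.
Lemma req_sym r r' : req r r' -> req r' r.
Proof. destruct r, r'; simpl; try tauto; intros; symmetry; auto. Qed.
Lemma req_trans r r' r'' : req r r' -> req r' r'' -> req r r''.
Proof. destruct r, r', r''; simpl; try tauto; intros; etransitivity; eauto. Qed.
Lemma req_mono (R : dtm -> dtm -> Prop) r r' : (forall T U, R T U -> dsc T U) -> rrel R r r' -> req r r'.
Proof. destruct r, r'; simpl; auto. Qed.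

(** * Congruence is a strong bisimulation *)

Definition sims T U := forall n l r, tr n T l r -> exists m r', tr m U l r' /\ req r r'.
Lemma sims_trans T U W : sims T U -> sims U W -> sims T W.
Proof.
  intros H1 H2 n l r H. apply H1 in H as (m & r1 & H & ?). apply H2 in H as (m2 & r2 & H & ?).
  eauto using req_trans.
Qed.
Lemma sims_fw T U : fw true T U -> sims T U.
Proof.
  intros H n l r Ht. eapply fw_tr in H as (m & r' & _ & ? & ?); eauto.
  exists m, r'; split; auto. eapply req_mono; [|eauto]. apply dsc_fw.
Qed.

Lemma dsc_sims T U : dsc T U -> sims T U /\ sims U T.
Proof.
  induction 1 as [T U H| | |].
  - split; [apply sims_fw; auto|]. apply fw_chain in H. induction H as [T U [H|H]| |].
    + apply sims_fw. apply fw_sym in H. eapply fw_weaken; eauto.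
    + intros n l r Ht. eapply std_red_tr in H as (m & r' & ? & ?); eauto.
      exists m, r'; split; auto. apply req_sym. eapply req_mono; [|eauto]. apply std_red_dsc.
    + intros n l r ?; eauto using req_refl.
    + eapply sims_trans; eauto.
  - split; intros n l r ?; eauto using req_refl.
  - tauto.
  - destruct IHclos_refl_sym_trans1, IHclos_refl_sym_trans2. split; eapply sims_trans; eauto.
Qed.

Lemma harmony T U n l r : dsc T U -> tr n T l r -> exists m r', tr m U l r' /\ req r r'.
Proof. intros H; apply dsc_sims in H as [H _]; apply H. Qed.

Lemma harmony_t T U n T' : dsc T U -> tr n T LT (RP T') -> exists m U', tr m U LT (RP U') /\ dsc T' U'.
Proof.
  intros H Ht. eapply harmony in Ht as (m & [U'| |] & ? & R); eauto; try contradiction.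
Qed.
Lemma harmony_i T U n s F : dsc T U -> tr n T (LI s) (RI F) -> exists m F', tr m U (LI s) (RI F') /\ dsc F F'.
Proof.
  intros H Ht. eapply harmony in Ht as (m & [|F'|] & ? & R); eauto; try contradiction.
Qed.
Lemma harmony_o T U n a C : dsc T U -> tr n T (LO a) (RO C) -> exists m C', tr m U (LO a) (RO C') /\ ceq C C'.
Proof.
  intros H Ht. eapply harmony in Ht as (m & [| |C'] & ? & R); eauto; try contradiction.
Qed.

(** * Weak transitions *)

Inductive ws : dtm -> dtm -> Prop :=
| ws_refl T T' : dsc T T' -> ws T T'
| ws_step n T T1 T' : tr n T LT (RP T1) -> ws T1 T' -> ws T T'.

Lemma ws_dsc_l T U : ws T U -> forall T', dsc T' T -> ws T' U.
Proof.
  induction 1; intros.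
  - apply ws_refl. rewrite H0; auto.
  - symmetry in H1. eapply harmony_t in H as (m & U' & ? & ?); eauto.
    eapply ws_step; eauto. apply IHws. symmetry; auto.
Qed.
Lemma ws_dsc_r T U U' : ws T U -> dsc U U' -> ws T U'.
Proof.
  induction 1; intros.
  - apply ws_refl. rewrite H; auto.
  - eapply ws_step; eauto.
Qed.
#[global] Instance ws_proper : Proper (dsc ==> dsc ==> iff) ws.
Proof.
  intros T T' H U U' H'; split; intros.
  - eapply ws_dsc_r; [eapply ws_dsc_l; eauto; symmetry|]; auto.
  - eapply ws_dsc_r; [eapply ws_dsc_l; eauto|]; symmetry; auto.
Qed.
Lemma ws_trans T U W : ws T U -> ws U W -> ws T W.
Proof.
  induction 1; intros.
  - eapply ws_dsc_l; eauto.
  - eapply ws_step; eauto.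
Qed.
Lemma ws_map (C : dtm -> dtm) : Proper (dsc ==> dsc) C ->
  (forall n T U, tr n T LT (RP U) -> exists m, tr m (C T) LT (RP (C U))) ->
  forall T U, ws T U -> ws (C T) (C U).
Proof.
  intros P H T U; induction 1.
  - apply ws_refl. rewrite H0. reflexivity.
  - apply H in H0 as [m ?]. eapply ws_step; eauto.
Qed.
Lemma ws_pl T T' U : ws T T' -> ws (Pr T U) (Pr T' U).
Proof.
  apply (ws_map (fun x => Pr x U)).
  - intros x y E; rewrite E; reflexivity.
  - intros; eauto using tr_pl_t.
Qed.
Lemma tr_nu_t n T T' : tr n T LT (RP T') -> tr n (Nu T) LT (RP (Nu T')).
Proof. intros H. apply (tr_nu _ _ LT) in H; auto. Qed.
Lemma ws_nu T T' : ws T T' -> ws (Nu T) (Nu T').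
Proof.
  apply (ws_map Nu); [apply Nu_dsc|]. intros; eauto using tr_nu_t.
Qed.
Lemma ws_nren f T T' : ws T T' -> ws (nren f T) (nren f T').
Proof.
  apply (ws_map (nren f)); [apply nren_dsc|].
  intros n T0 U H; exists n. apply (tr_nren _ _ _ _ H f).
Qed.
Lemma tr_nu_t_inv n T r : tr n (Nu T) LT r -> exists T', r = RP (Nu T') /\ tr n T LT (RP T').
Proof.
  intros H; inversion H; subst. apply tr_shape in H2 as E. destruct E as [T' ->].
  simpl; eauto.
Qed.
Lemma ws_nu_inv T U : ws (Nu T) U -> exists T', ws T T' /\ dsc U (Nu T').
Proof.
  intros H. remember (Nu T) as X. revert T HeqX. induction H; intros; subst.
  - exists T0. split; [apply ws_refl; reflexivity|symmetry; auto].
  - apply tr_nu_t_inv in H as (T2 & E & ?). injection E as ->.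
    destruct (IHws _ eq_refl) as (T3 & ? & ?). exists T3; split; auto. eapply ws_step; eauto.
Qed.
Lemma ws_nren_inv f T U : (forall x y, f x = f y -> x = y) -> ws (nren f T) U ->
  exists T', ws T T' /\ dsc U (nren f T').
Proof.
  intros Hf H. remember (nren f T) as X. revert T HeqX. induction H; intros; subst.
  - exists T0. split; [apply ws_refl; reflexivity|symmetry; auto].
  - eapply tr_nren_inv in H as (l' & r' & H & E1 & E2); eauto.
    destruct l' as [|[?|]|]; try discriminate. destruct r'; try discriminate. injection E2 as ->.
    destruct (IHws _ eq_refl) as (T3 & ? & ?). exists T3; split; auto. eapply ws_step; eauto.
Qed.

(** Silent moves made after an output but before the object is delivered: they act on the
    continuation, under the extruded binders. *)
Inductive cws : conc -> conc -> Prop :=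
| cws_b A T T' : ws T T' -> cws (CB A T) (CB A T')
| cws_n C C' : cws C C' -> cws (CN C) (CN C').

Lemma cws_nren C C' : cws C C' -> forall f, cws (cnren f C) (cnren f C').
Proof. induction 1; intros; simpl; constructor; auto using ws_nren. Qed.
Lemma cws_refl C : cws C C.
Proof. induction C; constructor; auto. apply ws_refl; reflexivity. Qed.

Lemma csw_csw C : cnren sw (cnren sw C) = C.
Proof.
  rewrite cnren_cnren. etransitivity; [|apply cnren_id]. f_equal.
  extensionality x; destruct x as [|[|x]]; reflexivity.
Qed.

(** Both directions are proved together because [ceq] contains its own symmetry rule. *)
Lemma ceq_cws C D : ceq C D -> (forall C', cws C C' -> exists D', cws D D' /\ ceq C' D')
   /\ (forall D', cws D D' -> exists C', cws C C' /\ ceq C' D').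
Proof.
  induction 1.
  - split; intros X HX; inv HX.
    + exists (CB A' T'0). split; [constructor; rewrite <- H0; auto|]. constructor; auto. reflexivity.
    + exists (CB A T'0). split; [constructor; rewrite H0; auto|]. constructor; auto. reflexivity.
  - destruct IHceq as [I1 I2]. split; intros X HX; inv HX.
    + apply I1 in H1 as (D' & ? & ?). exists (CN D'). split; constructor; auto.
    + apply I2 in H1 as (D' & ? & ?). exists (CN D'). split; constructor; auto.
  - split; intros X HX; inv HX.
    + inv H0. exists (CB A (Nu T')). split; [constructor; apply ws_nu; auto|]. constructor.
    + apply ws_nu_inv in H2 as (T2 & ? & ?). exists (CN (CB (nren S A) T2)).
      split; [do 2 constructor; auto|]. rewrite ceq_scope. constructor; [reflexivity|symmetry; auto].
  - split; intros X HX; inv HX; inv H0.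
    + eexists (CN (CN (cnren sw _))). split; [do 2 constructor; apply cws_nren; eauto|]. apply ceq_swap.
    + match goal with H : cws (cnren sw C) ?Y |- _ =>
        apply cws_nren with (f := sw) in H; rewrite csw_csw in H;
        exists (CN (CN (cnren sw Y))); split; [do 2 constructor; auto|] end.
      rewrite ceq_swap, csw_csw. reflexivity.
  - destruct IHceq as [I1 I2]. split; intros X HX.
    + apply I2 in HX as (D' & ? & ?). exists D'; split; auto. symmetry; auto.
    + apply I1 in HX as (D' & ? & ?). exists D'; split; auto. symmetry; auto.
  - destruct IHceq1 as [I1 I2], IHceq2 as [I3 I4]. split; intros X HX.
    + apply I1 in HX as (D' & HX & ?). apply I3 in HX as (D'' & ? & ?). exists D''; split; auto. etransitivity; eauto.
    + apply I4 in HX as (D' & HX & ?). apply I2 in HX as (D'' & ? & ?). exists D''; split; auto. etransitivity; eauto.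
Qed.

(** * Typing *)

Inductive dwt : (nat -> ty) -> list ty -> dtm -> ty -> Prop :=
| dwt_n D G : dwt D G N0 TProc
| dwt_v D G x s : nth_error G x = Some s -> dwt D G (V x) s
| dwt_in D G a T : dwt D (D a :: G) T TProc -> dwt D G (In_ a T) TProc
| dwt_ou D G a A T : dwt D G A (D a) -> dwt D G T TProc -> dwt D G (Ou a A T) TProc
| dwt_pr D G T U : dwt D G T TProc -> dwt D G U TProc -> dwt D G (Pr T U) TProc
| dwt_nu D G s T : dwt (scons s D) G T TProc -> dwt D G (Nu T) TProc
| dwt_la D G T : dwt D (TAbs :: G) T TProc -> dwt D G (La T) TAbs
| dwt_ap D G T U : dwt D G T TAbs -> dwt D G U TAbs -> dwt D G (Ap T U) TProc.

Fixpoint nf (x : nat) (T : dtm) : Prop :=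
  match T with
  | N0 | V _ => False
  | In_ a T => x = a \/ nf x T
  | Ou a A T => x = a \/ nf x A \/ nf x T
  | Pr T U | Ap T U => nf x T \/ nf x U
  | Nu T => nf (S x) T
  | La T => nf x T
  end.

Lemma nren_ext T : forall f g, (forall x, nf x T -> f x = g x) -> nren f T = nren g T.
Proof.
  induction T; intros f g H; simpl in *; f_equal; auto.
  apply IHT. intros [|x] Hx; simpl; auto.
Qed.
Lemma nf_nren T : forall f y, nf y (nren f T) <-> exists x, nf x T /\ y = f x.
Proof.
  induction T; intros f y; simpl.
  - firstorder.
  - firstorder.
  - rewrite IHT. split; [intros [->|(x & ? & ->)]; eauto|intros (x & [->|?] & ->); eauto].
  - rewrite IHT1, IHT2. split.
    + intros [->|[(x & ? & ->)|(x & ? & ->)]]; eauto.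
    + intros (x & [->|[?|?]] & ->); eauto 6.
  - rewrite IHT1, IHT2. split.
    + intros [(x & ? & ->)|(x & ? & ->)]; eauto.
    + intros (x & [?|?] & ->); eauto 6.
  - rewrite IHT. split.
    + intros ([|x] & ? & E); simpl in E; [discriminate|]. injection E as ->. eauto.
    + intros (x & ? & ->). exists (S x); auto.
  - auto.
  - rewrite IHT1, IHT2. split.
    + intros [(x & ? & ->)|(x & ? & ->)]; eauto.
    + intros (x & [?|?] & ->); eauto 6.
Qed.
Lemma nf_vren T : forall g y, nf y (vren g T) <-> nf y T.
Proof. induction T; intros; simpl; rewrite ?IHT, ?IHT1, ?IHT2; tauto. Qed.
Lemma nf_vsub T : forall s y, nf y (vsub s T) -> nf y T \/ exists x, nf y (s x).
Proof.
  assert (U : forall s y x, nf y (up s x) -> exists x, nf y (s x)).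
  { intros s y [|x]; simpl; [tauto|]. rewrite nf_vren. eauto. }
  induction T; intros s y; simpl.
  - tauto.
  - eauto.
  - intros [->|H]; auto. apply IHT in H as [?|[x ?]]; eauto.
  - intros [->|[H|H]]; auto. apply IHT1 in H as [?|?]; auto. apply IHT2 in H as [?|?]; auto.
  - intros [H|H]; [apply IHT1 in H as [?|?]|apply IHT2 in H as [?|?]]; auto.
  - intros H. apply IHT in H as [?|[x H]]; auto. apply nf_nren in H as (z & ? & E).
    injection E as ->. eauto.
  - intros H. apply IHT in H as [?|[x ?]]; eauto.
  - intros [H|H]; [apply IHT1 in H as [?|?]|apply IHT2 in H as [?|?]]; auto.
Qed.
Lemma nf_inst F N y : nf y (inst F N) -> nf y F \/ nf y N.
Proof. intros H. apply nf_vsub in H as [?|[[|x] ?]]; simpl in *; tauto. Qed.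
Lemma nf_bound T : exists b, forall x, nf x T -> x < b.
Proof.
  induction T; simpl;
  try destruct IHT as [b Hb]; try destruct IHT1 as [b1 Hb1], IHT2 as [b2 Hb2].
  - exists 0; tauto.
  - exists 0; tauto.
  - exists (S (n + b)). intros x [->|H]; [|apply Hb in H]; lia.
  - exists (S (n + b1 + b2)). intros x [->|[H|H]]; [|apply Hb1 in H|apply Hb2 in H]; lia.
  - exists (b1 + b2). intros x [H|H]; [apply Hb1 in H|apply Hb2 in H]; lia.
  - exists b. intros x H; apply Hb in H; lia.
  - exists b; auto.
  - exists (b1 + b2). intros x [H|H]; [apply Hb1 in H|apply Hb2 in H]; lia.
Qed.

Lemma dwt_nren D G T s : dwt D G T s -> forall D' f, (forall x, nf x T -> D x = D' (f x)) ->
  dwt D' G (nren f T) s.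
Proof.
  induction 1; intros D' f Hf; simpl in *; try (econstructor; eauto; fail).
  - constructor. rewrite <- Hf; auto.
  - constructor; auto. rewrite <- Hf; auto.
  - apply dwt_nu with s. apply IHdwt. intros [|x] Hx; simpl; auto.
Qed.
Lemma dwt_nren_inv T : forall D D' G f s, dwt D' G (nren f T) s -> (forall x, D x = D' (f x)) ->
  dwt D G T s.
Proof.
  induction T; intros D D' G f s H Hf; simpl in *; inv H; try (econstructor; eauto; fail).
  - constructor. rewrite Hf; eauto.
  - constructor; eauto. rewrite Hf; eauto.
  - apply dwt_nu with s0. eapply IHT; eauto. intros [|x]; simpl; auto.
Qed.
Lemma dwt_D D D' G T s : dwt D G T s -> (forall x, nf x T -> D x = D' x) -> dwt D' G T s.
Proof. intros H H'. rewrite <- (nren_id T). eapply dwt_nren; eauto. Qed.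
Lemma dwt_vren D G T s : dwt D G T s -> forall G' g,
  (forall x s, nth_error G x = Some s -> nth_error G' (g x) = Some s) -> dwt D G' (vren g T) s.
Proof.
  induction 1; intros G' g Hg; simpl; try (econstructor; eauto; fail).
  - constructor. apply IHdwt. intros [|x]; simpl; auto.
  - constructor. apply IHdwt. intros [|x]; simpl; auto.
Qed.
Lemma dwt_wk D G T s t : dwt D G T s -> dwt D (t :: G) (vren S T) s.
Proof. intros; eapply dwt_vren; eauto. Qed.
Lemma dwt_nwk D G T s t : dwt D G T s -> dwt (scons t D) G (nren S T) s.
Proof. intros; eapply dwt_nren; eauto. Qed.
Lemma dwt_vsub D G T s : dwt D G T s -> forall G' v,
  (forall x s, nth_error G x = Some s -> dwt D G' (v x) s) -> dwt D G' (vsub v T) s.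
Proof.
  assert (U : forall D G G' v t, (forall x s, nth_error G x = Some s -> dwt D G' (v x) s) ->
     forall x s, nth_error (t :: G) x = Some s -> dwt D (t :: G') (up v x) s).
  { intros D0 G0 G' v t Hv [|x] s0 E; simpl in *; [constructor; auto|]. apply dwt_wk; auto. }
  induction 1; intros G' v Hv; simpl; auto; try (econstructor; eauto; fail).
  apply dwt_nu with s. apply IHdwt. intros. apply dwt_nwk; auto.
Qed.
Lemma dwt_inst D G F N s t : dwt D (t :: G) F s -> dwt D G N t -> dwt D G (inst F N) s.
Proof.
  intros. eapply dwt_vsub; eauto. intros [|x] u E; simpl in *; [congruence|constructor; auto].
Qed.
Lemma dwt_app_ctx D G G' T s : dwt D G T s -> dwt D (G ++ G') T s.
Proof.
  intros H. rewrite <- (vsub_V T). eapply dwt_vsub; eauto. intros x u E. constructor.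
  rewrite nth_error_app1; auto. apply nth_error_Some. congruence.
Qed.
Lemma dwt_vsub_ext D G T s : dwt D G T s -> forall v w,
  (forall x, x < length G -> v x = w x) -> vsub v T = vsub w T.
Proof.
  assert (U : forall n v w, (forall x, x < n -> v x = w x) -> forall x, x < S n -> up v x = up w x).
  { intros n v w H [|x] Hx; simpl; auto. rewrite H; auto; lia. }
  induction 1; intros v w Hv; simpl in *; try (f_equal; eauto; fail).
  - apply Hv. apply nth_error_Some. congruence.
  - f_equal. apply IHdwt. intros; apply Hv in H0 as E. unfold nup; rewrite E; auto.
Qed.
Lemma dwt_closed D T s v : dwt D [] T s -> vsub v T = T.
Proof. intros H. rewrite <- (vsub_V T) at 2. eapply dwt_vsub_ext; eauto. simpl; lia. Qed.

Fixpoint cwt (D : nat -> ty) (G : list ty) (t : ty) (C : conc) : Prop :=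
  match C with
  | CB A T => dwt D G A t /\ dwt D G T TProc
  | CN C => exists s, cwt (scons s D) G t C
  end.
Lemma cwt_cpl C : forall D G t U, cwt D G t C -> dwt D G U TProc -> cwt D G t (cpl C U).
Proof.
  induction C; simpl; intros; [split; try constructor; tauto|].
  destruct H as [s ?]. exists s. apply IHC; auto. apply dwt_nwk; auto.
Qed.
Lemma cwt_cpr C : forall D G t U, cwt D G t C -> dwt D G U TProc -> cwt D G t (cpr U C).
Proof.
  induction C; simpl; intros; [split; try constructor; tauto|].
  destruct H as [s ?]. exists s. apply IHC; auto. apply dwt_nwk; auto.
Qed.
Lemma cwt_cap C : forall D G t F, cwt D G t C -> dwt D (t :: G) F TProc -> dwt D G (cap C F) TProc.
Proof.
  induction C; simpl; intros.
  - constructor; [eapply dwt_inst|]; intuition eauto.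
  - destruct H as [s ?]. apply dwt_nu with s. eapply IHC; eauto. apply dwt_nwk; auto.
Qed.

Lemma tr_dwt n T l r : tr n T l r -> forall D G s, dwt D G T s ->
  match l, r with
  | LT, RP T' => s = TProc /\ dwt D G T' TProc
  | LI (Some a), RI F => s = TProc /\ dwt D (D a :: G) F TProc
  | LI None, RI F => s = TAbs /\ dwt D (TAbs :: G) F TProc
  | LO a, RO C => s = TProc /\ cwt D G (D a) C
  | _, _ => False
  end.
Proof.
  induction 1; intros D G s Hw; inv Hw; simpl; auto.
  - match goal with H : dwt _ _ T _ |- _ => apply IHtr in H as IH end.
    destruct l as [|[a|]|a], r; simpl; try tauto; destruct IH as [E IH]; try discriminate; split; auto.
    + constructor; auto.
    + constructor; auto using dwt_wk.
    + apply cwt_cpl; auto.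
  - match goal with H : dwt _ _ U _ |- _ => apply IHtr in H as IH end.
    destruct l as [|[a|]|a], r; simpl; try tauto; destruct IH as [E IH]; try discriminate; split; auto.
    + constructor; auto.
    + constructor; auto using dwt_wk.
    + apply cwt_cpr; auto.
  - match goal with H : dwt _ _ T _ |- _ => apply IHtr in H as IH end.
    destruct l as [|[a|]|a], r; simpl in *; try tauto; destruct IH as [E IH]; try discriminate; split; auto.
    + econstructor; eauto.
    + econstructor; eauto.
    + eauto.
  - match goal with H : dwt _ _ M _ |- _ => apply IHtr1 in H as [_ IH] end.
    apply IHtr2. eapply dwt_inst; eauto.
  - match goal with H : dwt _ _ T _ |- _ => apply IHtr1 in H as [_ IH1] end.
    match goal with H : dwt _ _ U _ |- _ => apply IHtr2 in H as [_ IH2] end.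
    split; auto. eapply cwt_cap; eauto.
  - match goal with H : dwt _ _ U _ |- _ => apply IHtr1 in H as [_ IH1] end.
    match goal with H : dwt _ _ T _ |- _ => apply IHtr2 in H as [_ IH2] end.
    split; auto. eapply cwt_cap; eauto.
Qed.
Lemma tr_dwt_t n T T' D G s : tr n T LT (RP T') -> dwt D G T s -> dwt D G T' TProc.
Proof. intros H Hw. apply (tr_dwt _ _ _ _ H) in Hw. tauto. Qed.
Lemma tr_dwt_i n T a F D G s : tr n T (LI (Some a)) (RI F) -> dwt D G T s -> dwt D (D a :: G) F TProc.
Proof. intros H Hw. apply (tr_dwt _ _ _ _ H) in Hw. tauto. Qed.
Lemma tr_dwt_o n T a C D G s : tr n T (LO a) (RO C) -> dwt D G T s -> cwt D G (D a) C.
Proof. intros H Hw. apply (tr_dwt _ _ _ _ H) in Hw. tauto. Qed.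

(** * Translation of named terms *)

(** Variables are interpreted by terms rather than indices, so that named substitution and de Bruijn
    instantiation both become an update of [e]. *)
Fixpoint tl (r : name -> nat) (e : var -> dtm) (T : term) : dtm :=
  match T with
  | Nil => N0
  | Var X => e X
  | Inp a X T => In_ (r a) (tl r (upd (fun x => vren S (e x)) X (V 0)) T)
  | Out a A T => Ou (r a) (tl r e A) (tl r e T)
  | Par T U => Pr (tl r e T) (tl r e U)
  | Res c T => Nu (tl (upd (fun x => S (r x)) c 0) (nup e) T)
  | Abs X T => La (tl r (upd (fun x => vren S (e x)) X (V 0)) T)
  | App T U => Ap (tl r e T) (tl r e U)
  end.

Lemma upd_eq {A} (f : nat -> A) x v : upd f x v x = v.
Proof. unfold upd. rewrite Nat.eqb_refl; auto. Qed.
Lemma upd_neq {A} (f : nat -> A) x v y : y <> x -> upd f x v y = f y.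
Proof. intros. unfold upd. apply Nat.eqb_neq in H. rewrite H; auto. Qed.
Ltac upds := repeat match goal with
  | |- context [upd ?f ?x ?v ?x] => rewrite upd_eq
  | H : context [upd ?f ?x ?v ?x] |- _ => rewrite upd_eq in H
  | H : ?y <> ?x |- context [upd ?f ?x ?v ?y] => rewrite (upd_neq f x v y H)
  | H : ?y <> ?x, H' : context [upd ?f ?x ?v ?y] |- _ => rewrite (upd_neq f x v y H) in H'
  end.

Lemma in_remove_iff (x y : nat) l : In x (remove Nat.eq_dec y l) <-> In x l /\ x <> y.
Proof.
  split; intros; [apply in_remove in H; auto|]. apply in_in_remove; tauto.
Qed.

Lemma tl_ext T : forall r r' e e', (forall x, In x (fn T) -> r x = r' x) ->
  (forall X, In X (fv T) -> e X = e' X) -> tl r e T = tl r' e' T.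
Proof.
  induction T; intros r r' e e' Hr He; simpl in *;
  repeat match goal with H : forall x, In x (_ :: _) -> _ |- _ =>
    pose proof (H _ (or_introl eq_refl)); assert (forall x, In x _ -> r x = r' x) by (intros; apply H; right; eassumption); clear H end;
  f_equal; auto.
  - apply IHT; auto. intros X HX. destruct (Nat.eq_dec X v); subst; upds; auto.
    rewrite He; auto. apply in_remove_iff; auto.
  - apply IHT1; intros; auto with datatypes.
  - apply IHT2; intros; auto with datatypes.
  - apply IHT1; intros; auto with datatypes.
  - apply IHT2; intros; auto with datatypes.
  - apply IHT; intros x Hx.
    + destruct (Nat.eq_dec x n); subst; upds; auto. rewrite Hr; auto. apply in_remove_iff; auto.
    + unfold nup. rewrite He; auto.
  - apply IHT; auto. intros X HX. destruct (Nat.eq_dec X v); subst; upds; auto.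
    rewrite He; auto. apply in_remove_iff; auto.
  - apply IHT1; intros; auto with datatypes.
  - apply IHT2; intros; auto with datatypes.
Qed.
Lemma upd_map {A B} (g : A -> B) f x v : (fun y => g (upd f x v y)) = upd (fun y => g (f y)) x (g v).
Proof. extensionality y. unfold upd. destruct (y =? x); auto. Qed.
Lemma tl_vsub T : forall r e s, vsub s (tl r e T) = tl r (fun X => vsub s (e X)) T.
Proof.
  induction T; intros; simpl; f_equal; auto.
  - rewrite IHT, upd_map. f_equal. simpl. f_equal. extensionality X. apply vsub_wk.
  - rewrite IHT. f_equal. extensionality X. unfold nup. apply vsub_nup.
  - rewrite IHT, upd_map. f_equal. simpl. f_equal. extensionality X. apply vsub_wk.
Qed.
Lemma tl_vren T r e g : vren g (tl r e T) = tl r (fun X => vren g (e X)) T.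
Proof. rewrite vren_V, tl_vsub. f_equal. extensionality X. symmetry; apply vren_V. Qed.
Lemma tl_nren T : forall r e f, nren f (tl r e T) = tl (fun x => f (r x)) (fun X => nren f (e X)) T.
Proof.
  induction T; intros; simpl; f_equal; auto.
  - rewrite IHT, upd_map. f_equal. simpl. f_equal. extensionality X. apply nren_vren.
  - rewrite IHT, upd_map. f_equal. extensionality X. unfold nup. apply nren_S_upn.
  - rewrite IHT, upd_map. f_equal. simpl. f_equal. extensionality X. apply nren_vren.
Qed.
Lemma tl_res_fresh c T r e : ~ In c (fn T) ->
  tl (upd (fun x => S (r x)) c 0) (nup e) T = nren S (tl r e T).
Proof.
  intros H. rewrite tl_nren. apply tl_ext; intros; auto.
  rewrite upd_neq; [auto|intros ->; auto].
Qed.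
Lemma tl_var_fresh Y T r e v : ~ In Y (fv T) -> tl r (upd (fun x => vren S (e x)) Y v) T = vren S (tl r e T).
Proof.
  intros H. rewrite tl_vren. apply tl_ext; intros; auto.
  rewrite upd_neq; [auto|intros ->; auto].
Qed.

Lemma upd_upd_eq {A} (f : nat -> A) x v w : upd (upd f x v) x w = upd f x w.
Proof. extensionality y. unfold upd. destruct (y =? x); auto. Qed.
Lemma upd_comm {A} (f : nat -> A) x y v w : x <> y -> upd (upd f x v) y w = upd (upd f y w) x v.
Proof.
  intros. extensionality z. unfold upd. destruct (z =? y) eqn:E1, (z =? x) eqn:E2; auto.
  apply Nat.eqb_eq in E1, E2. congruence.
Qed.

Lemma tl_subst T : forall A X r e, subst_safe A T ->
  tl r e (subst A X T) = tl r (upd e X (tl r e A)) T.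
Proof.
  unfold subst_safe.
  assert (Bnd : forall A X Y r e T, (forall r e, tl r e (subst A X T) = tl r (upd e X (tl r e A)) T) ->
     ~ In Y (fv A) -> X <> Y ->
     tl r (upd (fun x => vren S (e x)) Y (V 0)) (subst A X T) =
     tl r (upd (fun x => vren S (upd e X (tl r e A) x)) Y (V 0)) T).
  { intros A X Y r e T0 IH HY HX. rewrite IH, tl_var_fresh; auto.
    rewrite upd_map, upd_comm; auto. }
  induction T; intros A X r e [Hn Hv]; simpl in *; auto.
  - unfold upd. rewrite (Nat.eqb_sym v X). destruct (X =? v); auto.
  - destruct (X =? v) eqn:E; simpl.
    + apply Nat.eqb_eq in E; subst. rewrite upd_map, upd_upd_eq; auto.
    + apply Nat.eqb_neq in E. f_equal. apply Bnd; auto.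
  - f_equal; [apply IHT1|apply IHT2]; split; intros; auto with datatypes.
  - f_equal; [apply IHT1|apply IHT2]; split; intros; auto with datatypes.
  - f_equal. rewrite IHT; auto. f_equal. unfold nup. rewrite upd_map. f_equal.
    apply tl_res_fresh. auto.
  - destruct (X =? v) eqn:E; simpl.
    + apply Nat.eqb_eq in E; subst. rewrite upd_map, upd_upd_eq; auto.
    + apply Nat.eqb_neq in E. f_equal. apply Bnd; auto.
  - f_equal; [apply IHT1|apply IHT2]; split; intros; auto with datatypes.
Qed.

Lemma tl_rename_name T : forall c d r e, ~ In d (names T) ->
  tl r e (rename_name c d T) = tl (upd r c (r d)) e T.
Proof.
  assert (R : forall c d a (r : name -> nat), r (if a =? c then d else a) = upd r c (r d) a).
  { intros. unfold upd. destruct (a =? c); auto. }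
  induction T; intros c d r e H; simpl in *; rewrite ?in_app_iff in *; auto.
  - rewrite R. f_equal. apply IHT; tauto.
  - rewrite R. f_equal; [apply IHT1|apply IHT2]; tauto.
  - f_equal; [apply IHT1|apply IHT2]; tauto.
  - destruct (n =? c) eqn:E; simpl.
    + apply Nat.eqb_eq in E; subst. rewrite upd_map, upd_upd_eq; auto.
    + apply Nat.eqb_neq in E. f_equal. rewrite IHT; [|tauto]. f_equal.
      rewrite upd_map, upd_comm; auto. f_equal. rewrite upd_neq; [auto|intros ->; tauto].
  - f_equal. auto.
  - f_equal; [apply IHT1|apply IHT2]; tauto.
Qed.
Lemma tl_rename_var T : forall X Y r e, ~ In Y (vars T) ->
  tl r e (rename_var X Y T) = tl r (upd e X (e Y)) T.
Proof.
  induction T; intros X Y r e H; simpl in *; rewrite ?in_app_iff in *; auto.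
  - unfold upd. destruct (v =? X); auto.
  - destruct (v =? X) eqn:E; simpl.
    + apply Nat.eqb_eq in E; subst. rewrite upd_map, upd_upd_eq; auto.
    + apply Nat.eqb_neq in E. f_equal. rewrite IHT; [|tauto]. f_equal.
      rewrite upd_map, (upd_comm _ v X); auto. f_equal. rewrite upd_neq; [auto|intros ->; tauto].
  - f_equal; [apply IHT1|apply IHT2]; tauto.
  - f_equal; [apply IHT1|apply IHT2]; tauto.
  - f_equal. rewrite IHT; auto. unfold nup. rewrite upd_map; auto.
  - destruct (v =? X) eqn:E; simpl.
    + apply Nat.eqb_eq in E; subst. rewrite upd_map, upd_upd_eq; auto.
    + apply Nat.eqb_neq in E. f_equal. rewrite IHT; [|tauto]. f_equal.
      rewrite upd_map, (upd_comm _ v X); auto. f_equal. rewrite upd_neq; [auto|intros ->; tauto].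
  - f_equal; [apply IHT1|apply IHT2]; tauto.
Qed.
Lemma fn_names T x : In x (fn T) -> In x (names T).
Proof.
  induction T; simpl; rewrite ?in_app_iff, ?in_remove_iff; intuition.
Qed.
Lemma fv_vars T x : In x (fv T) -> In x (vars T).
Proof.
  induction T; simpl; rewrite ?in_app_iff, ?in_remove_iff; intuition.
Qed.
Lemma tl_alpha_res c d T r e : ~ In d (names T) ->
  tl r e (Res d (rename_name c d T)) = tl r e (Res c T).
Proof.
  intros H. simpl. rewrite tl_rename_name; auto. f_equal. apply tl_ext; auto. intros x Hx.
  upds. destruct (Nat.eq_dec x c); subst; upds; auto.
  rewrite upd_neq; [auto|intros ->; apply H, fn_names; auto].
Qed.
Lemma tl_alpha_var X Y T r e : ~ In Y (vars T) ->
  tl r (upd (fun x => vren S (e x)) Y (V 0)) (rename_var X Y T) =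
  tl r (upd (fun x => vren S (e x)) X (V 0)) T.
Proof.
  intros H. rewrite tl_rename_var; auto. apply tl_ext; auto. intros x Hx.
  upds. destruct (Nat.eq_dec x X); subst; upds; auto.
  rewrite upd_neq; [auto|intros ->; apply H, fv_vars; auto].
Qed.

Lemma tl_inst X T A r e :
  inst (tl r (upd (fun x => vren S (e x)) X (V 0)) T) (tl r e A) = tl r (upd e X (tl r e A)) T.
Proof.
  unfold inst. rewrite tl_vsub, upd_map. f_equal. simpl. f_equal.
  extensionality x. rewrite vsub_vren. apply vsub_V.
Qed.

Lemma sw_upd2 (r : nat -> nat) c d : c <> d ->
  (fun x => sw (upd (fun x => S (upd (fun x => S (r x)) c 0 x)) d 0 x)) =
  upd (fun x => S (upd (fun x => S (r x)) d 0 x)) c 0.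
Proof.
  intros H. extensionality x. unfold upd. destruct (x =? d) eqn:E1, (x =? c) eqn:E2; auto.
  apply Nat.eqb_eq in E1, E2. congruence.
Qed.

Lemma scong_dsc T T' : scong T T' -> forall r e, dsc (tl r e T) (tl r e T').
Proof.
  induction 1; intros r e; try (rewrite tl_alpha_res; [reflexivity|assumption]); simpl.
  - rewrite tl_alpha_var; [reflexivity|auto].
  - rewrite tl_alpha_var; [reflexivity|auto].
  - apply dsc_nil.
  - apply dsc_assoc.
  - apply dsc_comm.
  - destruct (Nat.eq_dec c d); [subst; reflexivity|].
    rewrite dsc_swap, tl_nren.
    match goal with |- dsc (Nu (Nu ?a)) (Nu (Nu ?b)) => replace a with b; [reflexivity|] end.
    f_equal. { symmetry; apply sw_upd2; auto. }
    extensionality x. unfold nup. rewrite sw_SS; auto.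
  - upds. apply dsc_fw. constructor.
  - upds. apply dsc_fw. constructor.
  - rewrite (tl_res_fresh c T2); auto. apply dsc_ext.
  - rewrite dsc_beta, tl_inst, tl_subst; auto. reflexivity.
  - reflexivity.
  - symmetry; auto.
  - etransitivity; eauto.
  - apply In_dsc; auto.
  - apply Ou_dsc; auto. reflexivity.
  - apply Ou_dsc; auto. reflexivity.
  - apply Pr_dsc; auto. reflexivity.
  - apply Pr_dsc; auto. reflexivity.
  - apply Nu_dsc; auto.
  - apply La_dsc; auto.
  - apply Ap_dsc; auto. reflexivity.
  - apply Ap_dsc; auto. reflexivity.
Qed.

(** Image of the residual of an [LOut cs a A] step as a concretion. *)
Fixpoint tlc (r : name -> nat) (e : var -> dtm) (cs : list name) (A T : term) : conc :=
  match cs with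
  | [] => CB (tl r e A) (tl r e T)
  | c :: cs => CN (tlc (upd (fun x => S (r x)) c 0) (nup e) cs A T)
  end.

Lemma tlc_nren cs A T : forall r e f,
  cnren f (tlc r e cs A T) = tlc (fun x => f (r x)) (fun X => nren f (e X)) cs A T.
Proof.
  induction cs; intros; simpl; [rewrite !tl_nren; auto|].
  rewrite IHcs, upd_map. do 2 f_equal. extensionality X. unfold nup. apply nren_S_upn.
Qed.
(** Needed for [st_res] on outputs: the named step keeps a restriction that the object does not
    mention, whereas [tr] extrudes it. *)
Lemma CN_tlc cs A T c : ~ In c cs -> ~ In c (fn A) -> forall r e,
  ceq (CN (tlc (upd (fun x => S (r x)) c 0) (nup e) cs A T)) (tlc r e cs A (Res c T)).
Proof.
  intros Hc HA. induction cs as [|d cs IH]; intros r e; simpl in *.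
  - rewrite (tl_res_fresh c A); auto. apply ceq_scope.
  - rewrite ceq_swap, tlc_nren. constructor. rewrite <- IH; [|tauto].
    match goal with |- ceq (CN ?a) (CN ?b) => replace a with b; [reflexivity|] end.
    f_equal.
    + symmetry; apply sw_upd2; auto.
    + extensionality X. unfold nup. rewrite sw_SS; auto.
Qed.
Lemma cpl_tlc cs A T U : (forall c, In c cs -> ~ In c (fn U)) -> forall r e,
  cpl (tlc r e cs A T) (tl r e U) = tlc r e cs A (Par T U).
Proof.
  intros H. induction cs as [|c cs IH]; intros; simpl; auto.
  rewrite <- IH; [|auto with datatypes]. rewrite (tl_res_fresh c U); auto with datatypes.
Qed.
Lemma cpr_tlc cs A T U : (forall c, In c cs -> ~ In c (fn U)) -> forall r e,
  cpr (tl r e U) (tlc r e cs A T) = tlc r e cs A (Par U T).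
Proof.
  intros H. induction cs as [|c cs IH]; intros; simpl; auto.
  rewrite <- IH; [|auto with datatypes]. rewrite (tl_res_fresh c U); auto with datatypes.
Qed.

Lemma step_out_subj T l T' : step T l T' -> match l with LOut cs a A => ~ In a cs | _ => True end.
Proof.
  induction 1; auto. intros [?|?]; auto.
Qed.

Definition step_img r e (T : term) (l : label) (T' : term) : Prop :=
  match l with
  | LTau => exists n T1, tr n (tl r e T) LT (RP T1) /\ dsc T1 (tl r e T')
  | LIn a A => exists n F, tr n (tl r e T) (LI (Some (r a))) (RI F) /\ dsc (inst F (tl r e A)) (tl r e T')
  | LOut cs a A => exists n C, tr n (tl r e T) (LO (r a)) (RO C) /\ ceq C (tlc r e cs A T')
  end.

(** The hypothesis ranges over all interpretations because the received object may mention the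
    extruded [cs]. It is used with these names bound; as none of them is free in [T1], the
    transition obtained is the weakening of one under the original interpretation. *)
Lemma comm_img T1 T1' T2' a A : (forall r e, step_img r e T1 (LIn a A) T1') -> forall cs,
  ~ In a cs -> (forall c, In c cs -> ~ In c (fn T1)) -> forall r e,
  exists n F, tr n (tl r e T1) (LI (Some (r a))) (RI F) /\
    dsc (cap (tlc r e cs A T2') F) (tl r e (news cs (Par T1' T2'))).
Proof.
  intros IH. induction cs as [|c cs IHcs]; intros Ha Hc r e; simpl.
  - destruct (IH r e) as (n & F & ? & E). exists n, F; split; auto. rewrite E; reflexivity.
  - destruct (IHcs (fun H => Ha (or_intror H)) (fun x H => Hc x (or_intror H))
      (upd (fun x => S (r x)) c 0) (nup e)) as (n & F & Ht & E).
    rewrite (tl_res_fresh c T1) in Ht; [|auto with datatypes].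
    rewrite upd_neq in Ht by (intros ->; apply Ha; left; auto).
    change (LI (Some (S (r a)))) with (lren S (LI (Some (r a)))) in Ht.
    apply tr_S_inv in Ht as (r' & Ht & E'). destruct r'; try discriminate.
    simpl in E'. injection E' as ->. exists n, F0. split; [apply Ht|]. unfold news in E. rewrite E. reflexivity.
Qed.

Lemma step_tr T l T' : step T l T' -> forall r e, step_img r e T l T'.
Proof.
  induction 1; intros r e; simpl.
  - eexists _, _; split; [constructor|]. rewrite tl_inst, tl_subst; auto. reflexivity.
  - eexists _, _; split; [constructor|]. reflexivity.
  - specialize (IHstep (upd (fun x => S (r x)) c 0) (nup e)). destruct l; simpl in *.
    + destruct IHstep as (n & T1 & ? & E). eexists _, _; split; [apply tr_nu_t; eauto|]. rewrite E; reflexivity.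
    + destruct IHstep as (k & F & Ht & E). rewrite upd_neq in Ht by tauto.
      apply (tr_nu _ _ (LI (Some (r n)))) in Ht. eexists _, _; split; [apply Ht|]. simpl.
      rewrite inst_Nu, <- E, tl_res_fresh; auto. reflexivity.
    + destruct IHstep as (k & C & Ht & E). rewrite in_app_iff in H0. simpl in H0.
      rewrite upd_neq in Ht by tauto.
      apply (tr_nu _ _ (LO (r n))) in Ht. eexists _, _; split; [apply Ht|]. simpl.
      rewrite E. apply CN_tlc; tauto.
  - destruct (IHstep (upd (fun x => S (r x)) d 0) (nup e)) as (k & C & Ht & E).
    rewrite upd_neq in Ht by auto. apply (tr_nu _ _ (LO (r a))) in Ht.
    eexists _, _; split; [apply Ht|]. constructor; auto.
  - specialize (IHstep r e). destruct l; simpl in *.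
    + destruct IHstep as (n & ? & ? & E). eexists _, _; split; [apply tr_pl_t; eauto|]. rewrite E; reflexivity.
    + destruct IHstep as (k & F & Ht & E). eexists _, _; split; [apply tr_pl_i; eauto|].
      rewrite inst_Pr, inst_wk, E. reflexivity.
    + destruct IHstep as (k & C & Ht & E). eexists _, _; split; [apply tr_pl_o; eauto|].
      rewrite <- cpl_tlc; auto. apply ceq_cpl; auto. reflexivity.
  - specialize (IHstep r e). destruct l; simpl in *.
    + destruct IHstep as (n & ? & ? & E). eexists _, _; split; [apply tr_pr_t; eauto|]. rewrite E; reflexivity.
    + destruct IHstep as (k & F & Ht & E). eexists _, _; split; [apply tr_pr_i; eauto|].
      rewrite inst_Pr, inst_wk, E. reflexivity.
    + destruct IHstep as (k & C & Ht & E). eexists _, _; split; [apply tr_pr_o; eauto|].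
      rewrite <- cpr_tlc; auto. apply ceq_cpr; auto. reflexivity.
  - apply step_out_subj in H0 as Ha.
    destruct (comm_img T1 T1' T2' a A IHstep1 cs Ha H1 r e) as (n & F & Ht & E).
    destruct (IHstep2 r e) as (k & C & ? & Ec).
    eexists _, _; split; [eapply tr_cl; eauto|]. rewrite <- E. apply ceq_cap; auto. reflexivity.
  - apply step_out_subj in H0 as Ha.
    destruct (comm_img T1 T1' T2' a A IHstep1 cs Ha H1 r e) as (n & F & Ht & E).
    destruct (IHstep2 r e) as (k & C & ? & Ec).
    eexists _, _; split; [eapply tr_cr; eauto|].
    transitivity (tl r e (news cs (Par T1' T2'))).
    + rewrite <- E. apply ceq_cap; auto. reflexivity.
    + apply scong_dsc. clear. induction cs; simpl; [apply sc_par_comm|apply sc_res; auto].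
  - specialize (IHstep r e). pose proof (scong_dsc _ _ H r e) as HP. symmetry in HP.
    pose proof (scong_dsc _ _ H1) as HQ. destruct l; simpl in *.
    + destruct IHstep as (n & ? & Ht & E). eapply harmony_t in Ht as (m & ? & ? & E'); eauto.
      eexists _, _; split; eauto. rewrite <- E', E; auto.
    + destruct IHstep as (k & F & Ht & E). eapply harmony_i in Ht as (m & ? & ? & E'); eauto.
      eexists _, _; split; eauto. rewrite <- E', E; auto.
    + destruct IHstep as (k & C & Ht & E). eapply harmony_o in Ht as (m & ? & ? & E'); eauto.
      eexists _, _; split; eauto. rewrite <- E', E.
      clear - HQ. revert r e. induction l; intros; simpl; constructor; auto. reflexivity.
Qed.

Lemma tau_star_ws Q Q' : tau_star Q Q' -> forall r e, ws (tl r e Q) (tl r e Q').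
Proof.
  induction 1; intros r e.
  - apply step_tr with (r := r) (e := e) in H. destruct H as (n & T1 & ? & E).
    eapply ws_step; eauto. apply ws_refl; auto.
  - apply ws_refl; reflexivity.
  - eapply ws_trans; eauto.
Qed.

Lemma wt_dwt D G T s : wt D G T s -> forall D' G' r e, (forall x, In x (fn T) -> D x = D' (r x)) ->
  (forall X, In X (fv T) -> dwt D' G' (e X) (G X)) -> dwt D' G' (tl r e T) s.
Proof.
  induction 1; intros D' G' r e Hr He; simpl in *; auto; try (econstructor; eauto; fail).
  - constructor. apply IHwt; auto. intros Y HY. destruct (Nat.eq_dec Y X); subst; upds.
    + constructor. simpl. rewrite Hr; auto.
    + apply dwt_wk, He, in_remove_iff; auto.
  - constructor; [rewrite <- Hr; auto; apply IHwt1|apply IHwt2]; intros; auto with datatypes.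
  - constructor; [apply IHwt1|apply IHwt2]; intros; auto with datatypes.
  - apply dwt_nu with s. apply IHwt.
    + intros x Hx. destruct (Nat.eq_dec x c); subst; upds; simpl; auto.
      apply Hr, in_remove_iff; auto.
    + intros. apply dwt_nwk; auto.
  - constructor. apply IHwt; auto. intros Y HY. destruct (Nat.eq_dec Y X); subst; upds.
    + constructor; auto.
    + apply dwt_wk, He, in_remove_iff; auto.
  - constructor; [apply IHwt1|apply IHwt2]; intros; auto with datatypes.
Qed.

Lemma upd_V (g : nat -> nat) X : upd (fun x => V (S (g x))) X (V 0) = (fun x => V (upd (fun x => S (g x)) X 0 x)).
Proof. rewrite upd_map. reflexivity. Qed.

Lemma dwt_fv T : forall D G r g s, dwt D G (tl r (fun x => V (g x)) T) s ->
  forall X, In X (fv T) -> g X < length G.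
Proof.
  induction T; intros D G r g s H X HX; simpl in *; try (rewrite upd_V in H);
  rewrite ?in_app_iff, ?in_remove_iff in HX; inv H; try tauto.
  - destruct HX as [<-|[]]. apply nth_error_Some. congruence.
  - destruct HX. match goal with H : dwt _ _ _ _ |- _ => eapply IHT in H; eauto end. upds. simpl in *. lia.
  - destruct HX; eauto.
  - destruct HX; eauto.
  - unfold nup in *. simpl in *. eauto.
  - destruct HX. match goal with H : dwt _ _ _ _ |- _ => eapply IHT in H; eauto end. upds. simpl in *. lia.
  - destruct HX; eauto.
Qed.

Lemma dwt_wt T : forall D' G' r g s, dwt D' G' (tl r (fun x => V (g x)) T) s -> forall D G,
  (forall x, In x (fn T) -> D x = D' (r x)) ->
  (forall X, In X (fv T) -> nth_error G' (g X) = Some (G X)) -> wt D G T s.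
Proof.
  induction T; intros D' G' r g s H D G Hr HX; simpl in *; try (rewrite upd_V in H); inv H.
  - constructor.
  - assert (E : s = G v). { specialize (HX v (or_introl eq_refl)). congruence. }
    subst. constructor.
  - constructor. eapply IHT; eauto. intros Y HY. destruct (Nat.eq_dec Y v); subst; upds; simpl.
    + rewrite Hr; auto.
    + apply HX, in_remove_iff; auto.
  - constructor; [rewrite Hr; auto; eapply IHT1|eapply IHT2]; eauto; intros; auto with datatypes.
  - constructor; [eapply IHT1|eapply IHT2]; eauto; intros; auto with datatypes.
  - apply wt_res with s0. eapply IHT; eauto.
    intros x Hx. destruct (Nat.eq_dec x n); subst; upds; simpl; auto.
    apply Hr, in_remove_iff; auto.
  - constructor. eapply IHT; eauto. intros Y HY. destruct (Nat.eq_dec Y v); subst; upds; simpl; auto.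
    apply HX, in_remove_iff; auto.
  - constructor; [eapply IHT1|eapply IHT2]; eauto; intros; auto with datatypes.
Qed.

Notation tl0 := (tl (fun x => x) V).

Lemma dwt_fv_nil D r T s : dwt D [] (tl r V T) s -> fv T = [].
Proof.
  intros H. destruct (fv T) as [|X l] eqn:E; auto. exfalso.
  apply (dwt_fv T D [] r (fun x => x)) with (X := X) in H; [simpl in H; lia|rewrite E; left; auto].
Qed.
(** Typing in the empty context also yields closedness, since a free variable would be an index out
    of range. *)
Lemma proc_dwt P : proc P <-> dwt D0 [] (tl0 P) TProc.
Proof.
  split.
  - intros [E H]. eapply wt_dwt; eauto. rewrite E; simpl; tauto.
  - intros H. apply dwt_fv_nil in H as E. split; auto. eapply (dwt_wt _ _ _ _ (fun x => x)); eauto.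
    rewrite E; simpl; tauto.
Qed.

(** * From de Bruijn transitions back to named steps *)

Lemma bn_rename_name T c d : bnames (rename_name c d T) = bnames T /\ bvars (rename_name c d T) = bvars T.
Proof.
  induction T; simpl; repeat match goal with H : _ /\ _ |- _ => destruct H end; try destruct (_ =? _); simpl; split; congruence.
Qed.
Lemma bn_rename_var T c d : bnames (rename_var c d T) = bnames T /\ bvars (rename_var c d T) = bvars T.
Proof.
  induction T; simpl; repeat match goal with H : _ /\ _ |- _ => destruct H end; try destruct (_ =? _); simpl; split; congruence.
Qed.

Lemma fresh_ex (l : list nat) : exists x, ~ In x l.
Proof.
  exists (S (fold_right Nat.max 0 l)). intros H.
  assert (forall l x, In x l -> x <= fold_right Nat.max 0 l).
  { induction l0; simpl; intros x []; subst; [lia|]. apply IHl0 in H0. lia. }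
  apply H0 in H. lia.
Qed.

(** Alpha-conversion leaves the translation literally unchanged, so binders can be moved away from
    [L] without touching the transition being reflected. *)
Lemma freshen L T : exists T', scong T T' /\ (forall r e, tl r e T' = tl r e T) /\
  (forall c, In c (bnames T') -> ~ In c L) /\ (forall X, In X (bvars T') -> ~ In X L).
Proof.
  induction T;
  try destruct IHT as (T' & S1 & E1 & N1 & V1);
  try destruct IHT1 as (T1' & S1 & E1 & N1 & V1), IHT2 as (T2' & S2 & E2 & N2 & V2).
  - exists Nil; repeat split; simpl; auto using sc_refl.
  - exists (Var v); repeat split; simpl; auto using sc_refl.
  - destruct (fresh_ex (L ++ vars T')) as [Y HY]. rewrite in_app_iff in HY.
    exists (Inp n Y (rename_var v Y T')). destruct (bn_rename_var T' v Y) as [EA EB].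
    split; [|split; [|split]]; simpl; rewrite ?EA, ?EB; auto.
    + eapply sc_trans; [apply sc_inp; eauto|]. apply sc_alpha_inp; tauto.
    + intros r e. rewrite tl_alpha_var, E1; tauto.
    + intros X [<-|?]; auto.
  - exists (Out n T1' T2'). repeat split; simpl; intros; rewrite ?E1, ?E2; auto.
    + eapply sc_trans; [apply sc_out_obj; eauto|apply sc_out_cont; auto].
    + rewrite in_app_iff in H; destruct H; auto.
    + rewrite in_app_iff in H; destruct H; auto.
  - exists (Par T1' T2'). repeat split; simpl; intros; rewrite ?E1, ?E2; auto.
    + eapply sc_trans; [apply sc_par_l; eauto|apply sc_par_r; auto].
    + rewrite in_app_iff in H; destruct H; auto.
    + rewrite in_app_iff in H; destruct H; auto.
  - destruct (fresh_ex (L ++ names T')) as [d HY]. rewrite in_app_iff in HY.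
    exists (Res d (rename_name n d T')). destruct (bn_rename_name T' n d) as [EA EB].
    split; [|split; [|split]]; simpl bnames; simpl bvars; rewrite ?EA, ?EB; auto.
    + eapply sc_trans; [apply sc_res; eauto|]. apply sc_alpha_res; tauto.
    + intros r e. rewrite tl_alpha_res by tauto. simpl. rewrite E1; auto.
    + intros X [<-|?]; auto.
  - destruct (fresh_ex (L ++ vars T')) as [Y HY]. rewrite in_app_iff in HY.
    exists (Abs Y (rename_var v Y T')). destruct (bn_rename_var T' v Y) as [EA EB].
    split; [|split; [|split]]; simpl; rewrite ?EA, ?EB; auto.
    + eapply sc_trans; [apply sc_abs; eauto|]. apply sc_alpha_abs; tauto.
    + intros r e. rewrite tl_alpha_var, E1; tauto.
    + intros X [<-|?]; auto.
  - exists (App T1' T2'). repeat split; simpl; intros; rewrite ?E1, ?E2; auto.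
    + eapply sc_trans; [apply sc_app_l; eauto|apply sc_app_r; auto].
    + rewrite in_app_iff in H; destruct H; auto.
    + rewrite in_app_iff in H; destruct H; auto.
Qed.

Lemma step_scong P P1 l P' : scong P P1 -> step P1 l P' -> step P l P'.
Proof. intros; eapply st_struct; eauto using sc_refl. Qed.

(** Typing and closedness force the operator to be a literal [Abs]; once its binders avoid the names
    and variables of the argument, [sc_beta] applies. *)
Lemma app_unfold r M N D s F n : dwt D [] (tl r V (App M N)) s -> tr n (tl r V M) (LI None) (RI F) ->
  exists T', scong (App M N) T' /\ tl r V T' = inst F (tl r V N).
Proof.
  intros Hw Ht. simpl in Hw; inv Hw.
  match goal with H : dwt _ _ (tl r V M) _ |- _ => rename H into HM end.
  destruct (freshen (fn N ++ fv N) M) as (M' & S1 & E1 & N1 & V1).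
  rewrite <- (E1 r V) in *.
  destruct M'; simpl in *; try (inversion HM; fail).
  { inv HM. destruct v; discriminate. }
  inv Ht. exists (subst N v M'). split.
  - eapply sc_trans; [apply sc_app_l; eauto|]. apply sc_beta. split; intros x Hx HN.
    + apply N1 in Hx. apply Hx. auto with datatypes.
    + apply (V1 x); auto with datatypes.
  - rewrite tl_subst; [symmetry; apply (tl_inst v M' N r V)|]. split; intros x Hx HN.
    + apply N1 in Hx. apply Hx. auto with datatypes.
    + apply (V1 x); auto with datatypes.
Qed.

Lemma tr_step_in n X l rs : tr n X l rs -> forall b F, l = LI (Some b) -> rs = RI F ->
  forall r T D, X = tl r V T -> dwt D [] X TProc -> forall A, fv A = [] ->
  exists a T', b = r a /\ step T (LIn a A) T' /\ tl r V T' = inst F (tl r V A).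
Proof.
  induction 1; intros b F' El Er r' T0 D ET Hw A0 HA; try discriminate;
  destruct (freshen (fn A0) T0) as (T1 & S1 & E1 & N1 & V1); rewrite <- (E1 r' V) in ET;
  destruct T1; simpl in ET; try discriminate; injection ET; intros; subst.
  - injection El as <-. injection Er as <-. exists n, (subst A0 v T1).
    assert (subst_safe A0 T1).
    { split; [simpl in N1; auto|]. rewrite HA; simpl; auto. }
    split; auto. split; [eapply step_scong; eauto; constructor; auto|].
    rewrite tl_subst; auto. symmetry. apply (tl_inst v T1 A0 r' V).
  - destruct r; try discriminate. injection Er as <-. inv Hw.
    edestruct IHtr as (a & T' & -> & ? & E); eauto.
    exists a, (Par T' T1_2). split; auto. split; [eapply step_scong; eauto; constructor; auto|].
    simpl. rewrite inst_Pr, inst_wk, E; auto.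
  - destruct r; try discriminate. injection Er as <-. inv Hw.
    edestruct IHtr as (a & T' & -> & ? & E); eauto.
    exists a, (Par T1_1 T'). split; auto. split; [eapply step_scong; eauto; constructor; auto|].
    simpl. rewrite inst_Pr, inst_wk, E; auto.
  - destruct r; try discriminate. injection Er as <-. inv Hw.
    edestruct (IHtr (S b) F eq_refl eq_refl _ T1 (scons s D) eq_refl) with (A := A0)
      as (a & T' & Ea & ? & E); eauto.
    assert (a <> n0). { intros ->. upds. discriminate. }
    upds. injection Ea as ->.
    exists a, (Res n0 T'). split; auto. split.
    + eapply step_scong; eauto. constructor; auto. simpl in *. intros [?|?]; [congruence|].
      apply (N1 n0); auto.
    + simpl. rewrite inst_Nu. f_equal. change (nup V) with V. rewrite E. f_equal.
      apply (tl_res_fresh n0 A0 r' V). apply N1. simpl; auto.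
  - destruct (app_unfold r' T1_1 T1_2 D TProc F n) as (T2 & S2 & E2); auto.
    edestruct (IHtr2 _ _ eq_refl eq_refl r' T2) as (a & T' & -> & ? & E); eauto.
    { inv Hw. eapply dwt_inst; eauto. eapply (tr_dwt _ _ _ _ H); eauto. }
    exists a, T'. repeat split; auto. eapply step_scong; [|eauto]. eapply sc_trans; eauto.
Qed.

Lemma subst_notin A X T : ~ In X (fv T) -> subst A X T = T.
Proof.
  induction T; simpl; rewrite ?in_app_iff, ?in_remove_iff; intros H; auto; try (f_equal; tauto).
  - destruct (X =? v) eqn:E; auto. apply Nat.eqb_eq in E. exfalso; apply H; auto.
  - destruct (X =? v) eqn:E; auto. apply Nat.eqb_neq in E. f_equal. apply IHT. intros ?; apply H; auto.
  - destruct (X =? v) eqn:E; auto. apply Nat.eqb_neq in E. f_equal. apply IHT. intros ?; apply H; auto.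
Qed.

(** An abstraction with free names exactly [J] that is well typed whatever those channels carry,
    because it only receives on them and ignores what it gets. *)
Definition jt (J : list name) : term := Abs 0 (fold_right (fun j T => Inp j 0 T) Nil J).

Lemma jt_props J : fn (jt J) = J /\ fv (jt J) = [].
Proof.
  unfold jt; simpl. assert (fv (fold_right (fun j T => Inp j 0 T) Nil J) = []).
  { induction J; simpl; auto. rewrite IHJ; auto. }
  rewrite H; split; auto. clear H. induction J; simpl; congruence.
Qed.
Lemma jt_dwt J D G r e : dwt D G (tl r e (jt J)) TAbs.
Proof.
  simpl. constructor. generalize (upd (fun x => vren S (e x)) 0 (V 0)). generalize (TAbs :: G).
  induction J; intros; simpl; constructor; auto.
Qed.

(* Beta-expanding the body with a discarded argument adds arbitrary free names to a term;
   this lets [st_open] extrude every enclosing restriction. *)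
Lemma junk_proc J U D G r e : dwt D G (tl r e U) TProc ->
  exists U', scong U U' /\ incl J (fn U') /\ dwt D G (tl r e U') TProc.
Proof.
  intros Hw. destruct (freshen J U) as (U1 & S1 & E1 & N1 & _).
  destruct (fresh_ex (fv U1)) as [Z HZ]. destruct (jt_props J) as [EJ EV].
  exists (App (Abs Z U1) (jt J)). split; [|split].
  - eapply sc_trans; [exact S1|]. apply sc_sym.
    pose proof (sc_beta Z U1 (jt J)) as HB. rewrite subst_notin in HB; auto. apply HB.
    split; [rewrite EJ; auto|]. rewrite EV; simpl; auto.
  - intros x Hx. change (In x (fn U1 ++ fn (jt J))). rewrite EJ. auto with datatypes.
  - change (dwt D G (Ap (La (tl r (upd (fun x => vren S (e x)) Z (V 0)) U1)) (tl r e (jt J))) TProc).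
    constructor; [|apply jt_dwt]. rewrite tl_var_fresh; auto. constructor. apply dwt_wk.
    rewrite E1; auto.
Qed.
Lemma junk J A D r t : dwt D [] (tl r V A) t ->
  exists A', scong A A' /\ incl J (fn A') /\ dwt D [] (tl r V A') t.
Proof.
  destruct t.
  - apply junk_proc.
  - intros H. destruct A; simpl in H; inv H.
    + destruct v; discriminate.
    + match goal with H : dwt _ _ (tl _ _ A) _ |- _ => rename H into HA end.
      destruct (junk_proc J A D [TAbs] r _ HA) as (U & ? & ? & ?).
      exists (Abs v U). repeat split; auto using sc_abs. simpl. constructor; auto.
Qed.

(** The extruded names must avoid [L], and the names in [J] must occur in the object. The
    restriction case adds its own name to [J], since [st_open] applies only to a name free in the
    object while [tr] extrudes all of them. *)
Lemma tr_step_out n X l rs : tr n X l rs -> forall b C, l = LO b -> rs = RO C ->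
  forall r T D, X = tl r V T -> dwt D [] X TProc -> forall L J,
  exists cs a A T', b = r a /\ step T (LOut cs a A) T' /\ (forall c, In c cs -> ~ In c L) /\
    incl J (fn A) /\ ceq C (tlc r V cs A T') /\ cwt D [] (D b) (tlc r V cs A T').
Proof.
  induction 1; intros b C' El Er r' T0 D ET Hw L J; try discriminate;
  destruct (freshen L T0) as (T1 & S1 & E1 & N1 & V1); rewrite <- (E1 r' V) in ET;
  destruct T1; simpl in ET; try discriminate; injection ET; intros; subst.
  - injection El as <-. injection Er as <-. inv Hw.
    match goal with H : dwt _ _ (tl _ _ T1_1) _ |- _ => rename H into HA end.
    destruct (junk J _ _ _ _ HA) as (A' & SA & HJ & WA).
    exists [], n, A', T1_2. split; auto. split; [|split; [simpl; tauto|split; auto]].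
    + eapply step_scong; [eapply sc_trans; [eauto|apply sc_out_obj; eauto]|]. constructor.
    + simpl. split; auto. constructor; [apply scong_dsc; auto|reflexivity].
  - destruct r; try discriminate. injection Er as <-. inv Hw.
    edestruct (IHtr _ _ eq_refl eq_refl r' T1_1 D eq_refl) with (L := L ++ fn T1_2) (J := J)
      as (cs & a & A & T' & -> & St & HL & HJ & Ec & Wc); eauto.
    exists cs, a, A, (Par T' T1_2). split; auto. split; [|split; [|split; [auto|]]].
    + eapply step_scong; eauto. apply st_par_l; auto. simpl. intros c Hc HU.
      apply (HL c); auto with datatypes.
    + intros c Hc HU. apply (HL c); auto with datatypes.
    + rewrite <- cpl_tlc. 2: { intros c Hc HU. apply (HL c); auto with datatypes. }
      split; [apply ceq_cpl; auto; reflexivity|apply cwt_cpl; auto].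
  - destruct r; try discriminate. injection Er as <-. inv Hw.
    edestruct (IHtr _ _ eq_refl eq_refl r' T1_2 D eq_refl) with (L := L ++ fn T1_1) (J := J)
      as (cs & a & A & T' & -> & St & HL & HJ & Ec & Wc); eauto.
    exists cs, a, A, (Par T1_1 T'). split; auto. split; [|split; [|split; [auto|]]].
    + eapply step_scong; eauto. apply st_par_r; auto. simpl. intros c Hc HU.
      apply (HL c); auto with datatypes.
    + intros c Hc HU. apply (HL c); auto with datatypes.
    + rewrite <- cpr_tlc. 2: { intros c Hc HU. apply (HL c); auto with datatypes. }
      split; [apply ceq_cpr; auto; reflexivity|apply cwt_cpr; auto].
  - destruct r; try discriminate. injection Er as <-. inv Hw.
    edestruct (IHtr (S b) C eq_refl eq_refl _ T1 (scons s D) eq_refl) with (L := n0 :: L) (J := n0 :: J)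
      as (cs & a & A & T' & Ea & St & HL & HJ & Ec & Wc); eauto.
    assert (Han : a <> n0). { intros ->. upds. discriminate. }
    upds. injection Ea as ->.
    exists (n0 :: cs), a, A, T'. split; auto. split; [|split; [|split; [|split]]].
    + eapply step_scong; eauto. apply st_open; auto.
      * apply HJ; left; auto.
      * intros Hc. apply (HL _ Hc). left; auto.
    + intros c [<-|Hc] HU; [|apply (HL c); auto; right; auto]. apply (N1 n0); simpl; auto.
    + intros x Hx. apply HJ; right; auto.
    + simpl. constructor. auto.
    + simpl. exists s. auto.
  - destruct (app_unfold r' T1_1 T1_2 D TProc F n) as (T2 & S2 & E2); auto.
    edestruct (IHtr2 _ _ eq_refl eq_refl r' T2) with (L := L) (J := J)
      as (cs & a & A & T' & -> & St & HL & HJ & Ec & Wc); eauto.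
    { inv Hw. eapply dwt_inst; eauto. eapply (tr_dwt _ _ _ _ H); eauto. }
    exists cs, a, A, T'. repeat split; auto. eapply step_scong; [|eauto]. eapply sc_trans; eauto.
Qed.

Definition inj (f : nat -> nat) := forall x y, f x = f y -> x = y.
Lemma upd_inj r c : inj r -> inj (upd (fun x => S (r x)) c 0).
Proof.
  intros H x y. destruct (Nat.eq_dec x c), (Nat.eq_dec y c); subst; upds; try discriminate; auto.
Qed.

Lemma tl_res_fresh0 c T r : ~ In c (fn T) -> tl (upd (fun x => S (r x)) c 0) V T = nren S (tl r V T).
Proof. exact (tl_res_fresh c T r V). Qed.

(** Converse of [comm_img]. Injectivity of [r] identifies the subject of the reflected input with
    [a]. *)
Lemma comm_step T1 a A cs : ~ In a cs -> (forall c, In c cs -> ~ In c (fn T1)) -> fv A = [] ->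
  forall n r D F, inj r -> dwt D [] (tl r V T1) TProc -> tr n (tl r V T1) (LI (Some (r a))) (RI F) ->
  exists T1', step T1 (LIn a A) T1' /\
    forall T2', tl r V (news cs (Par T1' T2')) = cap (tlc r V cs A T2') F.
Proof.
  intros Ha Hc HA. induction cs as [|c cs IH]; intros n r D F Hi Hw Ht.
  - eapply tr_step_in in Ht as (a' & T' & Ea & ? & E); eauto. apply Hi in Ea. subst a'.
    exists T'. split; auto. intros; simpl. rewrite E; auto.
  - apply (tr_nren _ _ _ _) with (f := S) in Ht. simpl in Ht.
    rewrite <- (tl_res_fresh0 c) in Ht by auto with datatypes.
    replace (S (r a)) with (upd (fun x => S (r x)) c 0 a) in Ht
      by (rewrite upd_neq; auto; intros ->; apply Ha; left; auto).
    eapply IH in Ht as (T1' & ? & E).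
    + exists T1'. split; auto. intros. simpl. f_equal. apply E.
    + intros ?; apply Ha; right; auto.
    + auto with datatypes.
    + apply upd_inj; auto.
    + rewrite (tl_res_fresh0 c T1 r) by auto with datatypes. apply dwt_nwk with (t := TAbs); eauto.
Qed.

Lemma cwt_tlc_fv cs A T : forall D t r, cwt D [] t (tlc r V cs A T) -> fv A = [].
Proof.
  induction cs; simpl; intros D t r H; [eapply dwt_fv_nil; apply H|]. destruct H as [s H]; eauto.
Qed.

Lemma tr_step_tau n X l rs : tr n X l rs -> forall U, l = LT -> rs = RP U ->
  forall r T D, inj r -> X = tl r V T -> dwt D [] X TProc ->
  exists T', step T LTau T' /\ dsc (tl r V T') U /\ dwt D [] (tl r V T') TProc.
Proof.
  induction 1; intros U' El Er r' T0 D Hi ET Hw; try discriminate;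
  destruct T0; simpl in ET; try discriminate; try (injection ET; intros; subst).
  - destruct r; try discriminate. injection Er as <-. inv Hw.
    edestruct IHtr as (T' & ? & E & ?); eauto.
    exists (Par T' T0_2). split; [apply st_par_l; auto|]. simpl. split; [rewrite E; reflexivity|constructor; auto].
  - destruct r; try discriminate. injection Er as <-. inv Hw.
    edestruct IHtr as (T' & ? & E & ?); eauto.
    exists (Par T0_1 T'). split; [apply st_par_r; auto|]. simpl. split; [rewrite E; reflexivity|constructor; auto].
  - destruct r; try discriminate. injection Er as <-. inv Hw.
    destruct (IHtr _ eq_refl eq_refl _ T0 (scons s D) (upd_inj _ n0 Hi) eq_refl) as (T' & ? & E & ?); auto.
    exists (Res n0 T'). split; [apply st_res; auto|]. simpl. change (nup V) with V.
    split; [rewrite E; reflexivity|econstructor; eauto].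
  - destruct (app_unfold r' T0_1 T0_2 D TProc F n) as (T2 & S2 & E2); auto.
    edestruct (IHtr2 _ eq_refl eq_refl r' T2) as (T' & ? & ? & ?); eauto.
    { inv Hw. eapply dwt_inst; eauto. eapply (tr_dwt _ _ _ _ H); eauto. }
    exists T'. repeat split; auto. eapply step_scong; eauto.
  - injection Er as <-. inv Hw.
    edestruct (tr_step_out _ _ _ _ H0 _ _ eq_refl eq_refl r' T0_2 D eq_refl) with (L := fn T0_1) (J := @nil name)
      as (cs & b & A & T2' & -> & St & HL & HJ & Ec & Wc); eauto.
    apply step_out_subj in St as Hb.
    edestruct comm_step with (T1 := T0_1) (cs := cs) (A := A) as (T1' & ? & E); eauto using cwt_tlc_fv.
    exists (news cs (Par T1' T2')). split; [eapply st_comm_l; eauto|]. rewrite E. split.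
    + apply ceq_cap; [symmetry; auto|reflexivity].
    + eapply cwt_cap; eauto. eapply tr_dwt_i; eauto.
  - injection Er as <-. inv Hw.
    edestruct (tr_step_out _ _ _ _ H0 _ _ eq_refl eq_refl r' T0_1 D eq_refl) with (L := fn T0_2) (J := @nil name)
      as (cs & b & A & T2' & -> & St & HL & HJ & Ec & Wc); eauto.
    apply step_out_subj in St as Hb.
    edestruct comm_step with (T1 := T0_2) (cs := cs) (A := A) as (T1' & ? & E); eauto using cwt_tlc_fv.
    exists (news cs (Par T1' T2')). split.
    + eapply st_struct; [apply sc_par_comm|eapply st_comm_l; eauto|apply sc_refl].
    + rewrite E. split.
      * apply ceq_cap; [symmetry; auto|reflexivity].
      * eapply cwt_cap; eauto. eapply tr_dwt_i; eauto.
Qed.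

Lemma ws_tau_star X Y : ws X Y -> forall r T D, inj r -> dsc X (tl r V T) -> dwt D [] (tl r V T) TProc ->
  exists T', tau_star T T' /\ dsc (tl r V T') Y /\ dwt D [] (tl r V T') TProc.
Proof.
  induction 1; intros r T0 D Hi E Hw.
  - exists T0. split; [apply rt_refl|]. split; auto. rewrite <- E; auto.
  - eapply harmony_t in H as (m & U & Ht & E'); eauto.
    eapply tr_step_tau in Ht as (T2 & ? & E2 & ?); eauto.
    destruct (IHws r T2 D) as (T3 & ? & ? & ?); auto. { rewrite E2; auto. }
    exists T3. split; auto. eapply rt_trans; [apply rt_step; eauto|auto].
Qed.

(** * Calls of free variables *)

Definition trg (m : nat) : dtm := La (Ou m (V 0) N0).

(* [call E i C]: [E] has variable [i] applied in active position; [C] holds the argument and the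
   rest of [E].  Under a trigger for [i] it is an output. *)
Inductive call : dtm -> nat -> conc -> Prop :=
| call_v i N : call (Ap (V i) N) i (CB N N0)
| call_pl T U i C : call T i C -> call (Pr T U) i (cpl C U)
| call_pr T U i C : call U i C -> call (Pr T U) i (cpr T C)
| call_nu T i C : call T i C -> call (Nu T) i (CN C)
| call_be T N i C : call (inst T N) i C -> call (Ap (La T) N) i C.

Lemma call_tr E i C : call E i C -> forall s m, s i = trg m -> exists n, tr n (vsub s E) (LO m) (RO (cvsub s C)).
Proof.
  induction 1; intros s m Hs; simpl.
  - rewrite Hs. eexists. eapply tr_ap; [constructor|]. unfold inst; simpl. constructor.
  - destruct (IHcall _ _ Hs) as [n ?]. rewrite cvsub_cpl. eauto using tr_pl_o.
  - destruct (IHcall _ _ Hs) as [n ?]. rewrite cvsub_cpr. eauto using tr_pr_o.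
  - destruct (IHcall (nup s) (S m)) as [n Ht]. { unfold nup; rewrite Hs; auto. }
    exists n. apply (tr_nu _ _ (LO m)) in Ht. apply Ht.
  - destruct (IHcall _ _ Hs) as [n ?]. eexists. eapply tr_ap; [constructor|].
    rewrite <- vsub_inst; eauto.
Qed.

Lemma call_dsc E i C : call E i C -> forall s U, s i = La U -> dsc (vsub s E) (cap (cvsub s C) U).
Proof.
  induction 1; intros s U0 Hs; simpl.
  - rewrite Hs, dsc_beta, dsc_nil. reflexivity.
  - rewrite cvsub_cpl, cap_cpl, IHcall; eauto. reflexivity.
  - rewrite cvsub_cpr, cap_cpr, IHcall; eauto. reflexivity.
  - rewrite IHcall; [reflexivity|]. unfold nup; rewrite Hs; auto.
  - rewrite dsc_beta, <- vsub_inst. auto.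
Qed.

Lemma call_dwt E i C : call E i C -> forall D G s, dwt D G E s ->
  nth_error G i = Some TAbs /\ cwt D G TAbs C.
Proof.
  induction 1; intros D G s Hw; inv Hw.
  - match goal with H : dwt _ _ (V _) _ |- _ => inv H end. simpl. repeat split; auto. constructor.
  - edestruct IHcall; eauto. split; auto. apply cwt_cpl; auto.
  - edestruct IHcall; eauto. split; auto. apply cwt_cpr; auto.
  - edestruct IHcall; eauto. split; auto. simpl; eauto.
  - match goal with H : dwt _ _ (La _) _ |- _ => inv H end. eapply IHcall. eapply dwt_inst; eauto.
Qed.

Fixpoint cnf (x : nat) (C : conc) : Prop :=
  match C with CB A T => nf x A \/ nf x T | CN C => cnf (S x) C end.
Lemma cnf_cpl C : forall x U, cnf x (cpl C U) <-> cnf x C \/ nf x U.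
Proof.
  induction C; intros; simpl; [tauto|]. rewrite IHC, nf_nren. split; intros [H|H]; auto.
  - destruct H as (y & ? & E); injection E as ->; auto.
  - right; eauto.
Qed.
Lemma cnf_cpr C : forall x U, cnf x (cpr U C) <-> cnf x C \/ nf x U.
Proof.
  induction C; intros; simpl; [tauto|]. rewrite IHC, nf_nren. split; intros [H|H]; auto.
  - destruct H as (y & ? & E); injection E as ->; auto.
  - right; eauto.
Qed.
Lemma nf_cap C : forall x F, nf x (cap C F) -> cnf x C \/ nf x F.
Proof.
  induction C; intros x F; simpl.
  - intros [H|H]; auto. apply nf_inst in H as [?|?]; auto.
  - intros H. apply IHC in H as [?|H]; auto. apply nf_nren in H as (y & ? & E). injection E as ->; auto.
Qed.
Lemma cnf_bound C : exists b, forall x, cnf x C -> x < b.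
Proof.
  induction C; simpl.
  - destruct (nf_bound A) as [b1 H1], (nf_bound T) as [b2 H2]. exists (b1 + b2).
    intros x [H|H]; [apply H1 in H|apply H2 in H]; lia.
  - destruct IHC as [b H]. exists b. intros x Hx. apply H in Hx. lia.
Qed.

Definition rnf x r := match r with RP T => nf x T | RI F => nf x F | RO C => cnf x C end.
Lemma tr_nf n T l r : tr n T l r -> forall x, rnf x r -> nf x T.
Proof.
  induction 1; intros x Hx; simpl in *; auto.
  - destruct r; simpl in *; rewrite ?nf_vren, ?cnf_cpl in Hx; intuition auto.
  - destruct r; simpl in *; rewrite ?nf_vren, ?cnf_cpr in Hx; intuition auto.
  - apply IHtr. destruct r; simpl in *; auto.
  - apply IHtr2 in Hx. apply nf_inst in Hx as [?|?]; auto.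
  - apply nf_cap in Hx as [?|?]; auto.
  - apply nf_cap in Hx as [?|?]; auto.
Qed.
Lemma call_nf E i C : call E i C -> forall x, cnf x C -> nf x E.
Proof.
  induction 1; intros x Hx; simpl in *.
  - tauto.
  - apply cnf_cpl in Hx as [?|?]; auto.
  - apply cnf_cpr in Hx as [?|?]; auto.
  - auto.
  - apply IHcall in Hx. apply nf_inst in Hx as [?|?]; auto.
Qed.
Definition lname l := match l with LI (Some a) => Some a | LO a => Some a | _ => None end.
Lemma tr_lab_nf n T l r : tr n T l r -> forall a, lname l = Some a -> nf a T.
Proof.
  induction 1; intros b Hb; simpl in *; try (injection Hb as ->); auto; try discriminate.
  - apply IHtr. destruct l as [|[?|]|]; simpl in *; congruence.
  - specialize (IHtr2 _ Hb). apply nf_inst in IHtr2 as [H1|H1]; auto.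
    left. eapply tr_nf; eauto.
Qed.

Notation GA n := (repeat TAbs n).
Lemma GA_nth n x s : nth_error (GA n) x = Some s -> s = TAbs /\ x < n.
Proof.
  intros H. assert (x < n). { rewrite <- (repeat_length TAbs n). apply nth_error_Some. congruence. }
  rewrite nth_error_repeat in H; auto. split; congruence.
Qed.
Lemma GA_nth' n x : x < n -> nth_error (GA n) x = Some TAbs.
Proof. apply nth_error_repeat. Qed.

(** The trigger names do not occur in [E], so no prefix of [E] can synchronise with a trigger.
    Besides the moves of [E] itself only calls show up, as outputs. *)
Lemma tr_trg_inv n X l r : tr n X l r -> forall k D E sg mm, X = vsub sg E -> dwt D (GA k) E TProc ->
  (forall i, i < k -> sg i = trg (mm i)) -> (forall i, i < k -> ~ nf (mm i) E) ->
  (exists m r0, tr m E l r0 /\ r = rvsub sg r0) \/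
  (exists i C, i < k /\ l = LO (mm i) /\ call E i C /\ r = RO (cvsub sg C)).
Proof.
  induction 1; intros kk D E sg mm EX Hw Hs Hm; destruct E; simpl in EX; try discriminate;
  try (injection EX; intros; subst);
  try (inv Hw; match goal with H : nth_error _ _ = _ |- _ => apply GA_nth in H as [? _]; discriminate end); inv Hw; simpl in Hm.
  - left. exists 0, (RI E); split; constructor.
  - left. exists 0, (RO (CB E1 E2)); split; constructor.
  - edestruct (IHtr kk D E1 sg mm) as [(m & r0 & ? & ->)|(i & C & ? & -> & ? & ->)]; eauto; try (intros i Hi Hn; eapply Hm; eauto; fail).
    + left. exists m, (rparl r0 E2). split; [constructor; auto|]. rewrite rvsub_rparl; auto.
    + right. exists i, (cpl C E2). repeat split; auto; [constructor; auto|]. simpl. rewrite cvsub_cpl; auto.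
  - edestruct (IHtr kk D E2 sg mm) as [(m & r0 & ? & ->)|(i & C & ? & -> & ? & ->)]; eauto; try (intros i Hi Hn; eapply Hm; eauto; fail).
    + left. exists m, (rparr E1 r0). split; [constructor; auto|]. rewrite rvsub_rparr; auto.
    + right. exists i, (cpr E1 C). repeat split; auto; [constructor; auto|]. simpl. rewrite cvsub_cpr; auto.
  - edestruct (IHtr kk (scons s D) E (nup sg) (fun i => S (mm i))) as [(m & r0 & ? & ->)|(i & C & ? & El & ? & ->)]; eauto.
    + intros i Hi. unfold nup. rewrite Hs; auto.
    + left. exists m, (rnu r0). split; [constructor; auto|]. rewrite rvsub_rnu; auto.
    + right. exists i, (CN C). repeat split; auto; [|constructor; auto].
      destruct l as [|[?|]|]; simpl in El; congruence.
  - match goal with H : dwt _ _ E1 TAbs |- _ => inv H end.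
    + match goal with H : nth_error _ _ = _ |- _ => apply GA_nth in H as [_ ?] end.
      simpl in *. rewrite Hs in * by auto.
      match goal with H : tr _ (trg _) _ _ |- _ => inv H end.
      match goal with H : tr _ (inst _ _) _ _ |- _ => unfold inst in H; simpl in H; inv H end.
      right. exists x, (CB E2 N0). repeat split; auto. constructor.
    + simpl in *. match goal with H : tr _ (La _) _ _ |- _ => inv H end.
      edestruct (IHtr2 kk D (inst T E2) sg mm) as [(m & r0 & ? & ->)|(i & C & ? & -> & ? & ->)].
      * rewrite vsub_inst; auto.
      * eapply dwt_inst; eauto.
      * auto.
      * intros i Hi Hn. apply nf_inst in Hn as [?|?]; eapply Hm; eauto.
      * left. eexists _, r0. split; auto. eapply tr_ap; eauto. constructor.
      * right. exists i, C. repeat split; auto. constructor; auto.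
  - edestruct (IHtr1 kk D E1 sg mm) as [(m & r0 & T1 & E1')|(i & C1 & ? & E1' & ? & ?)]; eauto; try (intros i Hi Hn; eapply Hm; eauto; fail); [|discriminate].
    destruct r0 as [|F0|]; try discriminate. injection E1' as ->.
    edestruct (IHtr2 kk D E2 sg mm) as [(m2 & r2 & T2 & E2')|(i & C1 & ? & E2' & ? & ?)]; eauto; try (intros i Hi Hn; eapply Hm; eauto; fail).
    + destruct r2 as [| |C2]; try discriminate. injection E2' as ->.
      left. eexists _, _. split; [eapply tr_cl; eauto|]. simpl. rewrite cvsub_cap; auto.
    + injection E2' as ->. exfalso. eapply (Hm i); auto. left. eapply tr_lab_nf; eauto.
  - edestruct (IHtr1 kk D E2 sg mm) as [(m & r0 & T1 & E1')|(i & C1 & ? & E1' & ? & ?)]; eauto; try (intros i Hi Hn; eapply Hm; eauto; fail); [|discriminate].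
    destruct r0 as [|F0|]; try discriminate. injection E1' as ->.
    edestruct (IHtr2 kk D E1 sg mm) as [(m2 & r2 & T2 & E2')|(i & C1 & ? & E2' & ? & ?)]; eauto; try (intros i Hi Hn; eapply Hm; eauto; fail).
    + destruct r2 as [| |C2]; try discriminate. injection E2' as ->.
      left. eexists _, _. split; [eapply tr_cr; eauto|]. simpl. rewrite cvsub_cap; auto.
    + injection E2' as ->. exfalso. eapply (Hm i); auto. right. eapply tr_lab_nf; eauto.
Qed.

Lemma rfw_req r r' : rfw r r' -> req r r'.
Proof. apply req_mono, dsc_fw. Qed.

Lemma fw_cpl_cap b C F : forall U, fw b (Pr (cap C F) U) (cap (cpl C U) F).
Proof.
  revert F. induction C; intros; simpl. { apply fw_assoc'. }
  eapply fw_trans; [apply fw_ext'|]. apply fw_nu; auto.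
Qed.
Lemma fw_cpr_cap b C F : forall U, fw b (Pr U (cap C F)) (cap (cpr U C) F).
Proof.
  revert F. induction C; intros; simpl.
  - eapply fw_trans; [apply fw_comm|]. eapply fw_trans; [apply fw_assoc'|].
    apply fw_pr; [constructor|apply fw_comm].
  - eapply fw_trans; [apply fw_comm|]. eapply fw_trans; [apply fw_ext'|]. apply fw_nu.
    eapply fw_trans; [apply fw_comm|]; auto.
Qed.

Lemma req_rparl r r' U : req r r' -> req (rparl r U) (rparl r' U).
Proof.
  destruct r, r'; simpl; try tauto; intros H; try (rewrite H; reflexivity). apply ceq_cpl; auto; reflexivity.
Qed.
Lemma req_rparr r r' U : req r r' -> req (rparr U r) (rparr U r').
Proof.
  destruct r, r'; simpl; try tauto; intros H; try (rewrite H; reflexivity). apply ceq_cpr; auto; reflexivity.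
Qed.
Lemma req_rnu r r' : req r r' -> req (rnu r) (rnu r').
Proof.
  destruct r, r'; simpl; try tauto; intros H; rewrite H; reflexivity.
Qed.

Definition resolved n l r sg (U : nat -> dtm) E := exists i C, call E i C /\
   exists n' r', n' < n /\ tr n' (cap (cvsub sg C) (U i)) l r' /\ req r r'.

(** A transition that [E] cannot make by itself must unfold a variable in active position. Resolving
    just that call removes the [tr_ap] step it had paid for, whence a strictly smaller count. *)
Lemma tr_abs_inv n X l r : tr n X l r -> forall k D E sg U, X = vsub sg E -> dwt D (GA k) E TProc ->
  (forall i, i < k -> sg i = La (U i)) ->
  (exists m r0, tr m E l r0 /\ r = rvsub sg r0) \/ resolved n l r sg U E.
Proof.
  (* The residual is brought into the shape of a [cap] by oriented steps only, so the strict
     decrease is not lost. *)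
  assert (RW : forall T W n n' l r r', fw true T W -> n' < n -> tr n' T l r' -> req r r' ->
     exists n'' r'', n'' < n /\ tr n'' W l r'' /\ req r r'').
  { intros T W n0 n' l0 r0 r' HF Hn Ht HR. eapply fw_tr in Ht as (n2 & r2 & ? & ? & ?); eauto.
    exists n2, r2. repeat split; auto; [lia|]. eapply req_trans; eauto. apply rfw_req; auto. }
  induction 1; intros kk D E sg W EX Hw Hs; destruct E; simpl in EX; try discriminate;
  try (injection EX; intros; subst);
  try (inv Hw; match goal with H : nth_error _ _ = _ |- _ => apply GA_nth in H as [? _]; discriminate end); inv Hw.
  - left. exists 0, (RI E); split; constructor.
  - left. exists 0, (RO (CB E1 E2)); split; constructor.
  - edestruct (IHtr kk D E1 sg W) as [(m & r0 & ? & ->)|(i & C & ? & n' & r' & ? & ? & ?)]; eauto.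
    + left. exists m, (rparl r0 E2). split; [constructor; auto|]. rewrite rvsub_rparl; auto.
    + right. exists i, (cpl C E2). split; [constructor; auto|]. rewrite cvsub_cpl.
      eapply RW; [apply fw_cpl_cap| |apply tr_pl; eauto|apply req_rparl; eauto]; auto.
  - edestruct (IHtr kk D E2 sg W) as [(m & r0 & ? & ->)|(i & C & ? & n' & r' & ? & ? & ?)]; eauto.
    + left. exists m, (rparr E1 r0). split; [constructor; auto|]. rewrite rvsub_rparr; auto.
    + right. exists i, (cpr E1 C). split; [constructor; auto|]. rewrite cvsub_cpr.
      eapply RW; [apply fw_cpr_cap| |apply tr_pr; eauto|apply req_rparr; eauto]; auto.
  - edestruct (IHtr kk (scons s D) E (nup sg) (fun i => nren S (W i))) as [(m & r0 & ? & ->)|(i & C & ? & n' & r' & ? & ? & ?)]; eauto.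
    + intros i Hi. unfold nup. rewrite Hs; auto.
    + left. exists m, (rnu r0). split; [constructor; auto|]. rewrite rvsub_rnu; auto.
    + right. exists i, (CN C). split; [constructor; auto|]. exists n', (rnu r').
      split; auto. split; [apply tr_nu; auto|apply req_rnu; auto].
  - match goal with H : dwt _ _ E1 TAbs |- _ => inv H end.
    + match goal with H : nth_error _ _ = _ |- _ => apply GA_nth in H as [_ ?] end.
      simpl in *. rewrite Hs in * by auto.
      match goal with H : tr _ (La _) _ _ |- _ => inv H end.
      right. exists x, (CB E2 N0). split; [constructor|]. simpl.
      eapply RW; [apply fw_nil'| |eassumption|apply req_refl]; lia.
    + simpl in *. match goal with H : tr _ (La _) _ _ |- _ => inv H end.
      edestruct (IHtr2 kk D (inst T E2) sg W) as [(m & r0 & ? & ->)|(i & C & ? & n' & r' & ? & ? & ?)].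
      * rewrite vsub_inst; auto.
      * eapply dwt_inst; eauto.
      * auto.
      * left. eexists _, r0. split; auto. eapply tr_ap; eauto. constructor.
      * right. exists i, C. split; [constructor; auto|]. exists n', r'. repeat split; auto; lia.
  - edestruct (IHtr1 kk D E1 sg W) as [(m & r0 & T1 & E1')|(i & C1 & ? & n' & r' & ? & ? & R1)]; eauto.
    + destruct r0 as [|F0|]; try discriminate. injection E1' as ->.
      edestruct (IHtr2 kk D E2 sg W) as [(m2 & r2 & T2 & E2')|(i & C1 & ? & n' & r' & ? & ? & R2)]; eauto.
      * destruct r2 as [| |C2]; try discriminate. injection E2' as ->.
        left. eexists _, _. split; [eapply tr_cl; eauto|]. simpl. rewrite cvsub_cap; auto.
      * destruct r' as [| |C']; try contradiction. right. exists i, (cpr E1 C1). split; [constructor; auto|].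
        rewrite cvsub_cpr. eapply RW; [apply fw_cpr_cap| |eapply tr_cl; eauto|].
        -- lia.
        -- simpl in *. apply ceq_cap; auto; reflexivity.
    + destruct r' as [|F'|]; try contradiction. right. exists i, (cpl C1 E2). split; [constructor; auto|].
      rewrite cvsub_cpl. eapply RW; [apply fw_cpl_cap| |eapply tr_cl; eauto|].
      * lia.
      * simpl in *. apply ceq_cap; auto; reflexivity.
  - edestruct (IHtr1 kk D E2 sg W) as [(m & r0 & T1 & E1')|(i & C1 & ? & n' & r' & ? & ? & R1)]; eauto.
    + destruct r0 as [|F0|]; try discriminate. injection E1' as ->.
      edestruct (IHtr2 kk D E1 sg W) as [(m2 & r2 & T2 & E2')|(i & C1 & ? & n' & r' & ? & ? & R2)]; eauto.
      * destruct r2 as [| |C2]; try discriminate. injection E2' as ->.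
        left. eexists _, _. split; [eapply tr_cr; eauto|]. simpl. rewrite cvsub_cap; auto.
      * destruct r' as [| |C']; try contradiction. right. exists i, (cpl C1 E2). split; [constructor; auto|].
        rewrite cvsub_cpl. eapply RW; [apply fw_cpl_cap| |eapply tr_cr; eauto|].
        -- lia.
        -- simpl in *. apply ceq_cap; auto; reflexivity.
    + destruct r' as [|F'|]; try contradiction. right. exists i, (cpr E1 C1). split; [constructor; auto|].
      rewrite cvsub_cpr. eapply RW; [apply fw_cpr_cap| |eapply tr_cr; eauto|].
      * lia.
      * simpl in *. apply ceq_cap; auto; reflexivity.
Qed.

(** * Restricting named channels *)

(** [nu d] binds the channel that currently has the free index [d], the other free indices keeping
    their meaning. An extruded name can thus live as a free index and be restricted again later. *)
Definition clo (d x : nat) : nat := if x =? d then 0 else S x.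
Definition opn (d x : nat) : nat := match x with 0 => d | S y => y end.
Definition nu d T := Nu (nren (clo d) T).
Definition nus ds T := fold_right nu T ds.
Definition cnu d C := CN (cnren (clo d) C).
Definition cnus ds C := fold_right cnu C ds.
Definition rnus ds r := match r with
  | RP T => RP (nus ds T) | RI F => RI (nus ds F) | RO C => RO (cnus ds C) end.

Lemma clo_eq d : clo d d = 0.
Proof. unfold clo. rewrite Nat.eqb_refl; auto. Qed.
Lemma clo_neq d x : x <> d -> clo d x = S x.
Proof. unfold clo. intros H. apply Nat.eqb_neq in H. rewrite H; auto. Qed.
Lemma clo_inj d : inj (clo d).
Proof.
  intros x y. unfold clo. destruct (x =? d) eqn:E1, (y =? d) eqn:E2; intros; try discriminate.
  - apply Nat.eqb_eq in E1, E2. congruence.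
  - congruence.
Qed.
Lemma clo_fresh d T : ~ nf d T -> nren (clo d) T = nren S T.
Proof. intros H. apply nren_ext. intros x Hx. apply clo_neq. intros ->; auto. Qed.

#[global] Instance nus_dsc ds : Proper (dsc ==> dsc) (nus ds).
Proof.
  intros T U H. induction ds; simpl; auto. unfold nu. rewrite IHds. reflexivity.
Qed.
Lemma cnus_ceq ds C C' : ceq C C' -> ceq (cnus ds C) (cnus ds C').
Proof. intros H. induction ds; simpl; auto. apply ceq_n, ceq_nren; auto. Qed.
Lemma rnus_req ds r r' : req r r' -> req (rnus ds r) (rnus ds r').
Proof.
  destruct r, r'; simpl; try tauto; intros H; try (rewrite H; reflexivity). apply cnus_ceq; auto.
Qed.

Definition lav (ds : list nat) l := forall d, In d ds -> lname l <> Some d.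

Lemma lren_clo d l : lname l <> Some d -> lren (clo d) l = lren S l.
Proof.
  destruct l as [|[a|]|a]; simpl; intros H; auto; rewrite clo_neq; auto; congruence.
Qed.
Lemma clo_S d a a' : S a = clo d a' -> a' = a /\ a <> d.
Proof.
  unfold clo. destruct (a' =? d) eqn:E; intros H; [discriminate|]. apply Nat.eqb_neq in E.
  split; congruence.
Qed.
Lemma lren_clo_inv d l l' : lren S l = lren (clo d) l' -> l' = l /\ lname l <> Some d.
Proof.
  destruct l as [|[a|]|a], l' as [|[a'|]|a']; simpl; intros H; try discriminate;
  try (split; [reflexivity|discriminate]);
  injection H as H; apply clo_S in H as [-> ?]; split; congruence.
Qed.
Lemma nus_tr ds n T l r : tr n T l r -> lav ds l -> tr n (nus ds T) l (rnus ds r).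
Proof.
  intros Ht. induction ds as [|d ds IH]; intros Hl; simpl; [destruct r; auto|].
  assert (IH' : tr n (nus ds T) l (rnus ds r)) by (apply IH; intros x Hx; apply Hl; right; auto).
  apply (tr_nren _ _ _ _) with (f := clo d) in IH'. rewrite lren_clo in IH' by (apply Hl; left; auto).
  apply tr_nu in IH'. destruct r; apply IH'.
Qed.
Lemma nus_tr_inv ds n T : forall l r, tr n (nus ds T) l r ->
  exists r0, tr n T l r0 /\ r = rnus ds r0 /\ lav ds l.
Proof.
  induction ds as [|d ds IH]; simpl; intros l r Ht.
  - exists r. split; auto. split; [destruct r; auto|]. intros x [].
  - inv Ht. match goal with H : tr _ _ _ _ |- _ => rename H into Ht end.
    destruct (tr_nren_inv _ _ _ _ Ht (clo d) _ (clo_inj d) eq_refl) as (l' & r' & Ht' & El & ->). clear Ht; rename Ht' into Ht.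
    apply IH in Ht as (r1 & ? & -> & Hl).
    assert (l' = l /\ lname l <> Some d) as [-> Hd].
    { apply lren_clo_inv; auto. }
    exists r1. split; auto. split; [destruct r1; auto|]. intros x [<-|?]; auto.
Qed.
Lemma ws_nus ds T T' : ws T T' -> ws (nus ds T) (nus ds T').
Proof. intros H. induction ds; simpl; auto. apply ws_nu, ws_nren; auto. Qed.

Lemma cap_cnus ds F : (forall d, In d ds -> ~ nf d F) -> forall C, cap (cnus ds C) F = nus ds (cap C F).
Proof.
  induction ds as [|d ds IH]; intros H C; simpl; auto. unfold nu. f_equal.
  rewrite <- IH; [|auto with datatypes]. rewrite cnren_cap, clo_fresh; auto with datatypes.
Qed.
Lemma cpl_cnus ds U : (forall d, In d ds -> ~ nf d U) -> forall C, cpl (cnus ds C) U = cnus ds (cpl C U).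
Proof.
  induction ds as [|d ds IH]; intros H C; simpl; auto. unfold cnu. f_equal.
  rewrite <- IH; [|auto with datatypes]. rewrite cnren_cpl, clo_fresh; auto with datatypes.
Qed.
Lemma cpr_cnus ds U : (forall d, In d ds -> ~ nf d U) -> forall C, cpr U (cnus ds C) = cnus ds (cpr U C).
Proof.
  induction ds as [|d ds IH]; intros H C; simpl; auto. unfold cnu. f_equal.
  rewrite <- IH; [|auto with datatypes]. rewrite cnren_cpr, clo_fresh; auto with datatypes.
Qed.
Lemma nren_vsub_clo d s T : (forall i, ~ nf d (s i)) -> nren (clo d) (vsub s T) = vsub (nup s) (nren (clo d) T).
Proof.
  intros H. rewrite nren_vsub. f_equal. extensionality i. unfold nup. apply clo_fresh; auto.
Qed.
Lemma vsub_nus ds s T : (forall d i, In d ds -> ~ nf d (s i)) -> vsub s (nus ds T) = nus ds (vsub s T).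
Proof.
  induction ds as [|d ds IH]; intros H; simpl; auto. unfold nu. f_equal.
  rewrite <- IH by auto with datatypes. rewrite nren_vsub_clo; auto with datatypes.
Qed.
Lemma cnren_cvsub C : forall s f, cnren f (cvsub s C) = cvsub (fun x => nren f (s x)) (cnren f C).
Proof.
  induction C; intros; simpl; rewrite ?nren_vsub; auto. rewrite IHC, nren_nup. reflexivity.
Qed.
Lemma cvsub_cnus ds s C : (forall d i, In d ds -> ~ nf d (s i)) -> cvsub s (cnus ds C) = cnus ds (cvsub s C).
Proof.
  induction ds as [|d ds IH]; intros H; simpl; auto. unfold cnu. f_equal.
  rewrite <- IH by auto with datatypes. rewrite cnren_cvsub. f_equal.
  extensionality i. unfold nup. symmetry. apply clo_fresh; auto with datatypes.
Qed.
Lemma nus_pr ds T U : (forall d, In d ds -> ~ nf d U) -> dsc (nus ds (Pr T U)) (Pr (nus ds T) U).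
Proof.
  induction ds as [|d ds IH]; intros H; simpl; [reflexivity|]. unfold nu.
  rewrite IH by auto with datatypes. simpl. rewrite (clo_fresh d U) by auto with datatypes. apply dsc_ext.
Qed.
Lemma nus_prr ds T U : (forall d, In d ds -> ~ nf d U) -> dsc (nus ds (Pr U T)) (Pr U (nus ds T)).
Proof.
  intros. rewrite (dsc_comm U), nus_pr by auto. apply dsc_comm.
Qed.
Lemma nu_nu d e T : dsc (nu d (nu e T)) (nu e (nu d T)).
Proof.
  destruct (Nat.eq_dec d e) as [->|N]; [reflexivity|]. unfold nu. simpl. rewrite dsc_swap.
  rewrite !nren_nren.
  match goal with |- dsc (Nu (Nu (nren ?a T))) (Nu (Nu (nren ?b T))) => replace a with b; [reflexivity|] end.
  extensionality x. unfold clo. destruct (x =? e) eqn:E1, (x =? d) eqn:E2; simpl; rewrite ?E1, ?E2; auto.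
  apply Nat.eqb_eq in E1, E2. congruence.
Qed.
Lemma nus_nu ds e T : dsc (nus ds (nu e T)) (nu e (nus ds T)).
Proof.
  induction ds; simpl; [reflexivity|]. unfold nu at 1. rewrite IHds. apply nu_nu.
Qed.
Lemma nus_nus ds es T : dsc (nus ds (nus es T)) (nus es (nus ds T)).
Proof.
  induction es; simpl; [reflexivity|]. rewrite nus_nu. unfold nu at 1. rewrite IHes. reflexivity.
Qed.
Lemma nus_app ds es T : nus (ds ++ es) T = nus ds (nus es T).
Proof. apply fold_right_app. Qed.
Lemma cnus_app ds es T : cnus (ds ++ es) T = cnus ds (cnus es T).
Proof. apply fold_right_app. Qed.

Lemma cnren_ext C : forall f g, (forall x, cnf x C -> f x = g x) -> cnren f C = cnren g C.
Proof.
  induction C; intros f g H; simpl in *; f_equal.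
  - apply nren_ext; auto.
  - apply nren_ext; auto.
  - apply IHC. intros [|x] Hx; simpl; auto.
Qed.
Lemma cwt_nren C : forall D D' G t f, cwt D G t C -> (forall x, cnf x C -> D x = D' (f x)) -> cwt D' G t (cnren f C).
Proof.
  induction C; simpl; intros D D' G t f H Hf.
  - destruct H; split; eapply dwt_nren; eauto.
  - destruct H as [s H]. exists s. eapply IHC; eauto. intros [|x]; simpl; auto.
Qed.
Lemma cnf_cnren C : forall f y, cnf y (cnren f C) -> exists x, cnf x C /\ y = f x.
Proof.
  induction C; simpl; intros f y H.
  - rewrite !nf_nren in H. destruct H as [(x & ? & ->)|(x & ? & ->)]; eauto.
  - apply IHC in H as ([|x] & ? & E); simpl in E; [discriminate|]. injection E as ->. eauto.
Qed.
Fixpoint clen C := match C with CB _ _ => 0 | CN C => S (clen C) end.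
Lemma clen_nren C : forall f, clen (cnren f C) = clen C.
Proof. induction C; simpl; auto. Qed.

(** The extruded names become free indices of class [cl], so that object and continuation can be
    handled apart; [cnus ks] restores the concretion exactly. *)
Lemma open_conc cl : cl < 4 -> forall n C D G t b, clen C = n -> cwt D G t C -> exists ks A T D',
  C = cnus ks (CB A T) /\ (forall k, In k ks -> b <= k /\ k mod 4 = cl) /\
  (forall x, ~ In x ks -> D' x = D x) /\ dwt D' G A t /\ dwt D' G T TProc /\
  (forall x, nf x A \/ nf x T -> cnf x C \/ In x ks).
Proof.
  intros Hcl. induction n; intros C D G t b En Hw; destruct C; simpl in En; try discriminate.
  - exists [], A, T, D. simpl in *. repeat split; auto; tauto.
  - injection En as En. destruct Hw as [s Hw].
    (* The factor 4 leaves the residue to [cl]; the sum keeps [k] at least [b] and beyond every free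
       index of [C]. *)
    destruct (cnf_bound C) as [b1 Hb1]. set (k := 4 * (b + b1) + cl).
    assert (Hk : b <= k /\ b1 <= k /\ k mod 4 = cl).
    { repeat split; try (unfold k; lia). unfold k. rewrite Nat.add_comm, Nat.mul_comm, Nat.Div0.mod_add. apply Nat.mod_small; auto. }
    destruct Hk as (Hk1 & Hk2 & Hk3).
    assert (EC : C = cnren (clo k) (cnren (opn k) C)).
    { rewrite cnren_cnren. rewrite <- (cnren_id C) at 1. apply cnren_ext. intros [|x] Hx; simpl.
      - symmetry; apply clo_eq.
      - rewrite clo_neq; auto. apply Hb1 in Hx. lia. }
    destruct (IHn (cnren (opn k) C) (upd D k s) G t (S k)) as (ks & A & T & D' & E & Hks & HD & WA & WT & Hn).
    { rewrite clen_nren; auto. }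
    { eapply cwt_nren; eauto. intros [|x] Hx; simpl; [rewrite upd_eq; auto|].
      rewrite upd_neq; auto. apply Hb1 in Hx. lia. }
    exists (k :: ks), A, T, D'. split; [|split; [|split; [|split; [|split]]]]; auto.
    + simpl. unfold cnu. rewrite <- E, <- EC. auto.
    + intros x [<-|Hx]; auto. apply Hks in Hx. lia.
    + intros x Hx. rewrite HD; [|intros ?; apply Hx; right; auto]. apply upd_neq. intros ->; apply Hx; left; auto.
    + intros x Hx. apply Hn in Hx as [Hx|Hx]; [|right; right; auto].
      apply cnf_cnren in Hx as ([|y] & Hy & ->); simpl; auto.
Qed.

(** * Trigger servers *)

(** The process Q_c of the derived replication, with its private channel c at index 0; hence the
    shifts of [m] and [A]. *)
Definition Qs m A := In_ 0 (Pr (In_ (S m) (Pr (V 1) (Ap (vren (fun x => S (S x)) (nren S A)) (V 0)))) (Ou 0 (V 0) N0)).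
Definition srv m A := Nu (Pr (Qs m A) (Ou 0 (Qs m A) N0)).
(* [srvu] is [srv] after its internal communication, when it is ready to receive on [m]. *)
Definition srvu m A := Nu (Pr (In_ (S m) (Pr (vren S (Qs m A)) (Ap (vren S (nren S A)) (V 0)))) (Ou 0 (Qs m A) N0)).
(** The server as a receiving context: [cap C (srvF m)] installs a server for whatever object [C]
    carries. *)
Definition srvF m := srv m (V 0).

Lemma Qs_nren f m A : nren (upn f) (Qs m A) = Qs (f m) (nren f A).
Proof. unfold Qs; simpl. rewrite nren_vren, nren_S_upn. reflexivity. Qed.
Lemma Qs_vsub s m A : vsub (nup s) (Qs m A) = Qs m (vsub s A).
Proof.
  unfold Qs; simpl. do 4 f_equal. f_equal.
  rewrite vsub_vren. simpl. rewrite <- vsub_nup, vren_vsub. f_equal. extensionality x.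
  rewrite vren_vren. reflexivity.
Qed.
Lemma srv_nren f m A : nren f (srv m A) = srv (f m) (nren f A).
Proof. unfold srv; simpl nren. rewrite <- Qs_nren. reflexivity. Qed.
Lemma srv_vsub s m A : vsub s (srv m A) = srv m (vsub s A).
Proof. unfold srv; simpl vsub. rewrite <- Qs_vsub. reflexivity. Qed.
Lemma inst_srvF m A : inst (srvF m) A = srv m A.
Proof. unfold inst, srvF. rewrite srv_vsub. reflexivity. Qed.
Lemma srvF_nren f m : nren f (srvF m) = srvF (f m).
Proof. unfold srvF. rewrite srv_nren. reflexivity. Qed.

Lemma Qs_inst m A B :
  inst (Pr (In_ (S m) (Pr (V 1) (Ap (vren (fun x => S (S x)) (nren S A)) (V 0)))) (Ou 0 (V 0) N0)) B =
  Pr (In_ (S m) (Pr (vren S B) (Ap (vren S (nren S A)) (V 0)))) (Ou 0 B N0).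
Proof.
  unfold inst; simpl. do 4 f_equal. rewrite vsub_vren. simpl. rewrite vren_V. reflexivity.
Qed.

Ltac trinv := repeat match goal with
  | H : tr _ (Nu _) _ _ |- _ => inv H
  | H : tr _ (Pr _ _) _ _ |- _ => inv H
  | H : tr _ (In_ _ _) _ _ |- _ => inv H
  | H : tr _ (Qs _ _) _ _ |- _ => unfold Qs in H; inv H; fold (Qs) in *
  | H : tr _ (Ou _ _ _) _ _ |- _ => inv H
  | H : tr _ N0 _ _ |- _ => inv H
  | H : lren S ?l = _ |- _ => destruct l as [|[?|]|]; try discriminate; clear H
  | H : _ = lren S ?l |- _ => destruct l as [|[?|]|]; try discriminate; simpl in H
  end.

Lemma srv_tr m A : exists n X, tr n (srv m A) LT (RP X) /\ dsc X (srvu m A).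
Proof.
  eexists _, _. split.
  - apply tr_nu_t. eapply tr_cl; constructor.
  - simpl. rewrite Qs_inst. rewrite dsc_nil. reflexivity.
Qed.
Lemma srv_tr_inv n m A l r : tr n (srv m A) l r -> l = LT /\ exists X, r = RP X /\ dsc X (srvu m A).
Proof.
  unfold srv. intros H. trinv.
  split; auto. eexists; split; [reflexivity|].
  simpl. rewrite Qs_inst. rewrite dsc_nil. reflexivity.
Qed.
(** Once a request is accepted, the released copy of Q_c stands again beside the pending output of
    Q_c under the same restriction. The copy of [A] does not mention that channel and leaves its
    scope. *)
Lemma srvu_F m A : dsc (Nu (Pr (Pr (vren S (Qs m A)) (Ap (vren S (nren S A)) (V 0))) (vren S (Ou 0 (Qs m A) N0))))
  (Pr (vren S (srv m A)) (Ap (vren S A) (V 0))).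
Proof.
  rewrite <- dsc_assoc. rewrite (dsc_comm (Ap _ _)), dsc_assoc.
  change (Ap (vren S (nren S A)) (V 0)) with (Ap (vren S (nren S A)) (nren S (V 0))).
  rewrite <- nren_vren. change (Ap (nren S (vren S A)) (nren S (V 0))) with (nren S (Ap (vren S A) (V 0))).
  rewrite dsc_ext. reflexivity.
Qed.
Lemma srvu_tr m A : exists n F, tr n (srvu m A) (LI (Some m)) (RI F) /\ dsc F (Pr (vren S (srv m A)) (Ap (vren S A) (V 0))).
Proof.
  eexists _, _. split.
  - eapply (tr_nu _ _ (LI (Some m)) (RI _)). simpl. apply tr_pl_i. constructor.
  - simpl. apply srvu_F.
Qed.
Lemma srvu_tr_inv n m A l r : tr n (srvu m A) l r -> l = LI (Some m) /\
  exists F, r = RI F /\ dsc F (Pr (vren S (srv m A)) (Ap (vren S A) (V 0))).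
Proof.
  unfold srvu. intros H. trinv.
  match goal with H : LI _ = _ |- _ => injection H as -> end. split; auto.
  eexists; split; [reflexivity|]. apply srvu_F.
Qed.
Lemma srv_nf m A x : nf x (srv m A) -> x = m \/ nf x A.
Proof.
  unfold srv, Qs. simpl. rewrite !nf_vren, !nf_nren. intros H.
  repeat match goal with H : _ \/ _ |- _ => destruct H as [H|H] | H : exists _, _ |- _ => destruct H as (? & ? & E); injection E as -> end;
  try discriminate; try contradiction; auto; injection H; auto.
Qed.
Lemma srvu_nf m A x : nf x (srvu m A) -> x = m \/ nf x A.
Proof.
  unfold srvu, Qs. simpl. rewrite !nf_vren, !nf_nren. intros H.
  repeat match goal with H : _ \/ _ |- _ => destruct H as [H|H] | H : exists _, _ |- _ => destruct H as (? & ? & E); injection E as -> end;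
  try discriminate; try contradiction; auto; injection H; auto.
Qed.

Lemma fresh_for_notin l : ~ In (fresh_for l) l.
Proof.
  unfold fresh_for. intros H.
  assert (forall l x, In x l -> x <= fold_right Nat.max 0 l).
  { induction l0; simpl; intros x []; subst; [lia|]. apply IHl0 in H0. lia. }
  apply H0 in H. lia.
Qed.

(** Closedness up to congruence. This is what is extracted for the object of an answering output,
    since congruence steps may have inserted discarded arguments that are open. *)
Definition vclosed a := forall s, dsc (vsub s a) a.
Lemma vclosed_vren a g : vclosed a -> dsc (vren g a) a.
Proof. intros H. rewrite vren_V. apply H. Qed.
Lemma rep_gen_tl c m A r : c <> m -> ~ In c (fn A) -> vclosed (tl r V A) ->
  let Qc := Inp c 1 (Par (Inp m 0 (Par (Var 1) (App A (Var 0)))) (Out c (Var 1) Nil)) in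
  dsc (tl r V (Res c (Par Qc (Out c Qc Nil)))) (srv (r m) (tl r V A)).
Proof.
  intros Hc HA Hcl Qc.
  set (r' := upd (fun x => S (r x)) c 0).
  assert (EQ : dsc (tl r' V Qc) (Qs (r m) (tl r V A))).
  { unfold Qc, Qs. simpl. replace (r' c) with 0 by (symmetry; apply upd_eq).
    replace (r' m) with (S (r m)) by (unfold r'; rewrite upd_neq; auto).
    match goal with |- context [tl r' ?e A] => set (e2 := e) end.
    assert (EA : tl r' e2 A = vsub e2 (nren S (tl r V A))).
    { rewrite <- (tl_res_fresh0 c A r) by auto. rewrite tl_vsub. reflexivity. }
    assert (He : forall X, exists i, e2 X = V i).
    { intros X. unfold e2, upd. repeat destruct (X =? _); simpl; eauto. }
    assert (EB : vsub e2 (nren S (tl r V A)) = nren S (vsub e2 (tl r V A))).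
    { rewrite nren_vsub. f_equal. extensionality X. destruct (He X) as [i ->]. reflexivity. }
    rewrite EA, EB, (Hcl e2), <- nren_vren, (vclosed_vren _ _ Hcl). reflexivity. }
  change (tl r V (Res c (Par Qc (Out c Qc Nil)))) with (Nu (Pr (tl r' V Qc) (Ou (r' c) (tl r' V Qc) N0))).
  replace (r' c) with 0 by (symmetry; apply upd_eq). rewrite EQ. reflexivity.
Qed.
Lemma rep_tl m A r : vclosed (tl r V A) -> dsc (tl r V (rep_trig m A)) (srv (r m) (tl r V A)).
Proof.
  intros H. pose proof (fresh_for_notin (m :: names A)) as Hf.
  apply rep_gen_tl; auto.
  - intros E. apply Hf. left; auto.
  - intros E. apply Hf. right; apply fn_names; auto.
Qed.

Fixpoint cvc C := match C with CB A T => vclosed A | CN C => cvc C end.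
Lemma vclosed_nren a f : vclosed (nren f a) -> forall g, (forall x, g (f x) = x) -> vclosed a.
Proof.
  intros H g Hg s. specialize (H (fun x => nren f (s x))). rewrite <- nren_vsub in H.
  apply (nren_dsc g) in H. rewrite !nren_nren in H.
  replace (fun x => g (f x)) with (fun x : nat => x) in H by (extensionality x; auto).
  rewrite !nren_id in H. auto.
Qed.
Lemma cvc_cnren C : forall f, cvc C -> cvc (cnren f C).
Proof.
  assert (K : forall a f, vclosed a -> vclosed (nren f a)).
  { intros a f H s. 
    (* In the instance by constants all variables are gone, so the outer substitution merges into it
       without effect. *)
    assert (E : dsc (nren f a) (nren f (vsub (fun _ => N0) a))) by (rewrite (H (fun _ => N0)); reflexivity).
    assert (E2 : vsub (fun _ => N0) (nren f a) = nren f (vsub (fun _ => N0) a)) by (rewrite nren_vsub; reflexivity).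
    rewrite E at 1. rewrite nren_vsub, vsub_vsub. simpl. rewrite E2, <- E. reflexivity. }
  induction C; simpl; intros; auto.
Qed.
Lemma cvc_ceq C C' : ceq C C' -> cvc C <-> cvc C'.
Proof.
  assert (P : forall A A', dsc A A' -> vclosed A -> vclosed A').
  { intros A A' H H' s. rewrite <- H. apply H'. }
  induction 1; simpl; auto; try tauto.
  - split; apply P; auto. symmetry; auto.
  - split; intros H; [|apply (cvc_cnren (CB A T) S H)].
    eapply (vclosed_nren _ S); eauto. instantiate (1 := fun x => x - 1). intros; simpl; lia.
  - split; intros H; [apply (cvc_cnren C sw H)|].
    apply (cvc_cnren _ sw) in H. rewrite csw_csw in H. auto.
Qed.
Lemma cwt_cvc C : forall D t, cwt D [] t C -> cvc C.
Proof.
  induction C; simpl; intros D t H.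
  - intros s. destruct H as [H _]. rewrite (dwt_closed _ _ _ s H). reflexivity.
  - destruct H as [s H]; eauto.
Qed.

Lemma news_rep_tl cs A P' m : forall r, ~ In m cs -> cvc (tlc r V cs A P') ->
  dsc (tl r V (news cs (Par P' (rep_trig m A)))) (cap (tlc r V cs A P') (srvF (r m))).
Proof.
  induction cs as [|c cs IH]; intros r Hm Hc; simpl in Hm, Hc.
  - change (dsc (Pr (tl r V P') (tl r V (rep_trig m A))) (Pr (inst (srvF (r m)) (tl r V A)) (tl r V P'))).
    rewrite inst_srvF, <- rep_tl; auto. apply dsc_comm.
  - set (r' := upd (fun x => S (r x)) c 0) in *.
    change (dsc (Nu (tl r' V (news cs (Par P' (rep_trig m A)))))
      (Nu (cap (tlc r' V cs A P') (nren S (srvF (r m)))))).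
    rewrite IH; [|tauto|auto]. rewrite srvF_nren. unfold r' at 2.
    rewrite upd_neq by (intros ->; tauto). reflexivity.
Qed.

(** * Normal bisimilarity on de Bruijn terms *)

(** A normal bisimulation is not assumed closed under renaming, whereas configurations use indices
    of all four classes; the bijection [f] carries the named terms to them. *)
Definition NB p q := exists R P Q (f g : nat -> nat), normal_bisimulation R /\ R P Q /\
  (forall x, g (f x) = x) /\ (forall x, f (g x) = x) /\
  dsc p (nren f (tl0 P)) /\ dsc q (nren f (tl0 Q)).

Lemma NB_sym p q : NB p q -> NB q p.
Proof.
  intros (R & P & Q & f & g & HR & H & ?). exists R, Q, P, f, g. destruct HR as [Hs ?].
  split; [split; auto|]. split; [auto|tauto].
Qed.
#[global] Instance NB_proper : Proper (dsc ==> dsc ==> iff) NB.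
Proof.
  assert (K : forall p p' q q', dsc p p' -> dsc q q' -> NB p q -> NB p' q').
  { intros p p' q q' E E' (R & P & Q & f & g & ? & ? & ? & ? & ? & ?). exists R, P, Q, f, g.
    rewrite <- E, <- E'. tauto. }
  intros p p' E q q' E'. split; apply K; auto; symmetry; auto.
Qed.

Lemma id_inj : inj (fun x => x).
Proof. intros x y; auto. Qed.
Lemma g_inj (f g : nat -> nat) : (forall x, g (f x) = x) -> inj f.
Proof. intros H x y E. rewrite <- (H x), <- (H y), E. auto. Qed.

Lemma list_bound (f : nat -> nat) l : exists b, forall x, In x l -> f x < b.
Proof.
  induction l as [|y l [b Hb]]; [exists 0; intros x []|].
  exists (S (f y + b)). intros x [<-|H]; [lia|]. apply Hb in H. lia.
Qed.

Lemma NB_tau p q n p' : NB p q -> tr n p LT (RP p') -> exists q', ws q q' /\ NB p' q'.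
Proof.
  intros (R & P & Q & f & g & HR & HPQ & gf & fg & Ep & Eq) Ht.
  destruct (proj1 (proj2 HR) _ _ HPQ) as [WP WQ]. apply proc_dwt in WP.
  eapply harmony_t in Ht as (k & X & Ht & E1); eauto.
  destruct (tr_nren_inv _ _ _ _ Ht f _ (g_inj f g gf) eq_refl) as (l' & r' & Ht' & El & Er).
  destruct l' as [|[?|]|]; try discriminate. destruct r' as [Y| |]; try discriminate. injection Er as ->.
  eapply tr_step_tau in Ht' as (P' & St & E2 & W'); eauto using id_inj.
  destruct (proj1 (proj2 (proj2 HR) _ _ HPQ) P' St) as (Q' & HQ & HR'); [apply proc_dwt; auto|].
  exists (nren f (tl0 Q')). split.
  - rewrite Eq. apply ws_nren, tau_star_ws; auto.
  - exists R, P', Q', f, g. split; auto. split; auto. split; auto. split; auto. split; [|reflexivity].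
    rewrite E1, E2. reflexivity.
Qed.

Lemma trg_dwt D G m : D m = TAbs -> dwt D G (trg m) TAbs.
Proof. intros E. constructor. constructor; constructor. rewrite E; auto. Qed.

(** Freshness becomes a lower bound: any [m] from [b] on is pulled back by [g] to a name absent from
    both named processes. *)
Lemma NB_in p q : NB p q -> exists b, forall m n a F, b <= m -> tr n p (LI (Some a)) (RI F) ->
  exists q1 k G q', ws q q1 /\ tr k q1 (LI (Some a)) (RI G) /\ ws (inst G (trg m)) q' /\
    NB (inst F (trg m)) q'.
Proof.
  intros (R & P & Q & f & g & HR & HPQ & gf & fg & Ep & Eq).
  destruct (list_bound f (fn P ++ fn Q)) as [b Hb]. exists b. intros m n a F Hm Ht.
  destruct (proj1 (proj2 HR) _ _ HPQ) as [WP WQ]. apply proc_dwt in WP.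
  eapply harmony_i in Ht as (k & X & Ht & E1); eauto.
  destruct (tr_nren_inv _ _ _ _ Ht f _ (g_inj f g gf) eq_refl) as (l' & r' & Ht' & El & Er).
  destruct l' as [|[a'|]|]; try discriminate. destruct r' as [|Y|]; try discriminate.
  injection Er as ->. injection El as ->.
  assert (Hgm : forall l, incl l (fn P ++ fn Q) -> ~ In (g m) l).
  { intros l Hl Hi. apply Hl, Hb in Hi. rewrite fg in Hi. lia. }
  pose proof (tr_dwt_i _ _ _ _ _ _ _ Ht' WP) as WF.
  destruct (tr_step_in _ _ _ _ Ht' _ _ eq_refl eq_refl _ P D0 eq_refl WP (trig (g m)) eq_refl)
    as (a0 & P' & <- & St & E2).
  destruct (proj1 (proj2 (proj2 (proj2 HR) _ _ HPQ)) a' (g m) P') as (Q' & HQ & HR'); auto.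
  { apply Hgm. auto with datatypes. } { apply Hgm. auto with datatypes. }
  { apply proc_dwt. rewrite E2. eapply dwt_inst; eauto. apply (trg_dwt D0). reflexivity. }
  destruct HQ as (Q1 & Q2 & T1 & St2 & T2).
  apply step_tr with (r := fun x => x) (e := V) in St2. destruct St2 as (k2 & G & Ht2 & E3).
  apply (tr_nren _ _ _ _) with (f := f) in Ht2. simpl in Ht2.
  exists (nren f (tl0 Q1)), k2, (nren f G), (nren f (tl0 Q')). repeat split.
  - rewrite Eq. apply ws_nren, tau_star_ws; auto.
  - auto.
  - replace (trg m) with (nren f (tl0 (trig (g m)))) by (simpl; rewrite fg; auto).
    rewrite <- nren_inst. apply ws_nren. rewrite E3. apply tau_star_ws; auto.
  - exists R, P', Q', f, g. split; auto. split; auto. split; auto. split; auto. split; [|reflexivity].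
    rewrite E1, E2, nren_inst. replace (trg m) with (nren f (tl0 (trig (g m)))) by (simpl; rewrite fg; auto).
    reflexivity.
Qed.

Lemma news_out_dwt cs a A P : forall r D, ~ In a cs -> cwt D [] (D (r a)) (tlc r V cs A P) ->
  dwt D [] (tl r V (news cs (Out a A P))) TProc.
Proof.
  induction cs as [|c cs IH]; simpl; intros r D Ha H.
  - constructor; tauto.
  - destruct H as [s H]. apply dwt_nu with s. change (nup V) with V. apply IH; [tauto|].
    rewrite upd_neq by (intros ->; tauto). auto.
Qed.

(** The congruence that ends a weak move may lead outside the typed terms; the state just before it
    is still typed. *)
Lemma ws_typed X Y : ws X Y -> forall D G, dwt D G X TProc -> exists Y', dsc Y Y' /\ ws X Y' /\ dwt D G Y' TProc.
Proof.
  induction 1; intros D G Hw.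
  - exists T. split; [symmetry; auto|]. split; auto. apply ws_refl; reflexivity.
  - eapply tr_dwt_t in Hw; eauto. apply IHws in Hw as (Y & ? & ? & ?). exists Y. split; auto.
    split; auto. eapply ws_step; eauto.
Qed.

Lemma tlc_cws ds B Q Q' : tau_star Q Q' -> forall r e, cws (tlc r e ds B Q) (tlc r e ds B Q').
Proof.
  intros H. induction ds; intros; simpl; constructor; auto. apply tau_star_ws; auto.
Qed.

(** The answer [C4] is fixed before [m], as in the definition of normal bisimulation; [C1] is the
    concretion at the moment of the output and [C4] includes the silent moves that follow. *)
Lemma NB_out p q n a C : NB p q -> tr n p (LO a) (RO C) ->
  exists q1 k C1 C4, ws q q1 /\ tr k q1 (LO a) (RO C1) /\ cws C1 C4 /\
    exists b, forall m, b <= m -> NB (cap C (srvF m)) (cap C4 (srvF m)).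
Proof.
  intros (R & P & Q & f & g & HR & HPQ & gf & fg & Ep & Eq) Ht.
  destruct (proj1 (proj2 HR) _ _ HPQ) as [WP WQ]. apply proc_dwt in WP, WQ.
  eapply harmony_o in Ht as (k & C0 & Ht & E1); eauto.
  destruct (tr_nren_inv _ _ _ _ Ht f _ (g_inj f g gf) eq_refl) as (l' & r' & Ht' & El & Er).
  destruct l' as [|[a'|]|a']; try discriminate. destruct r' as [| |C']; try discriminate.
  injection Er as ->. injection El as ->.
  destruct (tr_step_out _ _ _ _ Ht' _ _ eq_refl eq_refl _ P D0 eq_refl WP [] [])
    as (cs & a0 & A & P' & <- & St & _ & _ & E2 & W2).
  apply step_out_subj in St as Ha.
  destruct (proj2 (proj2 (proj2 (proj2 HR) _ _ HPQ)) cs a' A P') as (ds & B & Q' & HQ & HR'); auto.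
  { apply proc_dwt. apply news_out_dwt; auto. }
  destruct HQ as (Q1 & Q2 & T1 & St2 & T2). pose proof (step_out_subj _ _ _ St2) as Hda. simpl in Hda.
  apply step_tr with (r := fun x => x) (e := V) in St2. destruct St2 as (k2 & C1 & Ht2 & E3).
  assert (HC4 : exists C4, cws C1 C4 /\ ceq C4 (tlc (fun x => x) V ds B Q')).
  { apply (proj2 (ceq_cws _ _ E3)). apply tlc_cws; auto. }
  destruct HC4 as (C4 & HC4 & E4).
  (* The answering output is congruent to one made by a typed state, whose object is closed. *)
  assert (Hcv : cvc (tlc (fun x => x) V ds B Q')).
  { apply (tau_star_ws _ _ ) with (r := fun x => x) (e := V) in T1.
    apply ws_typed with (D := D0) (G := []) in T1 as (Y & EY & _ & WY); auto.
    eapply harmony_o in Ht2 as (k3 & C1' & Ht3 & E5); eauto.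
    eapply tr_dwt_o in Ht3; eauto. apply cwt_cvc in Ht3.
    assert (H : cvc C1) by (apply (cvc_ceq _ _ E5); auto).
    apply (cvc_ceq _ _ E4). clear - H HC4. induction HC4; simpl in *; auto. }
  apply (tr_nren _ _ _ _) with (f := f) in Ht2. simpl in Ht2.
  exists (nren f (tl0 Q1)), k2, (cnren f C1), (cnren f C4). repeat split.
  - rewrite Eq. apply ws_nren, tau_star_ws; auto.
  - auto.
  - apply cws_nren; auto.
  - destruct (list_bound f (a' :: cs ++ ds ++ fn P ++ fn Q ++ fn P' ++ fn Q' ++ fn A ++ fn B)) as [b Hb].
    exists b. intros m Hm.
    assert (Hg : ~ In (g m) (a' :: cs ++ ds ++ fn P ++ fn Q ++ fn P' ++ fn Q' ++ fn A ++ fn B)).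
    { intros Hi. apply Hb in Hi. rewrite fg in Hi. lia. }
    specialize (HR' _ Hg). simpl in Hg. rewrite !in_app_iff in Hg.
    exists R, (news cs (Par P' (rep_trig (g m) A))), (news ds (Par Q' (rep_trig (g m) B))), f, g.
    split; auto. split; auto. split; auto. split; auto.
    assert (Em : srvF m = nren f (srvF (g m))) by (rewrite srvF_nren, fg; auto). split.
    + rewrite news_rep_tl; [|tauto|eapply cwt_cvc; eauto].
      rewrite cnren_cap, <- Em. apply ceq_cap; [|reflexivity]. rewrite E1. apply ceq_nren; auto.
    + rewrite news_rep_tl; [|tauto|auto].
      rewrite cnren_cap, <- Em. apply ceq_cap; [|reflexivity]. apply ceq_nren. auto.
Qed.

(** * Factored configurations *)

(* Names are coloured modulo 4: 0 for the names of the original process, 1 and 2 for the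
   private names of the tested process and of its environment, 3 for triggers.  Variable [i]
   stands for the [i]-th exchanged abstraction; [sd i] tells whether the process owns it.
   [tA i] is that abstraction over the earlier variables, [tH i] its closed expansion. *)
Record env := Env { len : nat; mm : nat -> nat; sd : nat -> bool }.
Record side := Side { tD : nat -> ty; tA : nat -> dtm; tH : nat -> dtm; tds : list nat; tp : dtm }.

Definition trs (m : nat -> nat) : nat -> dtm := fun i => trg (m i).
(** [s] marks the indices owned by the process and [fl] the servers that have already made their
    internal step. Stored abstractions appear with triggers for the variables they mention. *)
Fixpoint srvs n (m : nat -> nat) (s fl : nat -> bool) (A : nat -> dtm) : dtm :=
  match n with
  | 0 => N0
  | S k => Pr (srvs k m s fl A)
      (if s k then if fl k then srvu (m k) (vsub (trs m) (A k)) else srv (m k) (vsub (trs m) (A k)) else N0)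
  end.
Definition pf e fl x := nus (tds x) (Pr (vsub (trs (mm e)) (tp x)) (srvs (len e) (mm e) (sd e) fl (tA x))).

Definition okn (b : bool) x := x mod 4 = 0 \/ x mod 4 = if b then 1 else 2.
Definition wfe e := (forall i, mm e i mod 4 = 3) /\
  (forall i j, i < len e -> j < len e -> mm e i = mm e j -> i = j).
Definition pok b n D p := dwt D (GA n) p TProc /\ forall x, nf x p -> okn b x.
(** As [tA x i] only mentions variables below [i], the equation [w_H] determines [tH] by recursion
    on the index. [w_H0] makes [tH] finitely supported, so that one bound covers all its free
    names. *)
Record wfs e x : Prop := {
  w_D : forall a, a mod 4 = 0 \/ a mod 4 = 3 -> tD x a = TAbs;
  w_A : forall i, i < len e -> dwt (tD x) (GA i) (tA x i) TAbs;
  w_H : forall i, i < len e -> tH x i = vsub (tH x) (tA x i);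
  w_H0 : forall i, len e <= i -> tH x i = N0;
  w_n : forall i, i < len e -> forall a, nf a (tA x i) -> okn (sd e i) a;
  w_p : pok true (len e) (tD x) (tp x);
  w_ds : forall d, In d (tds x) -> d mod 4 = 1 }.

Definition setp x p := Side (tD x) (tA x) (tH x) (tds x) p.
Definition extE e m b := Env (S (len e)) (upd (mm e) (len e) m) (upd (sd e) (len e) b).
Definition extS e x D N ds p :=
  Side D (upd (tA x) (len e) N) (upd (tH x) (len e) (vsub (tH x) N)) ds p.
(** The unfolding states of the servers are left existential: silent moves change them without any
    counterpart in the real system. *)
Definition PQ e x y := exists fl fl', NB (pf e fl x) (pf e fl' y).

(** A literal abstraction is opened instead of applied: inserting a redex would raise the beta count
    on which the main induction runs. *)
Definition aapF A := match A with La U => U | _ => Ap (vren S A) (V 0) end.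

Lemma inst_upn U : inst (vren (upn S) U) (V 0) = U.
Proof.
  unfold inst. rewrite vsub_vren. rewrite <- (vsub_V U) at 2. f_equal. extensionality x. destruct x; auto.
Qed.
Lemma aapF_dsc A : dsc (aapF A) (Ap (vren S A) (V 0)).
Proof.
  destruct A; simpl; try reflexivity. rewrite dsc_beta, inst_upn. reflexivity.
Qed.
Lemma aapF_vsub s A : dsc (vsub (up s) (aapF A)) (Ap (vren S (vsub s A)) (V 0)).
Proof. rewrite aapF_dsc. simpl. rewrite vsub_wk. reflexivity. Qed.
Lemma aapF_dwt D G A : dwt D G A TAbs -> dwt D (TAbs :: G) (aapF A) TProc.
Proof.
  intros H. inversion H; subst; simpl; auto.
  constructor; constructor; auto.
Qed.
Lemma aapF_nf x A : nf x (aapF A) -> nf x A.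
Proof. destruct A; simpl; rewrite ?nf_vren; tauto. Qed.

Lemma GA_S n : GA (S n) = GA n ++ [TAbs].
Proof. apply repeat_cons. Qed.
Lemma dwt_GA D n T s : dwt D (GA n) T s -> dwt D (GA (S n)) T s.
Proof. rewrite GA_S. apply dwt_app_ctx. Qed.
Lemma GA_ext D n T s v w : dwt D (GA n) T s -> (forall x, x < n -> v x = w x) -> vsub v T = vsub w T.
Proof. intros H E. eapply dwt_vsub_ext; eauto. rewrite repeat_length; auto. Qed.
Lemma GA_ext_up D n T s t v w : dwt D (t :: GA n) T s -> (forall x, x < n -> v x = w x) ->
  vsub (up v) T = vsub (up w) T.
Proof.
  intros H E. eapply dwt_vsub_ext; eauto. simpl. rewrite repeat_length.
  intros [|x] Hx; simpl; auto. rewrite E; auto; lia.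
Qed.
Lemma upd_lt {X} (f : nat -> X) n v x : x < n -> upd f n v x = f x.
Proof. intros. apply upd_neq. lia. Qed.

Lemma tH_dwt e x : wfs e x -> forall i, i < len e -> dwt (tD x) [] (tH x i) TAbs.
Proof.
  intros W. induction i as [i IH] using lt_wf_ind. intros Hi.
  rewrite (w_H _ _ W) by auto. eapply dwt_vsub; [apply (w_A _ _ W); auto|].
  intros j s Hj. apply GA_nth in Hj as [-> ?]. apply IH; auto; lia.
Qed.
Lemma tH_La e x : wfs e x -> forall i, i < len e -> exists U, tH x i = La U.
Proof.
  intros W i Hi. apply (tH_dwt _ _ W) in Hi. inv Hi; eauto. destruct x0; discriminate.
Qed.
Definition body T := match T with La U => U | _ => N0 end.
Lemma tH_body e x i : wfs e x -> i < len e -> tH x i = La (body (tH x i)).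
Proof. intros W Hi. destruct (tH_La _ _ W _ Hi) as [U ->]. auto. Qed.
Lemma tH_bound e x : wfs e x -> exists b, forall i a, nf a (tH x i) -> a < b.
Proof.
  intros W. assert (K : forall n, exists b, forall i a, i < n -> nf a (tH x i) -> a < b).
  { induction n as [|n [b IH]]; [exists 0; lia|]. destruct (nf_bound (tH x n)) as [b' Hb'].
    exists (b + b'). intros i a Hi Ha. destruct (Nat.eq_dec i n) as [->|]; [apply Hb' in Ha; lia|].
    apply IH in Ha; lia. }
  destruct (K (len e)) as [b Hb]. exists b. intros i a Ha.
  destruct (le_lt_dec (len e) i) as [Hi|Hi]; [rewrite (w_H0 _ _ W) in Ha by auto; contradiction|eauto].
Qed.
Lemma tA_bound x n : exists b, forall i a, i < n -> nf a (tA x i) -> a < b.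
Proof.
  induction n as [|n [b IH]]; [exists 0; lia|]. destruct (nf_bound (tA x n)) as [b' Hb'].
  exists (b + b'). intros i a Hi Ha. destruct (Nat.eq_dec i n) as [->|]; [apply Hb' in Ha; lia|].
  apply IH in Ha; lia.
Qed.

Lemma wfs_setp e x p : wfs e x -> pok true (len e) (tD x) p -> wfs e (setp x p).
Proof. intros [] H. split; simpl; auto. Qed.

Lemma choose_m e b : wfe e -> exists m, b <= m /\ m mod 4 = 3 /\ forall s, wfe (extE e m s).
Proof.
  intros [W1 W2].
  assert (K : forall n, exists b, forall i, i < n -> mm e i < b).
  { induction n as [|n [c IH]]; [exists 0; lia|]. exists (S (c + mm e n)). intros i Hi.
    destruct (Nat.eq_dec i n) as [->|]; [lia|]. specialize (IH i). lia. }
  (* The residue is 3, the class of triggers, and the value exceeds both [b] and all triggers in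
     use. *)
  destruct (K (len e)) as [c Hc]. exists (3 + (b + c) * 4).
  assert (E : (3 + (b + c) * 4) mod 4 = 3) by (rewrite Nat.Div0.mod_add; auto).
  split; [lia|]. split; auto. intros s. split; simpl len; simpl mm.
  - intros i. destruct (Nat.eq_dec i (len e)) as [->|]; upds; auto.
  - intros i j Hi Hj. destruct (Nat.eq_dec i (len e)) as [->|], (Nat.eq_dec j (len e)) as [->|]; upds; auto.
    + intros E'. assert (mm e j < c) by (apply Hc; lia). lia.
    + intros E'. assert (mm e i < c) by (apply Hc; lia). lia.
    + apply W2; lia.
Qed.

Lemma wfs_ext e x m b D N ds p : wfs e x -> (forall a, a mod 4 = 0 \/ a mod 4 = 3 -> D a = TAbs) ->
  (forall i a, i < len e -> nf a (tA x i) -> tD x a = D a) ->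
  dwt D (GA (len e)) N TAbs -> (forall a, nf a N -> okn b a) ->
  pok true (S (len e)) D p -> (forall d, In d ds -> d mod 4 = 1) ->
  wfs (extE e m b) (extS e x D N ds p).
Proof.
  intros W HD HA HN Hn Hp Hds.
  assert (EX : forall j T s, j <= len e -> dwt D (GA j) T s ->
    vsub (upd (tH x) (len e) (vsub (tH x) N)) T = vsub (tH x) T).
  { intros. eapply GA_ext; eauto. intros. apply upd_lt; lia. }
  assert (WA : forall i, i < len e -> dwt D (GA i) (tA x i) TAbs).
  { intros i Hi. eapply dwt_D; [apply (w_A _ _ W); auto|]. intros; eapply HA; eauto. }
  split; simpl; auto.
  - intros i Hi. destruct (Nat.eq_dec i (len e)) as [->|]; upds; auto. apply WA; lia.
  - intros i Hi. destruct (Nat.eq_dec i (len e)) as [->|]; upds.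
    + symmetry. eapply EX; eauto.
    + rewrite (EX i _ TAbs) by (auto; try apply WA; lia). apply (w_H _ _ W). lia.
  - intros i Hi. rewrite upd_neq by lia. apply (w_H0 _ _ W). lia.
  - intros i Hi a Ha. destruct (Nat.eq_dec i (len e)) as [->|]; upds; auto. apply (w_n _ _ W i); auto. lia.
Qed.

Lemma pok_tr b n D p k l r : pok b n D p -> tr k p l r ->
  match l, r with
  | LT, RP p' => pok b n D p'
  | LI (Some a), RI F => dwt D (D a :: GA n) F TProc /\ (forall x, nf x F -> okn b x)
  | LO a, RO C => cwt D (GA n) (D a) C /\ (forall x, cnf x C -> okn b x)
  | _, _ => True end.
Proof.
  intros [H1 H2] Ht. pose proof (tr_nf _ _ _ _ Ht) as Hn. pose proof (tr_dwt _ _ _ _ Ht _ _ _ H1) as Hw.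
  destruct l as [|[a|]|a], r; auto; split; try tauto; intros; apply H2, Hn; auto.
Qed.
Lemma pok_cap b n D C F : cwt D (GA n) TAbs C -> (forall x, cnf x C -> okn b x) ->
  dwt D (TAbs :: GA n) F TProc -> (forall x, nf x F -> okn b x) -> pok b n D (cap C F).
Proof.
  intros. split; [eapply cwt_cap; eauto|]. intros x Hx. apply nf_cap in Hx as [?|?]; auto.
Qed.

(* Resolving a call amounts to a beta step once the stored abstractions are substituted. *)
Lemma call_resolve e x E i C : wfs e x -> i < len e -> call E i C ->
  dsc (vsub (tH x) E) (vsub (tH x) (cap C (aapF (tA x i)))).
Proof.
  intros W Hi Hc. rewrite (call_dsc _ _ _ Hc _ _ (tH_body _ _ _ W Hi)).
  rewrite cvsub_cap. apply ceq_cap; [reflexivity|]. rewrite aapF_vsub, <- (w_H _ _ W) by auto.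
  rewrite (tH_body _ _ _ W Hi) at 2. simpl. rewrite dsc_beta, inst_upn. reflexivity.
Qed.
Lemma pok_self e x E i C : wfs e x -> i < len e -> pok (sd e i) (len e) (tD x) E -> call E i C ->
  pok (sd e i) (len e) (tD x) (cap C (aapF (tA x i))).
Proof.
  intros W Hi [H1 H2] Hc. apply pok_cap.
  - eapply call_dwt; eauto.
  - intros a Ha. apply H2. eapply call_nf; eauto.
  - apply aapF_dwt. replace (len e) with (i + (len e - i)) by lia. rewrite repeat_app.
    apply dwt_app_ctx. apply (w_A _ _ W); auto.
  - intros a Ha. apply aapF_nf in Ha. apply (w_n _ _ W i); auto.
Qed.

Lemma srvs_ext n D : forall m m' s s' fl fl' A A', (forall i, i < n -> m i = m' i) ->
  (forall i, i < n -> s i = s' i) -> (forall i, i < n -> fl i = fl' i) ->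
  (forall i, i < n -> s i = true -> A i = A' i) -> (forall i, i < n -> dwt D (GA i) (A i) TAbs) ->
  srvs n m s fl A = srvs n m' s' fl' A'.
Proof.
  induction n; intros m m' s s' fl fl' A A' Hm Hs Hf HA HD; simpl; auto. f_equal; auto 10.
  rewrite <- Hs, <- Hf, <- Hm by auto. destruct (s n) eqn:E; auto. rewrite <- (HA n) by auto.
  replace (vsub (trs m') (A n)) with (vsub (trs m) (A n)); auto.
  eapply GA_ext; eauto. intros i Hi. unfold trs. rewrite Hm; auto.
Qed.
Lemma srvs_nf n m s fl A x : nf x (srvs n m s fl A) -> (exists i, x = m i) \/ exists i, i < n /\ s i = true /\ nf x (A i).
Proof.
  induction n; simpl; [tauto|]. intros [H|H].
  - apply IHn in H as [?|(i & ? & ? & ?)]; auto. right. exists i. repeat split; auto.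
  - destruct (s n) eqn:E; [|contradiction].
    assert (K : x = m n \/ nf x (vsub (trs m) (A n))).
    { destruct (fl n); [apply srvu_nf|apply srv_nf]; auto. }
    destruct K as [->|K]; eauto. apply nf_vsub in K as [K|[i K]]; [right; exists n; auto|].
    simpl in K. left. exists i. tauto.
Qed.
Lemma srvs_tr_inv n m s fl A k l r : tr k (srvs n m s fl A) l r ->
  (l = LT /\ exists i X, i < n /\ s i = true /\ r = RP X /\ dsc X (srvs n m s (upd fl i true) A)) \/
  (exists i F, i < n /\ s i = true /\ fl i = true /\ l = LI (Some (m i)) /\ r = RI F /\
     dsc F (Pr (vren S (srvs n m s (upd fl i false) A)) (Ap (vren S (vsub (trs m) (A i))) (V 0)))).
Proof.
  assert (EX : forall n i b, n <= i -> srvs n m s (upd fl i b) A = srvs n m s fl A).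
  { clear. induction n; intros i b H; simpl; auto. rewrite IHn, upd_neq by lia. auto. }
  revert k l r. induction n; simpl; intros k l r Ht; [inv Ht|]. inv Ht.
  - match goal with H : tr _ (srvs _ _ _ _ _) _ _ |- _ => apply IHn in H as [(-> & i & X & ? & ? & -> & E)|(i & F & ? & ? & ? & -> & -> & E)] end.
    + left. split; auto. eexists i, _. repeat split; auto. rewrite E, upd_neq by lia. reflexivity.
    + right. eexists i, _. repeat split; auto. simpl. rewrite E, upd_neq by lia.
      rewrite <- !dsc_assoc. rewrite (dsc_comm (Ap _ _)). reflexivity.
  - destruct (s n) eqn:Es; [|match goal with H : tr _ N0 _ _ |- _ => inv H end]. destruct (fl n) eqn:ctx_tl.
    + match goal with H : tr _ (srvu _ _) _ _ |- _ => apply srvu_tr_inv in H as (-> & F & -> & E) end.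
      right. eexists n, _. repeat split; auto. simpl. rewrite E, upd_eq, EX by lia. apply dsc_assoc.
    + match goal with H : tr _ (srv _ _) _ _ |- _ => apply srv_tr_inv in H as (-> & F & -> & E) end.
      left. split; auto. eexists n, _. repeat split; auto. simpl. rewrite E, upd_eq, EX by lia. reflexivity.
  - exfalso. destruct (s n); [|match goal with H : tr _ N0 _ _ |- _ => inv H end]. destruct (fl n).
    + match goal with H : tr _ (srvu _ _) _ _ |- _ => apply srvu_tr_inv in H as (? & _) end. discriminate.
    + match goal with H : tr _ (srv _ _) _ _ |- _ => apply srv_tr_inv in H as (? & _) end. discriminate.
  - exfalso. match goal with H : tr _ (srvs _ _ _ _ _) (LO _) _ |- _ => apply IHn in H as [(? & _)|(i & F0 & ? & ? & ? & ? & _)] end; discriminate.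
Qed.
Lemma srvs_unfold n m s fl A i : i < n -> s i = true -> fl i = false ->
  exists k X, tr k (srvs n m s fl A) LT (RP X) /\ dsc X (srvs n m s (upd fl i true) A).
Proof.
  assert (EX : forall n i b, n <= i -> srvs n m s (upd fl i b) A = srvs n m s fl A).
  { clear. induction n; intros i b H; simpl; auto. rewrite IHn, upd_neq by lia. auto. }
  intros Hi Hs Hf. induction n; [lia|]. simpl. destruct (Nat.eq_dec i n) as [->|].
  - rewrite Hs, Hf. destruct (srv_tr (m n) (vsub (trs m) (A n))) as (k & X & Ht & E).
    eexists _, _. split; [apply tr_pr_t; eauto|]. rewrite upd_eq, EX, E by lia. reflexivity.
  - destruct IHn as (k & X & Ht & E); [lia|]. eexists _, _. split; [apply tr_pl_t; eauto|].
    rewrite E, upd_neq by lia. reflexivity.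
Qed.
Lemma srvs_serve n m s fl A i : i < n -> s i = true -> fl i = true ->
  exists k F, tr k (srvs n m s fl A) (LI (Some (m i))) (RI F) /\
   dsc F (Pr (vren S (srvs n m s (upd fl i false) A)) (Ap (vren S (vsub (trs m) (A i))) (V 0))).
Proof.
  assert (EX : forall n i b, n <= i -> srvs n m s (upd fl i b) A = srvs n m s fl A).
  { clear. induction n; intros i b H; simpl; auto. rewrite IHn, upd_neq by lia. auto. }
  intros Hi Hs Hf. induction n; [lia|]. simpl. destruct (Nat.eq_dec i n) as [->|].
  - rewrite Hs, Hf. destruct (srvu_tr (m n) (vsub (trs m) (A n))) as (k & X & Ht & E).
    eexists _, _. split; [apply tr_pr_i; eauto|]. rewrite upd_eq, EX, E by lia. apply dsc_assoc.
  - destruct IHn as (k & X & Ht & E); [lia|]. eexists _, _. split; [apply tr_pl_i; eauto|].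
    rewrite E, upd_neq by lia. rewrite <- !dsc_assoc. rewrite (dsc_comm (Ap _ _)). reflexivity.
Qed.

Lemma not_1 x : x mod 4 = 0 \/ x mod 4 = 3 -> x mod 4 <> 1.
Proof. intros [->| ->]; discriminate. Qed.
Lemma okn_3 b x : okn b x -> x mod 4 <> 3.
Proof. intros [->| ->]; [|destruct b]; discriminate. Qed.
Lemma okn_0 x : okn true x -> okn false x -> x mod 4 = 0.
Proof. intros [?|?] [?|?]; auto. congruence. Qed.

Lemma tr_Pr_t n T U X : tr n (Pr T U) LT (RP X) ->
  (exists T', tr n T LT (RP T') /\ X = Pr T' U) \/ (exists U', tr n U LT (RP U') /\ X = Pr T U') \/
  (exists k j a F C, tr k T (LI (Some a)) (RI F) /\ tr j U (LO a) (RO C) /\ X = cap C F) \/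
  (exists k j a F C, tr k U (LI (Some a)) (RI F) /\ tr j T (LO a) (RO C) /\ X = cap C F).
Proof.
  intros H. inversion H; subst.
  - destruct r; try discriminate. left. eexists; split; eauto. simpl in *; congruence.
  - destruct r; try discriminate. right; left. eexists; split; eauto. simpl in *; congruence.
  - right; right; left. eauto 10.
  - right; right; right. eauto 10.
Qed.
Lemma tr_Pr_i n T U s F : tr n (Pr T U) (LI s) (RI F) ->
  (exists F', tr n T (LI s) (RI F') /\ F = Pr F' (vren S U)) \/
  (exists F', tr n U (LI s) (RI F') /\ F = Pr (vren S T) F').
Proof.
  intros H. inversion H; subst.
  - destruct r; try discriminate. left. eexists; split; eauto. simpl in *; congruence.
  - destruct r; try discriminate. right. eexists; split; eauto. simpl in *; congruence.
Qed.
Lemma tr_Pr_o n T U a C : tr n (Pr T U) (LO a) (RO C) ->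
  (exists C', tr n T (LO a) (RO C') /\ C = cpl C' U) \/
  (exists C', tr n U (LO a) (RO C') /\ C = cpr T C').
Proof.
  intros H. inversion H; subst.
  - destruct r; try discriminate. left. eexists; split; eauto. simpl in *; congruence.
  - destruct r; try discriminate. right. eexists; split; eauto. simpl in *; congruence.
Qed.

Lemma trs_inv e D p n l r : wfe e -> pok true (len e) D p -> tr n (vsub (trs (mm e)) p) l r ->
  (exists m r0, tr m p l r0 /\ r = rvsub (trs (mm e)) r0) \/
  (exists i C, i < len e /\ l = LO (mm e i) /\ call p i C /\ r = RO (cvsub (trs (mm e)) C)).
Proof.
  intros [W _] [Hw Hn] Ht. eapply tr_trg_inv; eauto.
  intros i Hi Hx. apply Hn, okn_3 in Hx. apply Hx, W.
Qed.

Lemma lav_0 e x l : wfs e x -> (forall a, lname l = Some a -> a mod 4 = 0 \/ a mod 4 = 3) -> lav (tds x) l.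
Proof.
  intros W Hl d Hd E. apply (w_ds _ _ W) in Hd. apply Hl in E. lia.
Qed.

(** Servers never output, so three kinds of silent moves remain: one of [tp], the unfolding of a
    server, and a call accepted by a server. The second leaves the real system unchanged and the
    third is a beta step there, hence at most one real step results. *)
Lemma pf_tau_inv e fl y n X : wfe e -> wfs e y -> tr n (pf e fl y) LT (RP X) ->
  exists fl' q', dsc X (pf e fl' (setp y q')) /\ wfs e (setp y q') /\
    ws (vsub (tH y) (tp y)) (vsub (tH y) q').
Proof.
  intros WE W Ht. pose proof (w_p _ _ W) as WP.
  apply nus_tr_inv in Ht as (r0 & Ht & Er & _). destruct r0 as [X0| |]; try discriminate. injection Er as ->.
  apply tr_Pr_t in Ht as [(T' & Ht & ->)|[(U' & Ht & ->)|[(k & j & a & F & C & _ & Ht & _)|(k & j & a & F & C & Ht1 & Ht2 & ->)]]].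
  - eapply trs_inv in Ht as [(m & r0 & Hq & Er)|(i & C & _ & E & _)]; eauto; [|discriminate].
    destruct r0 as [q'| |]; try discriminate. injection Er as ->.
    exists fl, q'. split; [reflexivity|]. split.
    + apply wfs_setp; auto. apply (pok_tr _ _ _ _ _ _ _ WP Hq).
    + eapply ws_step; [apply (tr_vsub _ _ _ _ Hq)|apply ws_refl; reflexivity].
  - apply srvs_tr_inv in Ht as [(_ & i & X & ? & ? & Er & E)|(i & F & ? & ? & ? & E & _)]; [|discriminate].
    injection Er as ->. exists (upd fl i true), (tp y). split; [|split; [|apply ws_refl; reflexivity]].
    + unfold pf. simpl. rewrite E. reflexivity.
    + apply wfs_setp; auto.
  - exfalso. apply srvs_tr_inv in Ht as [(? & _)|(i & ? & ? & ? & ? & ? & _)]; discriminate.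
  - apply srvs_tr_inv in Ht1 as [(? & _)|(i & F0 & Hi & Hs & ? & E & Er & EF)]; [discriminate|].
    injection E as ->. injection Er as <-.
    eapply trs_inv in Ht2 as [(m & r0 & Hq & Er)|(j' & C0 & Hj & E & Hc & Er)]; eauto.
    + exfalso.
      pose proof (tr_lab_nf _ _ _ _ Hq _ eq_refl) as Hn. apply WP, okn_3 in Hn. apply Hn, (proj1 WE).
    + injection E as E. injection Er as ->. apply WE in E; auto. subst j'.
      exists (upd fl i false), (cap C0 (aapF (tA y i))). split; [|split].
      * unfold pf. simpl. apply nus_dsc. rewrite (ceq_cap _ _ (ceq_refl _) _ _ EF), cap_wkl, dsc_comm.
        apply Pr_dsc; [|reflexivity]. rewrite cvsub_cap. apply ceq_cap; [reflexivity|].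
        symmetry. apply aapF_vsub.
      * apply wfs_setp; auto. rewrite <- Hs. eapply pok_self; eauto. rewrite Hs; auto.
      * apply ws_refl. apply call_resolve with (e := e); auto.
Qed.

Lemma pf_ws e y X Y : wfe e -> ws X Y -> forall fl q, wfs e (setp y q) -> dsc X (pf e fl (setp y q)) ->
  exists fl' q', dsc Y (pf e fl' (setp y q')) /\ wfs e (setp y q') /\ ws (vsub (tH y) q) (vsub (tH y) q').
Proof.
  intros WE. induction 1; intros fl q W E.
  - exists fl, q. split; [rewrite <- H; auto|]. split; auto. apply ws_refl; reflexivity.
  - eapply harmony_t in H as (m & U' & Ht & E'); eauto.
    apply pf_tau_inv in Ht as (fl1 & q1 & E1 & W1 & S1); auto.
    destruct (IHws fl1 q1) as (fl2 & q2 & E2 & W2 & S2); auto. { rewrite E', E1. reflexivity. }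
    exists fl2, q2. split; auto. split; auto. eapply ws_trans; eauto.
Qed.

Lemma pf_ws0 e y fl Y : wfe e -> wfs e y -> ws (pf e fl y) Y ->
  exists fl' q', dsc Y (pf e fl' (setp y q')) /\ wfs e (setp y q') /\ ws (vsub (tH y) (tp y)) (vsub (tH y) q').
Proof.
  intros WE W H. destruct y as [D A H0 ds p]. apply (pf_ws e (Side D A H0 ds p) _ _ WE H fl p W). reflexivity.
Qed.

Lemma inst_nus ds Y N : (forall d, In d ds -> ~ nf d N) -> inst (nus ds Y) N = nus ds (inst Y N).
Proof. intros H. apply vsub_nus. intros d [|i] Hd; simpl; auto. Qed.
Lemma trg_nf d m : nf d (trg m) -> d = m.
Proof. simpl. tauto. Qed.
Lemma ds_trg e x m d : wfs e x -> m mod 4 = 3 -> In d (tds x) -> ~ nf d (trg m).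
Proof. intros W Hm Hd E. apply trg_nf in E. subst. apply (w_ds _ _ W) in Hd. lia. Qed.

Lemma srvs_extE e fl fl' y D N ds p m b : wfs e y -> (forall i, i < len e -> fl i = fl' i) ->
  srvs (len e) (mm (extE e m b)) (sd (extE e m b)) fl' (tA (extS e y D N ds p)) =
  srvs (len e) (mm e) (sd e) fl (tA y).
Proof.
  intros W Hf. symmetry. apply srvs_ext with (D := tD y); simpl; intros; auto; try (rewrite upd_lt; auto).
  apply (w_A _ _ W); auto.
Qed.

Lemma trs_upd f n m : trs (upd f n m) n = trg m.
Proof. unfold trs. rewrite upd_eq. reflexivity. Qed.

(** Feeding the trigger [m] amounts to appending a variable owned by the environment. The stored [N]
    matters only for [tH], since [pf] sees the new variable as a trigger. *)
Lemma in_form e fl y a G m N : wfs e y -> m mod 4 = 3 -> dwt (tD y) (tD y a :: GA (len e)) G TProc ->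
  dsc (inst (nus (tds y) (Pr (vsub (up (trs (mm e))) G) (vren S (srvs (len e) (mm e) (sd e) fl (tA y))))) (trg m))
   (pf (extE e m false) fl (extS e y (tD y) N (tds y) (inst G (V (len e))))).
Proof.
  intros W Hm HG. rewrite inst_nus by (intros; eapply ds_trg; eauto).
  unfold pf. apply nus_dsc. rewrite inst_Pr, inst_wk. apply Pr_dsc.
  - simpl. rewrite vsub_inst. simpl. rewrite trs_upd.
    rewrite (GA_ext_up _ _ _ _ _ (trs (upd (mm e) (len e) m)) (trs (mm e)) HG); [reflexivity|].
    intros i Hi. unfold trs. rewrite upd_lt; auto.
  - simpl len. simpl srvs. rewrite upd_eq, dsc_nil.
    rewrite <- (srvs_extE e fl fl y (tD y) N (tds y) (inst G (V (len e))) m false); auto. reflexivity.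
Qed.

(** The same for a trigger sent to a server: the process gains a copy of [tA y i] called on the new
    variable, and the server returns to its initial state. *)
Lemma serve_form e fl y i m N F1 : wfs e y -> m mod 4 = 3 -> i < len e ->
  dsc F1 (Pr (vren S (srvs (len e) (mm e) (sd e) (upd fl i false) (tA y))) (Ap (vren S (vsub (trs (mm e)) (tA y i))) (V 0))) ->
  dsc (inst (nus (tds y) (Pr (vren S (vsub (trs (mm e)) (tp y))) F1)) (trg m))
   (pf (extE e m false) (upd fl i false) (extS e y (tD y) N (tds y) (Pr (tp y) (inst (aapF (tA y i)) (V (len e)))))).
Proof.
  intros W Hm Hi EF. rewrite inst_nus by (intros; eapply ds_trg; eauto).
  unfold pf. apply nus_dsc. rewrite EF, !inst_Pr, !inst_wk.
  set (m' := upd (mm e) (len e) m).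
  assert (EX : forall j T s, j <= len e -> dwt (tD y) (GA j) T s -> vsub (trs m') T = vsub (trs (mm e)) T).
  { intros. eapply GA_ext; eauto. intros. unfold trs, m'. rewrite upd_lt; auto; lia. }
  simpl len. simpl srvs. simpl tp. rewrite upd_eq, dsc_nil.
  rewrite <- (srvs_extE e (upd fl i false) (upd fl i false) y (tD y) N (tds y) (tp y) m false) by auto.
  simpl. fold m'. rewrite (dsc_comm _ (inst _ _)), dsc_assoc. apply Pr_dsc; [|reflexivity].
  apply Pr_dsc.
  - rewrite (EX (len e) _ TProc); auto; [reflexivity|]. apply (w_p _ _ W).
  - rewrite vsub_inst. simpl. unfold m' at 2. rewrite trs_upd, aapF_vsub.
    rewrite (EX i _ TAbs); [reflexivity|lia|]. apply (w_A _ _ W); auto.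
Qed.

Definition econc e fl x C := cnus (tds x) (cpl (cvsub (trs (mm e)) C) (srvs (len e) (mm e) (sd e) fl (tA x))).

Lemma trs_nf e d i : wfe e -> d mod 4 = 1 -> ~ nf d (trs (mm e) i).
Proof. intros [W _] Hd E. apply trg_nf in E. subst. rewrite W in Hd. discriminate. Qed.
Lemma srvs_fresh e fl y d : wfe e -> d mod 4 = 1 -> (forall i, i < len e -> ~ nf d (tA y i)) ->
  ~ nf d (srvs (len e) (mm e) (sd e) fl (tA y)).
Proof.
  intros [W _] Hd HA H. apply srvs_nf in H as [[i ->]|(i & ? & _ & ?)]; [rewrite W in Hd; discriminate|].
  eapply HA; eauto.
Qed.
Lemma econc_open e fl y ks N q : wfe e -> wfs e y -> (forall k, In k ks -> k mod 4 = 1) ->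
  (forall k i, In k ks -> i < len e -> ~ nf k (tA y i)) ->
  econc e fl y (cnus ks (CB N q)) = cnus (tds y ++ ks) (CB (vsub (trs (mm e)) N)
    (Pr (vsub (trs (mm e)) q) (srvs (len e) (mm e) (sd e) fl (tA y)))).
Proof.
  intros WE W Hk HA. unfold econc. rewrite cnus_app, cvsub_cnus, cpl_cnus; auto.
  - intros. apply srvs_fresh; auto.
  - intros. apply trs_nf; auto.
Qed.
(** The receiving context [srvF m] is exactly the server of the new variable, owned by the process;
    its flag is false since it has not moved yet. *)
Lemma emit_form e fl y ks N q m D : wfe e -> wfs e y -> (forall k, In k ks -> k mod 4 = 1) -> m mod 4 = 3 ->
  dwt D (GA (len e)) N TAbs -> dwt D (GA (len e)) q TProc ->
  dsc (cap (cnus (tds y ++ ks) (CB (vsub (trs (mm e)) N)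
    (Pr (vsub (trs (mm e)) q) (srvs (len e) (mm e) (sd e) fl (tA y))))) (srvF m))
  (pf (extE e m true) (upd fl (len e) false) (extS e y D N (tds y ++ ks) q)).
Proof.
  intros WE W Hk Hm HN Hq. rewrite cap_cnus.
  2: { intros d Hd Hn. apply srv_nf in Hn as [->|[]].
       apply in_app_iff in Hd as [Hd|Hd]; [apply (w_ds _ _ W) in Hd|apply Hk in Hd]; lia. }
  unfold pf. apply nus_dsc. simpl cap. simpl len. simpl srvs. rewrite !upd_eq.
  set (m' := upd (mm e) (len e) m).
  assert (EX : forall T s, dwt D (GA (len e)) T s -> vsub (trs m') T = vsub (trs (mm e)) T).
  { intros. eapply GA_ext; eauto. intros. unfold trs, m'. rewrite upd_lt; auto; lia. }
  change (mm (extE e m true)) with m'. change (tp (extS e y D N (tds y ++ ks) q)) with q.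
  rewrite (EX _ _ HN), (EX _ _ Hq). change (Nu ?a) with (Nu a).
  rewrite (inst_srvF m (vsub (trs (mm e)) N)).
  rewrite <- (srvs_extE e fl (upd fl (len e) false) y D N (tds y ++ ks) q m true); auto.
  2: { intros. rewrite upd_lt; auto. }
  simpl. fold m'. rewrite dsc_comm, dsc_assoc. reflexivity.
Qed.

(** Ordinary outputs and calls are grouped together because a call, under triggers, is an output and
    is answered in the same way. *)
Definition emits e p a C := (a mod 4 = 0 /\ exists k, tr k p (LO a) (RO C)) \/
  (exists i, i < len e /\ a = mm e i /\ call p i C).
Lemma emits_class e p a C : wfe e -> emits e p a C -> a mod 4 = 0 \/ a mod 4 = 3.
Proof. intros [W _] [[? _]|(i & _ & -> & _)]; auto. Qed.
Lemma emits_ok e x p a C : wfs e (setp x p) -> emits e p a C ->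
  cwt (tD x) (GA (len e)) TAbs C /\ forall y, cnf y C -> okn true y.
Proof.
  intros W [[Ha [k Ht]]|(i & Hi & -> & Hc)].
  - pose proof (pok_tr _ _ _ _ _ _ _ (w_p _ _ W) Ht) as K. simpl in K.
    pose proof (w_D _ _ W a (or_introl Ha)) as ED. simpl in ED. rewrite ED in K. exact K.
  - destruct (w_p _ _ W) as [K1 K2]. split; [eapply call_dwt; eauto|].
    intros. apply K2. eapply call_nf; eauto.
Qed.
Lemma pf_emit e fl x a C : wfe e -> wfs e x -> emits e (tp x) a C ->
  exists n, tr n (pf e fl x) (LO a) (RO (econc e fl x C)).
Proof.
  intros WE W He.
  assert (K : exists n, tr n (vsub (trs (mm e)) (tp x)) (LO a) (RO (cvsub (trs (mm e)) C))).
  { destruct He as [[_ [k Ht]]|(i & _ & -> & Hc)].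
    - exists k. apply (tr_vsub _ _ _ _ Ht).
    - eapply call_tr; eauto. }
  destruct K as [n Ht]. exists n.
  apply (nus_tr (tds x) _ _ (LO a) (RO _) (tr_pl_o _ _ _ _ _ Ht)).
  eapply lav_0; eauto. simpl. intros b E. injection E as <-. eapply emits_class; eauto.
Qed.
Lemma pf_emit_inv e fl y n a C0 : wfe e -> wfs e y -> tr n (pf e fl y) (LO a) (RO C0) ->
  a mod 4 = 0 \/ a mod 4 = 3 -> exists C, emits e (tp y) a C /\ C0 = econc e fl y C.
Proof.
  intros WE W Ht Ha. apply nus_tr_inv in Ht as (r0 & Ht & Er & _).
  destruct r0 as [| |C1]; try discriminate. injection Er as ->. apply tr_Pr_o in Ht as [(C2 & Ht & ->)|(C2 & Ht & ->)].
  - eapply trs_inv in Ht as [(m & r0 & Hq & Er)|(i & C & Hi & E & Hc & Er)]; eauto; [| |apply (w_p _ _ W)].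
    + destruct r0 as [| |C]; try discriminate. injection Er as ->. exists C. split; [|reflexivity].
      left. split; eauto. destruct Ha as [|Ha]; auto. exfalso.
      pose proof (tr_lab_nf _ _ _ _ Hq _ eq_refl) as Hn. apply (w_p _ _ W), okn_3 in Hn. auto.
    + injection E as ->. injection Er as ->. exists C. split; [|reflexivity]. right; eauto.
  - exfalso. apply srvs_tr_inv in Ht as [(? & _)|(i & ? & ? & ? & ? & ? & _)]; discriminate.
Qed.

Lemma cws_nren_inv f : inj f -> forall C X, cws (cnren f C) X -> exists C', cws C C' /\ ceq X (cnren f C').
Proof.
  intros Hf C. revert f Hf. induction C; simpl; intros f Hf X HX; inv HX.
  - apply ws_nren_inv in H2 as (T2 & ? & ?); auto. exists (CB A T2). split; [constructor; auto|].
    simpl. constructor; auto. reflexivity.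
  - destruct (IHC _ (upn_inj _ Hf) _ H0) as (C2 & ? & E). exists (CN C2). split; [constructor; auto|].
    simpl. rewrite E; reflexivity.
Qed.
Lemma cws_cnus_inv ks A T : forall X, cws (cnus ks (CB A T)) X ->
  exists T', ws T T' /\ ceq X (cnus ks (CB A T')).
Proof.
  induction ks as [|k ks IH]; simpl; intros X HX; inv HX.
  - exists T'. split; auto. reflexivity.
  - destruct (cws_nren_inv _ (clo_inj k) _ _ H0) as (C2 & H2 & E). apply IH in H2 as (T' & ? & E').
    exists T'. split; auto. unfold cnu. apply ceq_n. rewrite E. apply ceq_nren; auto.
Qed.

(** * Moves of the tested process and their answers *)

Lemma M_tau e x y n p' : wfe e -> wfs e y -> PQ e x y -> tr n (tp x) LT (RP p') ->
  exists q', wfs e (setp y q') /\ ws (vsub (tH y) (tp y)) (vsub (tH y) q') /\ PQ e (setp x p') (setp y q').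
Proof.
  intros WE WY (fl & fl' & HNB) Ht.
  assert (Ht' : tr n (pf e fl x) LT (RP (pf e fl (setp x p')))).
  { unfold pf. apply (nus_tr _ _ _ LT (RP _)); [|intros d _; discriminate].
    apply tr_pl_t. apply (tr_vsub _ _ _ _ Ht). }
  eapply NB_tau in HNB as (Y & HY & HNB); eauto.
  apply pf_ws0 in HY as (fl2 & q2 & E & W & Hs); auto.
  exists q2. split; auto. split; eauto. exists fl, fl2. rewrite <- E. auto.
Qed.

(** A server must make its internal step before it listens on its trigger; the other side answers
    that step by a weak move. *)
Lemma M_unfold e x y i : wfe e -> wfs e x -> wfs e y -> PQ e x y -> i < len e -> sd e i = true ->
  exists q' fl fl', fl i = true /\ wfs e (setp y q') /\ ws (vsub (tH y) (tp y)) (vsub (tH y) q') /\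
    NB (pf e fl x) (pf e fl' (setp y q')).
Proof.
  intros WE WX WY (fl & fl' & HNB) Hi Hs. destruct (fl i) eqn:ctx_tl.
  - exists (tp y), fl, fl'. split; auto. split; [destruct y; auto|]. split; [apply ws_refl; reflexivity|].
    destruct y; auto.
  - destruct (srvs_unfold _ (mm e) _ _ (tA x) _ Hi Hs ctx_tl) as (k & X & Ht & E).
    pose proof (nus_tr (tds x) _ _ LT (RP _) (tr_pr_t _ (vsub (trs (mm e)) (tp x)) _ _ Ht)) as Ht'.
    eapply NB_tau in HNB as (Y & HY & HNB); [|apply Ht'; intros d _; discriminate].
    apply pf_ws0 in HY as (fl2 & q2 & E2 & W & HS); auto.
    exists q2, (upd fl i true), fl2. split; [apply upd_eq|]. split; auto. split; auto.
    rewrite <- E2. unfold pf. rewrite <- E. auto.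
Qed.

(** For the tested process, calling one of its own abstractions is a silent communication between
    [tp] and its server. *)
Lemma M_self e x y i C : wfe e -> wfs e x -> wfs e y -> PQ e x y -> call (tp x) i C -> i < len e -> sd e i = true ->
  exists q', wfs e (setp y q') /\ ws (vsub (tH y) (tp y)) (vsub (tH y) q') /\
    PQ e (setp x (cap C (aapF (tA x i)))) (setp y q').
Proof.
  intros WE WX WY HPQ Hc Hi Hs.
  destruct (M_unfold e x y i) as (q1 & fl & fl' & Hf & W1 & S1 & HNB); auto.
  destruct (srvs_serve _ (mm e) _ _ (tA x) _ Hi Hs Hf) as (k & F & Ht & E).
  destruct (call_tr _ _ _ Hc (trs (mm e)) (mm e i) eq_refl) as [n Ht2].
  pose proof (nus_tr (tds x) _ _ LT (RP _) (tr_cr _ _ _ _ _ _ _ Ht Ht2)) as Ht'.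
  eapply NB_tau in HNB as (Y & HY & HNB); [|apply Ht'; intros d _; discriminate].
  eapply pf_ws with (y := y) in HY as (fl2 & q2 & E2 & W & HS); eauto; [|reflexivity].
  exists q2. split; auto. split; [eapply ws_trans; eauto|]. exists (upd fl i false), fl2. rewrite <- E2.
  eapply NB_proper; [|reflexivity|exact HNB].
  unfold pf. simpl. apply nus_dsc. symmetry. rewrite (ceq_cap _ _ (ceq_refl _) _ _ E), cap_wkl, dsc_comm.
  apply Pr_dsc; [|reflexivity]. rewrite cvsub_cap. apply ceq_cap; [reflexivity|]. symmetry; apply aapF_vsub.
Qed.

Lemma ext_setp e y D N ds p q : setp (extS e y D N ds p) q = extS e y D N ds q.
Proof. reflexivity. Qed.

(** [q1] is reached before the answering input and [q'] after it. The object [N] is recorded in both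
    configurations, but the normal bisimulation is only shown a trigger. *)
Lemma M_in e x y n a F N : wfe e -> wfs e x -> wfs e y -> PQ e x y -> tr n (tp x) (LI (Some a)) (RI F) ->
  a mod 4 = 0 -> dwt (tD y) (GA (len e)) N TAbs -> (forall z, nf z N -> okn false z) ->
  exists m q1 k G q', let y' := extS e y (tD y) N (tds y) q' in
    wfe (extE e m false) /\ wfs e (setp y q1) /\ ws (vsub (tH y) (tp y)) (vsub (tH y) q1) /\
    tr k q1 (LI (Some a)) (RI G) /\ wfs (extE e m false) y' /\
    ws (vsub (tH y') (inst G (V (len e)))) (vsub (tH y') q') /\
    PQ (extE e m false) (extS e x (tD x) N (tds x) (inst F (V (len e)))) y'.
Proof.
  intros WE WX WY (fl & fl' & HNB) Ht Ha HN Hn.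
  destruct (NB_in _ _ HNB) as [b Hb]. destruct (choose_m e b WE) as (m & Hm & Hm3 & WE').
  pose proof (nus_tr (tds x) _ _ (LI (Some a)) (RI _) (tr_pl_i _ _ (srvs (len e) (mm e) (sd e) fl (tA x)) _ _
    (tr_vsub _ _ _ _ Ht (trs (mm e))))) as Ht'.
  assert (Hl : forall z, wfs e z -> lav (tds z) (LI (Some a))).
  { intros z Wz. eapply lav_0; eauto. simpl; intros c E; injection E as <-; auto. }
  destruct (Hb m _ a _ Hm (Ht' (Hl x WX))) as (Y1 & k & G0 & Y2 & S1 & T1 & S2 & HNB2).
  apply pf_ws0 in S1 as (fl1 & q1 & E1 & W1 & HS1); auto.
  eapply harmony_i in T1 as (k1 & G1 & T1 & EG); eauto.
  apply nus_tr_inv in T1 as (r0 & T1 & Er & _). destruct r0 as [|G2|]; try discriminate. injection Er as ->.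
  assert (HG : exists k G, tr k q1 (LI (Some a)) (RI G) /\
    G2 = Pr (vsub (up (trs (mm e))) G) (vren S (srvs (len e) (mm e) (sd e) fl1 (tA y)))).
  { simpl in T1. apply tr_Pr_i in T1 as [(G3 & T1 & ->)|(G3 & T1 & ->)].
    - eapply trs_inv in T1 as [(m' & r0 & Hq & Er)|(i & C & Hi & E & _)]; eauto; [| |apply (w_p _ _ W1)]; [|discriminate].
      destruct r0 as [|G|]; try discriminate. injection Er as ->. eauto.
    - exfalso. apply srvs_tr_inv in T1 as [(? & _)|(i & ? & ? & ? & ? & E & _)]; [discriminate|].
      injection E as ->. rewrite (proj1 WE) in Ha. discriminate. }
  destruct HG as (k2 & G & HG & ->).
  assert (WG : dwt (tD y) (tD y a :: GA (len e)) G TProc /\ forall z, nf z G -> okn true z)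
    by apply (pok_tr _ _ _ _ _ _ _ (w_p _ _ W1) HG).
  assert (Wext : wfs (extE e m false) (extS e y (tD y) N (tds y) (inst G (V (len e))))).
  { apply wfs_ext; auto.
    - apply (w_D _ _ WY).
    - split.
      + eapply dwt_inst; [|constructor; apply (GA_nth' (S (len e))); lia].
        rewrite (w_D _ _ WY) in WG by auto. rewrite GA_S. apply (dwt_app_ctx _ (TAbs :: GA (len e))). apply WG.
      + intros z Hz. apply nf_inst in Hz as [Hz|[]]. apply WG; auto.
    - apply (w_ds _ _ WY). }
  set (y0 := extS e y (tD y) N (tds y) (inst G (V (len e)))) in *.
  eapply pf_ws with (e := extE e m false) (y := y0) (fl := fl1) (q := inst G (V (len e))) in S2
    as (fl2 & q2 & E2 & W2 & HS2); eauto.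
  2: { rewrite EG. exact (in_form e fl1 y a G m N WY Hm3 (proj1 WG)). }
  exists m, q1, k2, G, q2. split; auto. split; auto. split; auto. split; auto. split; auto. split; auto.
  exists fl, fl2. unfold y0 in E2. rewrite ext_setp in E2. rewrite <- E2.
  eapply NB_proper; [|reflexivity|exact HNB2]. symmetry. apply in_form with (a := a); auto.
  apply (pok_tr _ _ _ _ _ _ _ (w_p _ _ WX) Ht).
Qed.

Lemma M_serve e x y i N : wfe e -> wfs e x -> wfs e y -> PQ e x y -> i < len e -> sd e i = true ->
  dwt (tD y) (GA (len e)) N TAbs -> (forall z, nf z N -> okn false z) ->
  exists m q', let y' := extS e y (tD y) N (tds y) q' in
    wfe (extE e m false) /\ wfs (extE e m false) y' /\
    ws (vsub (tH y') (Pr (tp y) (inst (aapF (tA y i)) (V (len e))))) (vsub (tH y') q') /\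
    PQ (extE e m false) (extS e x (tD x) N (tds x) (Pr (tp x) (inst (aapF (tA x i)) (V (len e))))) y'.
Proof.
  intros WE WX WY HPQ Hi Hs HN Hn.
  destruct (M_unfold e x y i) as (q0 & fl & fl' & Hf & W0 & S0 & HNB); auto.
  destruct (NB_in _ _ HNB) as [b Hb]. destruct (choose_m e b WE) as (m & Hm & Hm3 & WE').
  destruct (srvs_serve _ (mm e) _ _ (tA x) _ Hi Hs Hf) as (k & F & Ht & E).
  pose proof (nus_tr (tds x) _ _ (LI (Some (mm e i))) (RI _) (tr_pr_i _ (vsub (trs (mm e)) (tp x)) _ _ _ Ht)) as Ht'.
  assert (Hl : forall z, wfs e z -> lav (tds z) (LI (Some (mm e i)))).
  { intros z Wz. eapply lav_0; eauto. simpl; intros c Ec; injection Ec as <-. right. apply (proj1 WE). }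
  destruct (Hb m _ _ _ Hm (Ht' (Hl x WX))) as (Y1 & k1 & G0 & Y2 & S1 & T1 & S2 & HNB2).
  eapply pf_ws with (y := y) in S1 as (fl1 & q1 & E1 & W1 & HS1); eauto; [|reflexivity].
  eapply harmony_i in T1 as (k2 & G1 & T1 & EG); eauto.
  apply nus_tr_inv in T1 as (r0 & T1 & Er & _). destruct r0 as [|G2|]; try discriminate. injection Er as ->.
  simpl in T1.
  assert (HG : exists F1, G2 = Pr (vren S (vsub (trs (mm e)) q1)) F1 /\
    dsc F1 (Pr (vren S (srvs (len e) (mm e) (sd e) (upd fl1 i false) (tA y))) (Ap (vren S (vsub (trs (mm e)) (tA y i))) (V 0)))).
  { apply tr_Pr_i in T1 as [(G3 & T1 & ->)|(G3 & T1 & ->)].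
    - exfalso. eapply trs_inv in T1 as [(m' & r0 & Hq & Er)|(j & C & Hj & Ej & _)]; eauto; [| |apply (w_p _ _ W1)]; [|discriminate].
      pose proof (tr_lab_nf _ _ _ _ Hq _ eq_refl) as Hnf. apply (w_p _ _ W1), okn_3 in Hnf. apply Hnf, (proj1 WE).
    - apply srvs_tr_inv in T1 as [(? & _)|(j & F1 & Hj & ? & ? & Ej & Er & EF)]; [discriminate|].
      injection Ej as Ej. apply WE in Ej; auto. subst j. injection Er as ->. eauto. }
  destruct HG as (F1 & -> & EF).
  set (y0 := extS e y (tD y) N (tds y) (Pr q1 (inst (aapF (tA y i)) (V (len e))))) in *.
  assert (Wext : forall q, pok true (len e) (tD y) q ->
     wfs (extE e m false) (extS e y (tD y) N (tds y) (Pr q (inst (aapF (tA y i)) (V (len e)))))).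
  { intros q [Q1 Q2]. apply wfs_ext; auto.
    - apply (w_D _ _ WY).
    - split.
      + constructor; [apply dwt_GA; auto|]. eapply dwt_inst; [|constructor; apply (GA_nth' (S (len e))); lia].
        apply aapF_dwt. replace (S (len e)) with (i + (S (len e) - i)) by lia. rewrite repeat_app.
        apply dwt_app_ctx, (w_A _ _ WY); auto.
      + intros z [Hz|Hz]; auto. apply nf_inst in Hz as [Hz|[]]. apply aapF_nf in Hz.
        rewrite <- Hs. apply (w_n _ _ WY) with (i := i); auto.
    - apply (w_ds _ _ WY). }
  eapply pf_ws with (e := extE e m false) (y := y0) (fl := upd fl1 i false) in S2
    as (fl2 & q2 & E2 & W2 & HS2); eauto.
  2: { unfold y0. rewrite ext_setp. apply Wext. apply (w_p _ _ W1). }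
  2: { rewrite EG. exact (serve_form e fl1 (setp y q1) i m N F1 W1 Hm3 Hi EF). }
  exists m, q2. split; auto. split; auto. split.
  - eapply ws_trans; [|exact HS2]. simpl. apply ws_pl.
    rewrite !(GA_ext (tD y) (len e) _ TProc (upd _ _ _) (tH y)); try (intros; rewrite upd_lt; auto).
    + eapply ws_trans; eauto.
    + apply (w_p _ _ W1).
    + apply (w_p _ _ WY).
  - exists (upd fl i false), fl2. unfold y0 in E2. rewrite ext_setp in E2. rewrite <- E2.
    eapply NB_proper; [|reflexivity|exact HNB2]. symmetry. apply serve_form; auto.
Qed.

(** [q1] is the state before the answering output, [q3] the one right after it, and [q4] the one
    reached by the silent moves that follow. [D2] types the names [ks'] opened by the answer, and
    [b] lets the caller keep them away from its own names. *)
Lemma M_emit e x y a C ks N p' D1 b : wfe e -> wfs e x -> wfs e y -> PQ e x y -> emits e (tp x) a C ->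
  C = cnus ks (CB N p') -> (forall k, In k ks -> k mod 4 = 1) ->
  (forall k i, In k ks -> i < len e -> ~ nf k (tA x i)) ->
  dwt D1 (GA (len e)) N TAbs -> dwt D1 (GA (len e)) p' TProc ->
  exists m q1 ks' N' q3 q4 D2, let y' := extS e y D2 N' (tds y ++ ks') q4 in
    wfe (extE e m true) /\ wfs e (setp y q1) /\ ws (vsub (tH y) (tp y)) (vsub (tH y) q1) /\
    emits e q1 a (cnus ks' (CB N' q3)) /\ (forall k, In k ks' -> b <= k /\ k mod 4 = 1) /\
    (forall z, z mod 4 <> 1 -> D2 z = tD y z) /\
    pok true (len e) D2 q3 /\ pok true (len e) D2 q4 /\
    ws (vsub (tH y) q3) (vsub (tH y) q4) /\ wfs (extE e m true) y' /\
    PQ (extE e m true) (extS e x D1 N (tds x ++ ks) p') y'.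
Proof.
  intros WE WX WY (fl & fl' & HNB) He -> Hks HksA HN Hp'.
  destruct (pf_emit e fl x a _ WE WX He) as [n Ht].
  destruct (NB_out _ _ _ _ _ HNB Ht) as (Y1 & k & C1 & C4 & S1 & T1 & S4 & bb & HNB2).
  apply pf_ws0 in S1 as (fl1 & q1 & E1 & W1 & HS1); auto.
  eapply harmony_o in T1 as (k1 & C2 & T1 & EC); eauto.
  apply pf_emit_inv in T1 as (C3 & He3 & ->); auto; [|eapply emits_class; eauto].
  simpl in He3. destruct (emits_ok _ _ _ _ _ W1 He3) as [WC NC].
  destruct (tA_bound y (len e)) as [b1 Hb1].
  destruct (open_conc 1 ltac:(lia) _ _ _ _ _ (b + b1) eq_refl WC)
    as (ks' & N' & q3 & D2 & EC3 & Hks' & HD2 & WN & Wq & Hnf). subst C3.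
  assert (Hks1 : forall k, In k ks' -> k mod 4 = 1) by (intros z Hz; apply Hks' in Hz; tauto).
  assert (HksB : forall k i, In k ks' -> i < len e -> ~ nf k (tA y i)).
  { intros z i Hz Hi Hn. apply Hks' in Hz. apply Hb1 in Hn; auto. lia. }
  rewrite econc_open in EC; auto.
  destruct (proj1 (ceq_cws _ _ EC) _ S4) as (C5 & S5 & E5).
  apply cws_cnus_inv in S5 as (Y & SY & EY).
  destruct (choose_m e bb WE) as (m & Hm & Hm3 & WE').
  assert (HD : forall z, z mod 4 <> 1 -> D2 z = tD y z).
  { intros z Hz. apply HD2. intros Hi. apply Hks1 in Hi. auto. }
  assert (Hnf' : forall z, nf z N' \/ nf z q3 -> okn true z).
  { intros z Hz. apply Hnf in Hz as [Hz|Hz]; auto. right. apply Hks1; auto. }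
  assert (HDA : forall i z, i < len e -> nf z (tA y i) -> tD y z = D2 z).
  { intros i z Hi Hz. symmetry. apply HD2. intros Hk. eapply HksB; eauto. }
  (* With all extruded names left free, the silent moves after the output become moves of an
     ordinary configuration, to which [pf_ws] applies. *)
  set (y3 := Side D2 (tA y) (tH y) [] q3).
  assert (W3 : wfs e y3).
  { destruct WY as [wD wA wH wH0 wn wp wds]. split; simpl; auto.
    - intros z Hz. rewrite HD; [apply wD; auto|apply not_1; auto].
    - intros i Hi. eapply dwt_D; [apply wA; auto|]. eauto.
    - split; auto.
    - intros d []. }
  eapply pf_ws with (y := y3) (fl := fl1) (q := q3) in SY as (fl4 & q4 & E4 & W4 & HS4); eauto; [|reflexivity].
  exists m, q1, ks', N', q3, q4, D2. split; auto. split; auto. split; auto. split; auto.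
  split; [intros z Hz; apply Hks' in Hz; lia|]. split; auto. split; [split; auto|].
  split; [apply (w_p _ _ W4)|]. split; [exact HS4|]. split.
  - apply wfs_ext; auto.
    + intros z Hz. rewrite HD; [apply (w_D _ _ WY); auto|apply not_1; auto].
    + destruct (w_p _ _ W4) as [P1 P2]. simpl in P1, P2. split; auto. apply dwt_GA; auto.
    + intros d Hd. apply in_app_iff in Hd as [Hd|Hd]; auto. apply (w_ds _ _ WY); auto.
  - exists (upd fl (len e) false), (upd fl4 (len e) false).
    eapply NB_proper; [| |apply (HNB2 m Hm)]; symmetry.
    + rewrite econc_open by auto. apply emit_form; auto.
    + rewrite (ceq_cap _ _ E5 _ _ (reflexivity _)), (ceq_cap _ _ EY _ _ (reflexivity _)).
      rewrite <- (emit_form e fl4 y ks' N' q4 m D2); auto.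
      * apply ceq_cap; [|reflexivity]. apply cnus_ceq. constructor; [reflexivity|exact E4].
      * apply (w_p _ _ W4).
Qed.

#[local] Arguments Nat.modulo : simpl never.

(** * The context bisimulation *)

Definition rep x es s := nus (tds x) (nus es (vsub (tH x) (Pr (tp x) s))).

(** The shared part [s] is typed once per side, because the two configurations carry their own
    typings of names. Abstractions owned by the environment are literally equal, those owned by the
    processes may differ. *)
Record St e x y es s : Prop := {
  s_e : wfe e; s_x : wfs e x; s_y : wfs e y;
  s_sx : pok false (len e) (tD x) s; s_sy : pok false (len e) (tD y) s;
  s_es : forall d, In d es -> d mod 4 = 2;
  s_A : forall i, i < len e -> sd e i = false -> tA x i = tA y i;
  s_PQ : PQ e x y }.

Definition Rel U W := exists e x y es s, St e x y es s /\ dsc U (rep x es s) /\ dsc W (rep y es s).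

(** What [W] owes to a transition. The answer to an input may depend on the object received; the
    answer to an output is fixed before the receiving context. *)
Definition Ans l r W : Prop :=
  match l, r with
  | LT, RP T => exists W', ws W W' /\ Rel T W'
  | LI (Some a), RI F => forall A, dwt D0 [] A TAbs -> (forall z, nf z A -> z mod 4 = 0) ->
      exists W1 k G W', ws W W1 /\ tr k W1 (LI (Some a)) (RI G) /\ ws (inst G A) W' /\ Rel (inst F A) W'
  | LO a, RO C => exists W1 k C1 C4, ws W W1 /\ tr k W1 (LO a) (RO C1) /\ cws C1 C4 /\
      forall E, dwt D0 [TAbs] E TProc -> (forall z, nf z E -> z mod 4 = 0) -> Rel (cap C E) (cap C4 E)
  | _, _ => True
  end.

Lemma PQ_sym e x y : PQ e x y -> PQ e y x.
Proof. intros (fl & fl' & H). exists fl', fl. apply NB_sym; auto. Qed.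
Lemma Rel_sym U W : Rel U W -> Rel W U.
Proof.
  intros (e & x & y & es & s & [] & ? & ?). exists e, y, x, es, s. split; [|auto].
  split; auto; [|apply PQ_sym; auto]. intros; symmetry; auto.
Qed.
#[global] Instance Rel_proper : Proper (dsc ==> dsc ==> iff) Rel.
Proof.
  assert (K : forall p p' q q', dsc p p' -> dsc q q' -> Rel p q -> Rel p' q').
  { intros p p' q q' E E' (e & x & y & es & s & ? & ? & ?). exists e, x, y, es, s.
    rewrite <- E, <- E'. tauto. }
  intros p p' E q q' E'. split; apply K; auto; symmetry; auto.
Qed.
Lemma Ans_req l r r' W : req r r' -> Ans l r W -> Ans l r' W.
Proof.
  destruct l as [|[a|]|a], r, r'; simpl; try tauto.
  - intros E (W' & ? & ?). exists W'. rewrite <- E. auto.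
  - intros E H A HA HA'. destruct (H A HA HA') as (W1 & k & G & W' & ? & ? & ? & ?).
    exists W1, k, G, W'. rewrite <- E. auto.
  - intros E (W1 & k & C1 & C4 & ? & ? & ? & H). exists W1, k, C1, C4. repeat split; auto.
    intros E0 K1 K2. rewrite <- (ceq_cap _ _ E _ _ (reflexivity E0)). auto.
Qed.
Lemma Ans_ws l r W W' : ws W W' -> Ans l r W' -> Ans l r W.
Proof.
  destruct l as [|[a|]|a], r; simpl; try tauto; intros S.
  - intros (W2 & ? & ?). exists W2. split; auto. eapply ws_trans; eauto.
  - intros H A HA HA'. destruct (H A HA HA') as (W1 & k & G & W2 & ? & ? & ? & ?).
    exists W1, k, G, W2. repeat split; auto. eapply ws_trans; eauto.
  - intros (W1 & k & C1 & C4 & ? & ? & ? & H). exists W1, k, C1, C4. repeat split; auto. eapply ws_trans; eauto.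
Qed.

(** This is why storing an object under a new index instead of substituting it leaves the real
    system unchanged. *)
Lemma H_upd D n N H F s t : dwt D (t :: GA n) F s ->
  vsub (upd H n (vsub H N)) (inst F (V n)) = vsub H (inst F N).
Proof.
  intros W. rewrite !vsub_inst. simpl. rewrite upd_eq.
  rewrite (GA_ext_up _ _ _ _ _ _ H W); auto. intros. apply upd_lt; auto.
Qed.
Lemma H_old D n v (H : nat -> dtm) T s : dwt D (GA n) T s -> vsub (upd H n v) T = vsub H T.
Proof. intros W. eapply GA_ext; eauto. intros; apply upd_lt; auto. Qed.

Lemma pok_D b n D D' s : pok b n D s -> (forall z, nf z s -> D' z = D z) -> pok b n D' s.
Proof. intros [H1 H2] HD. split; auto. eapply dwt_D; eauto. intros; symmetry; auto. Qed.
Lemma pok_S b n D s : pok b n D s -> pok b (S n) D s.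
Proof. intros [H1 H2]. split; auto. apply dwt_GA; auto. Qed.
Lemma pok_Pr b n D s t : pok b n D s -> pok b n D t -> pok b n D (Pr s t).
Proof. intros [H1 H2] [H3 H4]. split; [constructor; auto|]. intros x [?|?]; auto. Qed.
Lemma pok_instV b n D F : dwt D (TAbs :: GA n) F TProc -> (forall z, nf z F -> okn b z) ->
  pok b (S n) D (inst F (V n)).
Proof.
  intros H1 H2. split.
  - eapply dwt_inst; [|constructor; apply (GA_nth' (S n)); lia].
    rewrite GA_S. apply (dwt_app_ctx _ (TAbs :: GA n)). auto.
  - intros z Hz. apply nf_inst in Hz as [?|[]]; auto.
Qed.
Lemma pok_inst b n D F N : dwt D (TAbs :: GA n) F TProc -> (forall z, nf z F -> okn b z) ->
  dwt D (GA n) N TAbs -> (forall z, nf z N -> okn b z) -> pok b n D (inst F N).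
Proof.
  intros. split; [eapply dwt_inst; eauto|]. intros z Hz. apply nf_inst in Hz as [?|?]; auto.
Qed.

Lemma St_s e x y es s s' : St e x y es s -> pok false (len e) (tD x) s' -> pok false (len e) (tD y) s' ->
  St e x y es s'.
Proof. intros []; split; auto. Qed.
Lemma rep_ws0 y q' es s : ws (vsub (tH y) (tp y)) (vsub (tH y) q') -> ws (rep y es s) (rep (setp y q') es s).
Proof. intros H. unfold rep. simpl. apply ws_nus, ws_nus, ws_pl. auto. Qed.

Definition setD x D := Side D (tA x) (tH x) (tds x) (tp x).
Lemma cwt_nren_inv C : forall D D' G t f, cwt D' G t (cnren f C) -> (forall x, D x = D' (f x)) -> cwt D G t C.
Proof.
  induction C; simpl; intros D D' G t f H Hf.
  - destruct H; split; eapply dwt_nren_inv; eauto.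
  - destruct H as [s H]. exists s. eapply IHC; eauto. intros [|x]; simpl; auto.
Qed.
Lemma cwt_cnus_inv ks A T : forall D G t, cwt D G t (cnus ks (CB A T)) ->
  exists D', (forall x, ~ In x ks -> D' x = D x) /\ dwt D' G A t /\ dwt D' G T TProc.
Proof.
  induction ks as [|k ks IH]; simpl; intros D G t H.
  - exists D. tauto.
  - destruct H as [s H]. apply cwt_nren_inv with (D := upd D k s) in H.
    + apply IH in H as (D' & HD & ? & ?). exists D'. repeat split; auto.
      intros x Hx. rewrite HD by tauto. apply upd_neq. intros ->; tauto.
    + intros x. unfold clo, upd. destruct (x =? k); auto.
Qed.

Lemma wfs_setD e x D ks : wfs e x -> (forall z, ~ In z ks -> D z = tD x z) ->
  (forall k, In k ks -> k mod 4 = 2) -> (forall k i, In k ks -> i < len e -> ~ nf k (tA x i)) -> wfs e (setD x D).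
Proof.
  intros W HD Hk HA. assert (K : forall z, z mod 4 <> 2 -> D z = tD x z).
  { intros z Hz. apply HD. intros Hi; apply Hk in Hi; auto. }
  destruct W as [wD wA wH wH0 wn wp wds]. split; simpl; auto.
  - intros z Hz. rewrite K; auto. destruct Hz as [-> | ->]; discriminate.
  - intros i Hi. eapply dwt_D; [apply wA; auto|]. intros z Hz. symmetry. apply HD. intros Hk'. eapply HA; eauto.
  - eapply pok_D; eauto. intros z Hz. apply K. apply wp in Hz as [-> | ->]; discriminate.
Qed.

(** The environment is shared, so its concretion is opened once, with the same names on both sides.
    The bound keeps these names away from the stored abstractions of both, while each typing is
    extended separately. *)
Lemma St_open e x y es s C : St e x y es s -> cwt (tD x) (GA (len e)) TAbs C -> cwt (tD y) (GA (len e)) TAbs C ->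
  (forall z, cnf z C -> nf z s) -> exists ks N s' D1 D2,
    C = cnus ks (CB N s') /\ (forall k, In k ks -> k mod 4 = 2) /\
    (forall k i, In k ks -> ~ nf k (tH x i)) /\ (forall k i, In k ks -> ~ nf k (tH y i)) /\
    St e (setD x D1) (setD y D2) (es ++ ks) s /\ pok false (len e) D1 s' /\ pok false (len e) D2 s' /\
    dwt D1 (GA (len e)) N TAbs /\ dwt D2 (GA (len e)) N TAbs /\ (forall z, nf z N -> okn false z).
Proof.
  intros SS WC1 WC2 NC.
  destruct (tH_bound _ _ (s_x _ _ _ _ _ SS)) as [b1 B1]. destruct (tH_bound _ _ (s_y _ _ _ _ _ SS)) as [b2 B2].
  destruct (tA_bound x (len e)) as [b3 B3]. destruct (tA_bound y (len e)) as [b4 B4]. destruct (nf_bound s) as [b5 B5].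
  destruct (open_conc 2 ltac:(lia) _ _ _ _ _ (b1 + b2 + b3 + b4 + b5) eq_refl WC1)
    as (ks & N & s' & D1 & EC & Hks & HD1 & WN & Ws & Hnf).
  rewrite EC in WC2. apply cwt_cnus_inv in WC2 as (D2 & HD2 & WN2 & Ws2).
  assert (Hk2 : forall k, In k ks -> k mod 4 = 2) by (intros k Hk; apply Hks in Hk; tauto).
  assert (Hks5 : forall k, In k ks -> ~ nf k s) by (intros k Hk Hn; apply Hks in Hk; apply B5 in Hn; lia).
  assert (Nm : forall z, nf z N \/ nf z s' -> okn false z).
  { intros z Hz. apply Hnf in Hz as [Hz|Hz]; [|right; auto]. apply (s_sx _ _ _ _ _ SS). auto. }
  exists ks, N, s', D1, D2. split; auto. split; auto.
  split; [intros k i Hk Hn; apply Hks in Hk; apply B1 in Hn; lia|].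
  split; [intros k i Hk Hn; apply Hks in Hk; apply B2 in Hn; lia|]. split.
  - destruct SS. split; auto.
    + eapply wfs_setD; eauto. intros k i Hk Hi Hn; apply Hks in Hk; apply B3 in Hn; auto; lia.
    + eapply wfs_setD; eauto. intros k i Hk Hi Hn; apply Hks in Hk; apply B4 in Hn; auto; lia.
    + apply pok_D with (D := tD x); auto. simpl. intros z Hz. apply HD1. intros Hk. eapply Hks5; eauto.
    + apply pok_D with (D := tD y); auto. simpl. intros z Hz. apply HD2. intros Hk. eapply Hks5; eauto.
    + intros d Hd. apply in_app_iff in Hd as [?|?]; auto.
  - split; [split; auto|]. split; [split; auto|]. auto.
Qed.

(* The process emits [N]: the environment only receives the fresh variable [len e]. *)
Lemma St_emit e x y es s a C : St e x y es s -> emits e (tp x) a C -> exists ks N p' D1 m q1 ks' N' q3 q4 D2,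
    let x' := extS e x D1 N (tds x ++ ks) p' in let y' := extS e y D2 N' (tds y ++ ks') q4 in
    C = cnus ks (CB N p') /\ (forall k, In k ks -> k mod 4 = 1) /\ (forall k, In k ks' -> k mod 4 = 1) /\
    (forall k i, In k ks -> ~ nf k (tH x i)) /\ (forall k i, In k ks' -> ~ nf k (tH y i)) /\
    wfs e (setp y q1) /\ ws (vsub (tH y) (tp y)) (vsub (tH y) q1) /\ emits e q1 a (cnus ks' (CB N' q3)) /\
    dwt D1 (GA (len e)) N TAbs /\ dwt D1 (GA (len e)) p' TProc /\ dwt D2 (GA (len e)) N' TAbs /\
    dwt D2 (GA (len e)) q3 TProc /\
    ws (vsub (tH y) q3) (vsub (tH y) q4) /\ dwt D2 (GA (len e)) q4 TProc /\
    (forall s', pok false (S (len e)) (tD x) s' -> pok false (S (len e)) (tD y) s' -> St (extE e m true) x' y' es s').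
Proof.
  intros SS He. destruct (tH_bound _ _ (s_x _ _ _ _ _ SS)) as [b1 B1]. destruct (tH_bound _ _ (s_y _ _ _ _ _ SS)) as [b2 B2].
  destruct (tA_bound x (len e)) as [b3 B3].
  assert (WX0 : wfs e (setp x (tp x))) by (destruct x; apply SS).
  destruct (emits_ok e x (tp x) a C WX0 He) as [WC NC].
  destruct (open_conc 1 ltac:(lia) _ _ _ _ _ (b1 + b3) eq_refl WC)
    as (ks & N & p' & D1 & EC & Hks & HD1 & WN & Wp & Hnf).
  assert (Hk1 : forall k, In k ks -> k mod 4 = 1) by (intros k Hk; apply Hks in Hk; tauto).
  assert (HkA : forall k i, In k ks -> i < len e -> ~ nf k (tA x i)).
  { intros k i Hk Hi Hn; apply Hks in Hk; apply B3 in Hn; auto; lia. }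
  assert (Nm : forall z, nf z N \/ nf z p' -> okn true z).
  { intros z Hz. apply Hnf in Hz as [Hz|Hz]; [|right; auto]. auto. }
  destruct SS as [WE WX WY SX SY SE SA SPQ].
  destruct (M_emit e x y a C ks N p' D1 b2 WE WX WY SPQ He EC Hk1 HkA WN Wp)
    as (m & q1 & ks' & N' & q3 & q4 & D2 & WE' & W1 & S1 & He1 & Hks' & HD2 & [Q3 Q3'] & [Q4 Q4'] & S3 & WY' & HPQ).
  assert (HN' : dwt D2 (GA (len e)) N' TAbs).
  { pose proof (w_A _ _ WY' (len e)) as K1. simpl in K1. rewrite upd_eq in K1. apply K1; lia. }
  assert (HD1' : forall z, z mod 4 <> 1 -> D1 z = tD x z).
  { intros z Hz. apply HD1. intros Hi; apply Hk1 in Hi; auto. }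
  exists ks, N, p', D1, m, q1, ks', N', q3, q4, D2. repeat (split; [solve [auto]|]).
  split; [intros k Hk; apply Hks' in Hk; tauto|].
  split; [intros k i Hk Hn; apply Hks in Hk; apply B1 in Hn; lia|].
  split; [intros k i Hk Hn; apply Hks' in Hk; apply B2 in Hn; lia|].
  repeat (split; [solve [auto]|]). intros s' P1 P2. split; auto.
  - apply wfs_ext; auto.
    + intros z Hz. rewrite HD1'; [apply (w_D _ _ WX); auto|apply not_1; auto].
    + intros i z Hi Hz. symmetry. apply HD1. intros Hk. eapply HkA; eauto.
    + split; auto. apply dwt_GA; auto.
    + intros d Hd. apply in_app_iff in Hd as [Hd|Hd]; auto. apply (w_ds _ _ WX); auto.
  - apply pok_D with (D := tD x); auto. intros z Hz. apply HD1'. apply P1 in Hz as [-> | ->]; discriminate.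
  - apply pok_D with (D := tD y); auto. intros z Hz. apply HD2. apply P1 in Hz as [-> | ->]; discriminate.
  - simpl. intros i Hi. destruct (Nat.eq_dec i (len e)) as [->|]; upds; [discriminate|]. intros. apply SA; auto. lia.
Qed.

Lemma comm_eq D D' H n ks N T F : (forall k, In k ks -> ~ nf k F) -> (forall k i, In k ks -> ~ nf k (H i)) ->
  dwt D (TAbs :: GA n) F TProc -> dwt D' (GA n) T TProc ->
  vsub H (cap (cnus ks (CB N T)) F) = nus ks (vsub (upd H n (vsub H N)) (Pr (inst F (V n)) T)).
Proof.
  intros HF HH WF WT. rewrite cap_cnus, vsub_nus by auto. simpl.
  rewrite (H_upd _ _ _ _ _ _ _ WF), (H_old _ _ _ _ _ _ WT). reflexivity.
Qed.

(** Private names of one part cannot occur in the other, so restrictions opened for one part commute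
    with the other. *)
Lemma disj_12 F b k : (forall z, nf z F -> okn b z) -> k mod 4 = (if b then 2 else 1) -> ~ nf k F.
Proof. intros H E Hn. apply H in Hn as [Hn|Hn]; rewrite Hn in E; destruct b; discriminate. Qed.

Lemma St_setp e x y es s p q : St e x y es s -> wfs e (setp x p) -> wfs e (setp y q) ->
  PQ e (setp x p) (setp y q) -> St e (setp x p) (setp y q) es s.
Proof. intros [] W1 W2 HPQ. split; auto. Qed.

Lemma St_answers_tau e x y es s m X : St e x y es s -> tr m (Pr (tp x) s) LT (RP X) ->
  Ans LT (RP (nus (tds x) (nus es (vsub (tH x) X)))) (rep y es s).
Proof.
  intros SS Ht. pose proof SS as [WE WX WY SX SY SE SA SPQ]. pose proof (w_p _ _ WX) as WP.
  apply tr_Pr_t in Ht as [(p' & Ht & ->)|[(s' & Ht & ->)|[(k & j & a & F & C & Hi & Ho & ->)|(k & j & a & F & C & Hi & Ho & ->)]]].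
  - destruct (M_tau _ _ _ _ _ WE WY SPQ Ht) as (q' & W' & Sw & HPQ).
    exists (rep (setp y q') es s). split; [apply rep_ws0; auto|].
    exists e, (setp x p'), (setp y q'), es, s. split; [|split; reflexivity].
    apply St_setp; auto. apply wfs_setp; auto. apply (pok_tr _ _ _ _ _ _ _ WP Ht).
  - exists (rep y es s'). split.
    + apply ws_nus, ws_nus. eapply ws_step; [|apply ws_refl; reflexivity].
      apply tr_pr_t. apply (tr_vsub _ _ _ _ Ht).
    + exists e, x, y, es, s'. split; [|split; reflexivity].
      apply (St_s _ _ _ _ s); auto; [apply (pok_tr _ _ _ _ _ _ _ SX Ht)|apply (pok_tr _ _ _ _ _ _ _ SY Ht)].
  (* The environment sends to the process. Both parts know the subject, so its class is 0; the
     object becomes a variable of the environment. *)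
  - assert (Ha : a mod 4 = 0).
    { apply okn_0; [apply WP, (tr_lab_nf _ _ _ _ Hi); auto|apply SX, (tr_lab_nf _ _ _ _ Ho); auto]. }
    destruct (pok_tr _ _ _ _ _ _ _ SX Ho) as [WC1 NC1]. destruct (pok_tr _ _ _ _ _ _ _ SY Ho) as [WC2 _].
    rewrite (w_D _ _ WX) in WC1 by auto. rewrite (w_D _ _ WY) in WC2 by auto.
    destruct (St_open _ _ _ _ _ _ SS WC1 WC2 (tr_nf _ _ _ _ Ho))
      as (ks & N & s' & D1 & D2 & -> & Hks & HkX & HkY & SS1 & Ps1 & Ps2 & WN1 & WN2 & NN).
    destruct SS1 as [_ WX1 WY1 SX1 SY1 SE1 SA1 SPQ1].
    destruct (M_in e (setD x D1) (setD y D2) k a F N WE WX1 WY1 SPQ1 Hi Ha WN2 NN)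
      as (m' & q1 & k1 & G & q' & WE' & W1 & S1 & HG & WY' & S2 & HPQ). simpl in S1, S2.
    destruct (pok_tr _ _ _ _ _ _ _ (w_p _ _ WX1) Hi) as [WF NF]. simpl in WF. rewrite (w_D _ _ WX1) in WF by auto.
    destruct (pok_tr _ _ _ _ _ _ _ (w_p _ _ W1) HG) as [WG NG]. simpl in WG. rewrite (w_D _ _ WY1) in WG by auto.
    set (x' := extS e (setD x D1) D1 N (tds x) (inst F (V (len e)))) in *.
    set (y' := extS e (setD y D2) D2 N (tds y) q') in *.
    assert (Ks1 : forall k, In k ks -> ~ nf k F) by (intros z Hz; apply (disj_12 F true); auto).
    assert (Ks2 : forall k, In k ks -> ~ nf k G) by (intros z Hz; apply (disj_12 G true); auto).
    exists (rep y' (es ++ ks) s'). split.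
    + eapply ws_trans; [apply rep_ws0; exact S1|]. unfold rep. simpl. apply ws_nus. rewrite nus_app. apply ws_nus.
      eapply ws_step; [eapply tr_cl; [apply (tr_vsub _ _ _ _ HG)|apply (tr_vsub _ _ _ _ Ho)]|].
      rewrite <- cvsub_cap. rewrite (comm_eq D2 D2 (tH y) (len e)) by (auto; apply Ps2).
      apply ws_nus, ws_pl. exact S2.
    + exists (extE e m' false), x', y', (es ++ ks), s'. split; [|split; [|reflexivity]].
      * split; auto.
        -- apply wfs_ext; auto; [apply (w_D _ _ WX1)|apply pok_instV; auto|apply (w_ds _ _ WX1)].
        -- simpl. apply pok_S; auto.
        -- simpl. apply pok_S; auto.
        -- simpl. intros i Hl. destruct (Nat.eq_dec i (len e)) as [->|]; upds; auto. intros. apply SA; auto. lia.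
      * unfold rep. simpl. rewrite nus_app. rewrite (comm_eq D1 D1 (tH x) (len e)) by (auto; apply Ps1). reflexivity.
  (* The process sends to the environment, which continues with the new variable in place of the
     object. *)
  - assert (Ha : a mod 4 = 0).
    { apply okn_0; [apply WP, (tr_lab_nf _ _ _ _ Ho); auto|apply SX, (tr_lab_nf _ _ _ _ Hi); auto]. }
    assert (He : emits e (tp x) a C) by (left; eauto).
    destruct (St_emit _ _ _ _ _ _ _ SS He) as (ks & N & p' & D1 & m' & q1 & ks' & N' & q3 & q4 & D2 &
       -> & Hks & Hks' & HkX & HkY & W1 & S1 & He1 & WN & Wp & WN' & Wq3 & S3 & Wq4 & HSt).
    destruct (pok_tr _ _ _ _ _ _ _ SX Hi) as [WF NF]. rewrite (w_D _ _ WX) in WF by auto.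
    destruct (pok_tr _ _ _ _ _ _ _ SY Hi) as [WF2 _]. rewrite (w_D _ _ WY) in WF2 by auto.
    (* The answer is a genuine output: a call would happen on a trigger, of class 3. *)
    destruct He1 as [[_ [k1 Ho1]]|(i & _ & E & _)]; [|subst a; rewrite (proj1 WE) in Ha; discriminate].
    set (x' := extS e x D1 N (tds x ++ ks) p') in *. set (y' := extS e y D2 N' (tds y ++ ks') q4) in *.
    assert (Ks1 : forall k, In k ks -> ~ nf k F) by (intros z Hz; apply (disj_12 F false); auto).
    assert (Ks2 : forall k, In k ks' -> ~ nf k F) by (intros z Hz; apply (disj_12 F false); auto).
    exists (rep y' es (inst F (V (len e)))). split.
    + eapply ws_trans; [apply rep_ws0; exact S1|]. unfold rep. simpl. rewrite nus_app. apply ws_nus.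
      rewrite nus_nus. apply ws_nus.
      eapply ws_step; [eapply tr_cr; [apply (tr_vsub _ _ _ _ Hi)|apply (tr_vsub _ _ _ _ Ho1)]|].
      rewrite <- cvsub_cap. rewrite (comm_eq (tD y) D2 (tH y) (len e)) by auto.
      apply ws_nus. simpl. rewrite dsc_comm. apply ws_pl.
      rewrite (H_old _ _ _ _ _ _ Wq3), (H_old _ _ _ _ _ _ Wq4). auto.
    + exists (extE e m' true), x', y', es, (inst F (V (len e))). split; [|split; [|reflexivity]].
      * apply HSt; apply pok_instV; auto.
      * unfold rep. simpl. rewrite nus_app. apply nus_dsc. rewrite (nus_nus ks es). apply nus_dsc.
        rewrite (comm_eq (tD x) D1 (tH x) (len e)) by auto. apply nus_dsc. apply dsc_comm.
Qed.

Ltac ds0 NE := let d := fresh "d" in let Hd := fresh "Hd" in let Hn := fresh "Hn" in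
  intros d Hd Hn; apply NE in Hn;
  first [ match goal with K : wfs _ _ |- _ => rewrite (w_ds _ _ K _ Hd) in Hn; discriminate end
        | match goal with K : forall d, In d _ -> d mod 4 = _ |- _ => rewrite (K _ Hd) in Hn; discriminate end ].

(** An outside object received by the process becomes a variable of the environment; one received by
    the environment is simply substituted in the shared part. *)
Lemma St_answers_in e x y es s m a F0 : St e x y es s -> tr m (Pr (tp x) s) (LI (Some a)) (RI F0) -> a mod 4 = 0 ->
  Ans (LI (Some a)) (RI (nus (tds x) (nus es (vsub (up (tH x)) F0)))) (rep y es s).
Proof.
  intros SS Ht Ha A WA NA. pose proof SS as [WE WX WY SX SY SE SA SPQ]. pose proof (w_p _ _ WX) as WP.
  assert (WAD : forall z n, wfs e z -> dwt (tD z) (GA n) A TAbs).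
  { intros z n Wz. apply (dwt_app_ctx _ [] (GA n)). eapply dwt_D; eauto. intros b Hb. symmetry.
    apply (w_D _ _ Wz). left; auto. }
  assert (NA2 : forall b z, nf z A -> okn b z) by (left; auto).
  assert (I1 : forall z T, wfs e z -> inst (nus (tds z) (nus es T)) A = nus (tds z) (nus es (inst T A))).
  { intros z T Wz. rewrite !inst_nus; [auto|ds0 NA|ds0 NA]. }
  assert (I2 : forall H F, inst (vsub (up H) F) A = vsub H (inst F A)).
  { intros H F. rewrite vsub_inst. f_equal. symmetry; eapply dwt_closed; eauto. }
  assert (Hl : forall z, wfs e z -> lav (tds z) (LI (Some a)) /\ lav es (LI (Some a))).
  { intros z Wz. split; intros d Hd E; injection E as ->; [apply (w_ds _ _ Wz) in Hd|apply SE in Hd]; rewrite Hd in Ha; discriminate. }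
  apply tr_Pr_i in Ht as [(F & Ht & ->)|(F & Ht & ->)].
  - destruct (M_in e x y m a F A WE WX WY SPQ Ht Ha) as (m' & q1 & k1 & G & q' & WE' & W1 & S1 & HG & WY' & S2 & HPQ); auto.
    simpl in S1, S2.
    destruct (pok_tr _ _ _ _ _ _ _ WP Ht) as [WF NF]. rewrite (w_D _ _ WX) in WF by auto.
    destruct (pok_tr _ _ _ _ _ _ _ (w_p _ _ W1) HG) as [WG NG]. simpl in WG. rewrite (w_D _ _ WY) in WG by auto.
    set (x' := extS e x (tD x) A (tds x) (inst F (V (len e)))) in *.
    set (y' := extS e y (tD y) A (tds y) q') in *.
    pose proof (nus_tr (tds y) _ _ (LI (Some a)) (RI _) (nus_tr es _ _ (LI (Some a)) (RI _)
      (tr_vsub _ _ _ _ (tr_pl_i _ _ s _ _ HG) (tH y)) (proj2 (Hl y WY))) (proj1 (Hl y WY))) as Htr.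
    exists (rep (setp y q1) es s), k1. eexists. exists (rep y' es s). split; [apply rep_ws0; auto|].
    split; [exact Htr|]. split.
    + rewrite I1, I2, inst_Pr, inst_wk by auto. unfold rep. simpl. apply ws_nus, ws_nus.
      rewrite <- (H_upd _ _ _ _ _ _ _ WG). rewrite <- (H_old _ _ (vsub (tH y) A) (tH y) _ _ (proj1 SY)).
      apply ws_pl. auto.
    + exists (extE e m' false), x', y', es, s. split; [|split; [|reflexivity]].
      * split; auto.
        -- apply wfs_ext; auto; [apply (w_D _ _ WX)|apply pok_instV; auto|apply (w_ds _ _ WX)].
        -- simpl. apply pok_S; auto.
        -- simpl. apply pok_S; auto.
        -- simpl. intros i Hi. destruct (Nat.eq_dec i (len e)) as [->|]; upds; auto. intros. apply SA; auto. lia.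
      * rewrite I1, I2, inst_Pr, inst_wk by auto. unfold rep. simpl.
        rewrite <- (H_upd _ _ _ _ _ _ _ WF). rewrite <- (H_old _ _ (vsub (tH x) A) (tH x) _ _ (proj1 SX)). reflexivity.
  - pose proof (nus_tr (tds y) _ _ (LI (Some a)) (RI _) (nus_tr es _ _ (LI (Some a)) (RI _)
      (tr_vsub _ _ _ _ (tr_pr_i _ (tp y) _ _ _ Ht) (tH y)) (proj2 (Hl y WY))) (proj1 (Hl y WY))) as Htr.
    destruct (pok_tr _ _ _ _ _ _ _ SX Ht) as [WF NF]. rewrite (w_D _ _ WX) in WF by auto.
    destruct (pok_tr _ _ _ _ _ _ _ SY Ht) as [WF2 _]. rewrite (w_D _ _ WY) in WF2 by auto.
    exists (rep y es s), m. eexists. exists (rep y es (inst F A)). split; [apply ws_refl; reflexivity|].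
    split; [exact Htr|]. split.
    + rewrite I1, I2, inst_Pr, inst_wk by auto. apply ws_refl. reflexivity.
    + exists e, x, y, es, (inst F A). split; [|split; [|reflexivity]].
      * apply (St_s _ _ _ _ s); auto; apply pok_inst; auto.
      * rewrite I1, I2, inst_Pr, inst_wk by auto. reflexivity.
Qed.

Lemma cws_cnus ks C C' : cws C C' -> cws (cnus ks C) (cnus ks C').
Proof. intros H. induction ks; simpl; auto. constructor. apply cws_nren; auto. Qed.
Lemma nf_vsub_H T H k : (forall i, ~ nf k (H i)) -> ~ nf k T -> ~ nf k (vsub H T).
Proof. intros HH HT Hn. apply nf_vsub in Hn as [?|[i ?]]; auto. eapply HH; eauto. Qed.

(** The outer context joins the shared part, instantiated with the new variable if the process has
    emitted and with the object itself if the environment has. *)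
Lemma St_answers_out e x y es s m a C0 : St e x y es s -> tr m (Pr (tp x) s) (LO a) (RO C0) -> a mod 4 = 0 ->
  Ans (LO a) (RO (cnus (tds x) (cnus es (cvsub (tH x) C0)))) (rep y es s).
Proof.
  intros SS Ht Ha. pose proof SS as [WE WX WY SX SY SE SA SPQ]. pose proof (w_p _ _ WX) as WP.
  assert (Hl : forall z, wfs e z -> lav (tds z) (LO a) /\ lav es (LO a)).
  { intros z Wz. split; intros d Hd E; injection E as ->; [apply (w_ds _ _ Wz) in Hd|apply SE in Hd]; rewrite Hd in Ha; discriminate. }
  assert (EE : forall E H, dwt D0 [TAbs] E TProc -> vsub (up H) E = E).
  { intros E H WEE. rewrite <- (vsub_V E) at 2. eapply dwt_vsub_ext; eauto. intros [|x0] Hx; simpl in *; auto; lia. }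
  assert (ED : forall z E n, wfs e z -> dwt D0 [TAbs] E TProc -> (forall a, nf a E -> a mod 4 = 0) ->
     dwt (tD z) (TAbs :: GA n) E TProc).
  { intros z E n Wz WEE NE. apply (dwt_app_ctx _ [TAbs] (GA n)). eapply dwt_D; eauto. intros b Hb. symmetry.
    apply (w_D _ _ Wz). left; auto. }
  apply tr_Pr_o in Ht as [(C & Ht & ->)|(C & Ht & ->)].
  - assert (He : emits e (tp x) a C) by (left; eauto).
    destruct (St_emit _ _ _ _ _ _ _ SS He) as (ks & N & p' & D1 & m' & q1 & ks' & N' & q3 & q4 & D2 &
       -> & Hks & Hks' & HkX & HkY & W1 & S1 & He1 & WN & Wp & WN' & Wq3 & S3 & Wq4 & HSt).
    destruct He1 as [[_ [k1 Ho1]]|(i & _ & E & _)]; [|subst a; rewrite (proj1 WE) in Ha; discriminate].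
    set (x' := extS e x D1 N (tds x ++ ks) p') in *. set (y' := extS e y D2 N' (tds y ++ ks') q4) in *.
    pose proof (nus_tr (tds y) _ _ (LO a) (RO _) (nus_tr es _ _ (LO a) (RO _)
      (tr_vsub _ _ _ _ (tr_pl_o _ _ s _ _ Ho1) (tH y)) (proj2 (Hl y WY))) (proj1 (Hl y WY))) as Htr.
    assert (Fs : forall H kk, (forall k i, In k kk -> ~ nf k (H i)) -> (forall k, In k kk -> k mod 4 = 1) ->
       forall k, In k kk -> ~ nf k (vsub H s)).
    { intros H kk HH Hk k Hi. apply nf_vsub_H; auto. apply (disj_12 s false); [apply SX|auto]. }
    simpl in Htr. rewrite cvsub_cpl, cvsub_cnus, cpl_cnus in Htr by eauto.
    exists (rep (setp y q1) es s), k1. eexists.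
    exists (cnus (tds y) (cnus es (cnus ks' (CB (vsub (tH y) N') (Pr (vsub (tH y) q4) (vsub (tH y) s)))))).
    split; [apply rep_ws0; auto|]. split; [exact Htr|]. split.
    + apply cws_cnus, cws_cnus, cws_cnus. constructor. apply ws_pl; auto.
    + intros E WEE NE. exists (extE e m' true), x', y', es, (Pr (inst E (V (len e))) s). split; [|split].
      * apply HSt; (apply pok_Pr; [apply pok_instV; auto; left; auto|apply pok_S; auto]).
      * rewrite cvsub_cpl, cvsub_cnus, cpl_cnus by eauto.
        rewrite !cap_cnus by ds0 NE.
        unfold rep. simpl. rewrite nus_app. apply nus_dsc. rewrite (nus_nus ks es). apply nus_dsc, nus_dsc.
        rewrite vsub_inst, EE by auto. simpl. upds. rewrite (H_old _ _ _ _ _ _ Wp), (H_old _ _ _ _ _ _ (proj1 SX)).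
        rewrite !dsc_assoc. rewrite (dsc_comm (inst _ _) (vsub _ p')). reflexivity.
      * rewrite !cap_cnus by ds0 NE.
        unfold rep. simpl. rewrite nus_app. apply nus_dsc. rewrite (nus_nus ks' es). apply nus_dsc, nus_dsc.
        rewrite vsub_inst, EE by auto. simpl. upds. rewrite (H_old _ _ _ _ _ _ Wq4), (H_old _ _ _ _ _ _ (proj1 SY)).
        rewrite !dsc_assoc. rewrite (dsc_comm (inst _ _) (vsub _ q4)). reflexivity.
  - destruct (pok_tr _ _ _ _ _ _ _ SX Ht) as [WC1 NC1]. destruct (pok_tr _ _ _ _ _ _ _ SY Ht) as [WC2 _].
    rewrite (w_D _ _ WX) in WC1 by auto. rewrite (w_D _ _ WY) in WC2 by auto.
    destruct (St_open _ _ _ _ _ _ SS WC1 WC2 (tr_nf _ _ _ _ Ht))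
      as (ks & N & s' & D1 & D2 & -> & Hks & HkX & HkY & SS1 & Ps1 & Ps2 & WN1 & WN2 & NN).
    pose proof (nus_tr (tds y) _ _ (LO a) (RO _) (nus_tr es _ _ (LO a) (RO _)
      (tr_vsub _ _ _ _ (tr_pr_o _ (tp y) _ _ _ Ht) (tH y)) (proj2 (Hl y WY))) (proj1 (Hl y WY))) as Htr.
    assert (Fs : forall z, wfs e z -> (forall k i, In k ks -> ~ nf k (tH z i)) -> forall k, In k ks -> ~ nf k (vsub (tH z) (tp z))).
    { intros z Wz HH k Hi. apply nf_vsub_H; auto. apply (disj_12 (tp z) true); [apply (w_p _ _ Wz)|auto]. }
    exists (rep y es s), m. eexists _, _. split; [apply ws_refl; reflexivity|]. split; [exact Htr|].
    split; [apply cws_refl|]. intros E WEE NE. simpl.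
    pose proof SS1 as [_ WX1 WY1 _ _ _ _ _].
    exists e, (setD x D1), (setD y D2), (es ++ ks), (Pr (inst E N) s'). split; [|split].
    + apply (St_s _ _ _ _ s); auto; apply pok_Pr; auto; apply pok_inst; auto; try (left; auto; fail).
    + rewrite cvsub_cpr, cvsub_cnus, cpr_cnus by auto.
      rewrite !cap_cnus by ds0 NE.
      unfold rep. simpl. rewrite nus_app. apply nus_dsc, nus_dsc, nus_dsc. rewrite vsub_inst, EE by auto.
      rewrite !dsc_assoc. rewrite (dsc_comm (inst _ _) (vsub _ (tp x))). reflexivity.
    + rewrite cvsub_cpr, cvsub_cnus, cpr_cnus by auto.
      rewrite !cap_cnus by ds0 NE.
      unfold rep. simpl. rewrite nus_app. apply nus_dsc, nus_dsc, nus_dsc. rewrite vsub_inst, EE by auto.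
      rewrite !dsc_assoc. rewrite (dsc_comm (inst _ _) (vsub _ (tp y))). reflexivity.
Qed.

(** * Answering transitions that unfold stored abstractions *)

Definition lok l := forall a, lname l = Some a -> a mod 4 = 0.
Definition AnswersAt n := forall e x y es s l r, St e x y es s -> lok l ->
  tr n (vsub (tH x) (Pr (tp x) s)) l r -> Ans l (rnus (tds x) (rnus es r)) (rep y es s).
(** A call of variable [i] is pending, and [n] counts the beta steps that the transition uses once
    this call is resolved. *)
Definition AnswersCallAt n i := forall e x y es s l r C, St e x y es s -> lok l -> i < len e ->
  call (Pr (tp x) s) i C -> tr n (cap (cvsub (tH x) C) (body (tH x i))) l r ->
  Ans l (rnus (tds x) (rnus es r)) (rep y es s).

(** What may remain after a call has been played: a transition with no larger count, or a pending
    call of a strictly older variable. *)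
Definition Pend n i e x s l r :=
  (exists n', n' <= n /\ tr n' (vsub (tH x) (Pr (tp x) s)) l r) \/
  (exists j C n', j < i /\ j < len e /\ n' <= n /\ call (Pr (tp x) s) j C /\
     tr n' (cap (cvsub (tH x) C) (body (tH x j))) l r).

Lemma Pend_Ans n i e x y es s l r : (forall n', n' <= n -> AnswersAt n') ->
  (forall j n', j < i -> n' <= n -> AnswersCallAt n' j) -> St e x y es s -> lok l -> Pend n i e x s l r ->
  Ans l (rnus (tds x) (rnus es r)) (rep y es s).
Proof.
  intros HM HC SS Hl [(n' & Hn & Ht)|(j & C & n' & Hj & Hjl & Hn & Hc & Ht)].
  - eapply HM; eauto.
  - eapply HC; eauto.
Qed.

(* The stored abstraction [A] of variable [i] is either a real abstraction, and then the call
   costs a beta step, or an older variable, and then the index of the pending call decreases. *)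
Lemma Pend_intro n i e x s l r Z D A : dwt D (GA i) A TAbs -> i <= len e -> tr n Z l r ->
  (forall U, A = La U -> fw true Z (vsub (tH x) (Pr (tp x) s))) ->
  (forall j, A = V j -> exists C, call (Pr (tp x) s) j C /\ fw true Z (cap (cvsub (tH x) C) (body (tH x j)))) ->
  exists r', Pend n i e x s l r' /\ req r r'.
Proof.
  intros WA Hi Ht H1 H2. inversion WA; subst.
  - apply GA_nth in H as [_ Hx]. destruct (H2 _ eq_refl) as (C & Hc & HF).
    eapply fw_tr in HF as (n' & r' & ? & ? & R); eauto. exists r'. split; [|apply rfw_req; auto].
    right. exists x0, C, n'. repeat split; auto. lia.
  - eapply fw_tr in H1 as (n' & r' & ? & ? & R); eauto. exists r'. split; [|apply rfw_req; auto].
    left. exists n'. auto.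
Qed.

(** The extra [N0] is the continuation of the bare call, which [call_v] creates when the resolved
    abstraction is itself a variable. *)
Fixpoint cn0 C := match C with CB N T => CB N (Pr N0 T) | CN C => CN (cn0 C) end.
Lemma call_cap_var C j : call (cap C (aapF (V j))) j (cn0 C).
Proof.
  induction C; simpl.
  - apply (call_pl (Ap (V j) A) T j (CB A N0)). constructor.
  - constructor. exact IHC.
Qed.
Lemma fw_cn0 C : forall H F, fw true (cap (cvsub H C) F) (cap (cvsub H (cn0 C)) F).
Proof.
  induction C; intros; simpl.
  - apply fw_pr; [constructor|]. eapply fw_trans; [apply fw_nil'|apply fw_comm].
  - apply fw_nu; auto.
Qed.
Lemma fw_cap_cpl C F U : fw true (cap (cpl C U) F) (Pr (cap C F) U).
Proof. eapply fw_weaken, fw_sym, fw_cpl_cap. Qed.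
Lemma fw_cap_cpr C F U : fw true (cap (cpr U C) F) (Pr U (cap C F)).
Proof. eapply fw_weaken, fw_sym, fw_cpr_cap. Qed.

Lemma cnu_cnu d e C : ceq (cnu d (cnu e C)) (cnu e (cnu d C)).
Proof.
  destruct (Nat.eq_dec d e) as [->|N]; [reflexivity|]. unfold cnu. simpl. rewrite ceq_swap.
  rewrite !cnren_cnren.
  match goal with |- ceq (CN (CN (cnren ?a C))) (CN (CN (cnren ?b C))) => replace a with b; [reflexivity|] end.
  extensionality x. unfold clo. destruct (x =? e) eqn:E1, (x =? d) eqn:E2; simpl; rewrite ?E1, ?E2; auto.
  apply Nat.eqb_eq in E1, E2. congruence.
Qed.
Lemma cnus_cnus ds es C : ceq (cnus ds (cnus es C)) (cnus es (cnus ds C)).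
Proof.
  assert (K : forall ds e C, ceq (cnus ds (cnu e C)) (cnu e (cnus ds C))).
  { induction ds0; intros; simpl; [reflexivity|]. rewrite <- cnu_cnu. apply ceq_n, ceq_nren; auto. }
  induction es; simpl; [reflexivity|]. rewrite K. apply ceq_n, ceq_nren; auto.
Qed.
Lemma rnus_swap ds es ks r : req (rnus ds (rnus es (rnus ks r))) (rnus (ds ++ ks) (rnus es r)).
Proof.
  destruct r; simpl; rewrite ?nus_app, ?cnus_app.
  - apply nus_dsc, nus_nus.
  - apply nus_dsc, nus_nus.
  - apply cnus_ceq, cnus_cnus.
Qed.
Lemma rnus_app ds es ks r : rnus ds (rnus es (rnus ks r)) = rnus ds (rnus (es ++ ks) r).
Proof. destruct r; simpl; rewrite ?nus_app, ?cnus_app; auto. Qed.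

Lemma body_La e x i U : wfs e x -> i < len e -> tA x i = La U -> body (tH x i) = vsub (up (tH x)) U.
Proof. intros W Hi E. rewrite (w_H _ _ W) by auto. rewrite E. reflexivity. Qed.
Lemma body_V e x i j : wfs e x -> i < len e -> tA x i = V j -> tH x i = tH x j.
Proof. intros W Hi E. rewrite (w_H _ _ W) by auto. rewrite E. reflexivity. Qed.

Lemma wfs_A_GA e x i : wfs e x -> i < len e -> dwt (tD x) (GA (len e)) (tA x i) TAbs.
Proof.
  intros W Hi. replace (len e) with (i + (len e - i)) by lia. rewrite repeat_app.
  apply dwt_app_ctx. apply (w_A _ _ W); auto.
Qed.

Lemma call_inst e x i N : wfs e x -> i < len e ->
  dsc (vsub (tH x) (inst (aapF (tA x i)) N)) (inst (body (tH x i)) (vsub (tH x) N)).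
Proof.
  intros W Hi. rewrite vsub_inst, aapF_vsub, <- (w_H _ _ W) by auto.
  rewrite (tH_body _ _ _ W Hi) at 1. simpl. rewrite dsc_beta, inst_upn. reflexivity.
Qed.
Lemma body_nf e x i k : wfs e x -> i < len e -> (forall i, ~ nf k (tH x i)) -> ~ nf k (body (tH x i)).
Proof. intros W Hi H Hn. apply (H i). rewrite (tH_body _ _ _ W Hi). exact Hn. Qed.

(** Caller and owner give four cases. A call across the border stores its argument as a new variable
    and leaves the owner to run its abstraction on that variable. A call inside the environment is
    mere congruence, one inside the process goes through its server. In each case the original
    transition survives as a [Pend]. *)
Lemma CallAt_step n i : (forall n', n' <= n -> AnswersAt n') -> (forall j n', j < i -> n' <= n -> AnswersCallAt n' j) ->
  AnswersCallAt n i.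
Proof.
  intros HM HC e x y es s l r C0 SS Hl Hi Hc Ht. pose proof SS as [WE WX WY SX SY SE SA SPQ].
  pose proof (w_p _ _ WX) as WP. pose proof (w_A _ _ WX i Hi) as WA.
  inversion Hc as [| ? ? ? C Hc' | ? ? ? C Hc' | |]; subst; clear Hc; destruct (sd e i) eqn:Es.
  - (* the process calls its own abstraction *)
    destruct (M_self _ _ _ _ _ WE WX WY SPQ Hc' Hi Es) as (q' & W' & S' & HPQ).
    set (x' := setp x (cap C (aapF (tA x i)))) in *.
    assert (SS' : St e x' (setp y q') es s).
    { apply St_setp; auto. apply wfs_setp; auto. rewrite <- Es. eapply pok_self; eauto. rewrite Es; auto. }
    edestruct (Pend_intro n i e x' s l r _ _ (tA x i) WA (Nat.lt_le_incl _ _ Hi) Ht) as (r' & HP & HR).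
    + intros U EU. simpl. rewrite cvsub_cpl, cvsub_cap, (body_La _ _ _ _ WX Hi EU), EU. apply fw_cap_cpl.
    + intros j EV. exists (cpl (cn0 C) s). simpl. split.
      * constructor. rewrite EV. apply call_cap_var.
      * rewrite !cvsub_cpl, <- (body_V _ _ _ _ WX Hi EV).
        eapply fw_trans; [apply fw_cap_cpl|]. eapply fw_trans; [|apply fw_cpl_cap].
        apply fw_pr; [apply fw_cn0|constructor].
    + eapply Ans_ws; [apply rep_ws0; exact S'|]. eapply Ans_req; [apply rnus_req, rnus_req, req_sym; exact HR|].
      eapply Pend_Ans in HP; eauto.
  - (* the process calls an abstraction of the environment *)
    assert (He : emits e (tp x) (mm e i) C) by (right; eauto).
    destruct (St_emit _ _ _ _ _ _ _ SS He) as (ks & N & p' & D1 & m' & q1 & ks' & N' & q3 & q4 & D2 &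
       -> & Hks & Hks' & HkX & HkY & W1 & S1 & He1 & WN & Wp & WN' & Wq3 & S3 & Wq4 & HSt).
    (* Triggers are pairwise distinct and avoid class 0, so an output on [mm e i] can only be a call
       of the same variable. *)
    assert (Hc1 : call q1 i (cnus ks' (CB N' q3))).
    { destruct He1 as [[E _]|(j & Hj & E & Hcj)]; [rewrite (proj1 WE) in E; discriminate|].
      apply (proj2 WE) in E; auto. subst; auto. }
    set (s' := Pr s (inst (aapF (tA x i)) (V (len e)))).
    assert (Ei : tA x i = tA y i) by auto.
    assert (NAi : forall z, nf z (tA x i) -> okn false z).
    { intros z Hz. rewrite <- Es. apply (w_n _ _ WX i Hi); auto. }
    assert (SS' := HSt s'). set (x' := extS e x D1 N (tds x ++ ks) p') in *.
    set (y' := extS e y D2 N' (tds y ++ ks') q4) in *.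
    assert (SS'' : St (extE e m' true) x' y' es s').
    { apply SS'; (apply pok_Pr; [apply pok_S; auto|]); apply pok_instV.
      - apply aapF_dwt, wfs_A_GA; auto.
      - intros z Hz. apply aapF_nf in Hz; auto.
      - rewrite Ei. apply aapF_dwt, wfs_A_GA; auto.
      - intros z Hz. apply aapF_nf in Hz; auto. }
    pose proof (s_x _ _ _ _ _ SS'') as WX'. pose proof (s_y _ _ _ _ _ SS'') as WY'.
    assert (Hi' : i < len (extE e m' true)) by (simpl; lia).
    assert (EA' : tA x' i = tA x i) by (simpl; apply upd_lt; auto).
    assert (EAy' : tA y' i = tA y i) by (simpl; apply upd_lt; auto).
    assert (EH' : tH x' i = tH x i) by (simpl; apply upd_lt; auto).
    assert (EHy' : tH y' i = tH y i) by (simpl; apply upd_lt; auto).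
    assert (EN : tH x' (len e) = vsub (tH x) N) by (simpl; apply upd_eq).
    assert (ENy : tH y' (len e) = vsub (tH y) N') by (simpl; apply upd_eq).
    assert (Es1 : vsub (tH x') s = vsub (tH x) s) by (eapply H_old; apply SX).
    assert (Es2 : vsub (tH y') s = vsub (tH y) s) by (eapply H_old; apply SY).
    assert (Ep : vsub (tH x') p' = vsub (tH x) p') by (eapply H_old; eauto).
    assert (Eq : vsub (tH y') q4 = vsub (tH y) q4) by (eapply H_old; eauto).
    assert (Fs : forall H kk, (forall k i, In k kk -> ~ nf k (H i)) -> (forall k, In k kk -> k mod 4 = 1) ->
       forall k, In k kk -> ~ nf k (vsub H s)).
    { intros H kk HH Hk k Hik. apply nf_vsub_H; auto. apply (disj_12 s false); [apply SX|auto]. }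
    assert (Tx : tp x' = p') by reflexivity. assert (Ty : tp y' = q4) by reflexivity.
    assert (Dx : tds x' = tds x ++ ks) by reflexivity. assert (Dy : tds y' = tds y ++ ks') by reflexivity.
    clear SS' HSt. clearbody x' y'.
    rewrite cvsub_cpl, cvsub_cnus, cpl_cnus in Ht by eauto.
    rewrite cap_cnus in Ht by (intros k Hk; eapply body_nf; eauto). simpl cap in Ht.
    apply nus_tr_inv in Ht as (r0 & Ht & -> & _).
    edestruct (Pend_intro n i (extE e m' true) x' s' l r0 _ _ (tA x i) WA ltac:(simpl; lia) Ht) as (r' & HP & HR).
    + intros U EU. unfold s'. rewrite Tx. simpl vsub. rewrite vsub_inst.
      change (vsub (tH x') (V (len e))) with (tH x' (len e)). rewrite EN, Es1, Ep.
      rewrite EU. change (aapF (La U)) with U. rewrite <- (body_La (extE e m' true) x' i U); auto; [|rewrite EA'; auto]. rewrite EH'.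
      eapply fw_trans; [apply fw_comm|]. apply fw_assoc'.
    + intros j EV. assert (Ej : body (tH x' j) = body (tH x i)).
      { rewrite <- (body_V (extE e m' true) x' i j), EH'; auto. rewrite EA'; auto. }
      exists (cpr p' (cpr s (CB (V (len e)) N0))). rewrite Tx. split.
      * apply (call_pr p' s' j (cpr s (CB (V (len e)) N0))). unfold s'.
        apply (call_pr s _ j (CB (V (len e)) N0)). rewrite EV. apply (call_v j (V (len e))).
      * rewrite Ej. simpl cpr. simpl cvsub. simpl cap. change (vsub (tH x') (V (len e))) with (tH x' (len e)).
        rewrite EN, Es1, Ep. apply fw_pr; [constructor|]. apply fw_pr; [constructor|]. apply fw_nil'.
    + eapply Ans_ws; [|eapply Ans_req; [|eapply Pend_Ans in HP; eauto]].
      * eapply ws_trans; [apply rep_ws0; exact S1|]. unfold rep. simpl tds. simpl tp. simpl tH at 1.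
        rewrite Dy, Ty, nus_app. apply ws_nus. rewrite nus_nus. apply ws_nus.
        unfold s'. simpl vsub. rewrite Es2, Eq.
        rewrite (call_dsc _ _ _ Hc1 _ _ (tH_body _ _ _ WY Hi)), cvsub_cnus, cap_cnus; auto.
        2: { intros k Hk; eapply body_nf; eauto. }
        rewrite <- nus_pr by eauto. apply ws_nus. simpl.
        rewrite Ei, <- EAy'.
        pose proof (call_inst _ _ _ (V (len e)) WY' Hi') as CI. rewrite CI. rewrite EHy'.
        change (vsub (tH y') (V (len e))) with (tH y' (len e)). rewrite ENy.
        rewrite (dsc_comm (inst _ _)), <- dsc_assoc, (dsc_comm (inst _ _)). apply ws_pl. auto.
      * rewrite Dx. eapply req_trans; [|apply req_sym, rnus_swap]. apply rnus_req, rnus_req, req_sym. auto.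
  - (* the environment calls an abstraction of the process *)
    destruct (call_dwt _ _ _ Hc' _ _ _ (proj1 SX)) as [_ WC1]. destruct (call_dwt _ _ _ Hc' _ _ _ (proj1 SY)) as [_ WC2].
    destruct (St_open _ _ _ _ _ _ SS WC1 WC2 (call_nf _ _ _ Hc'))
      as (ks & N & s' & D1 & D2 & -> & Hks & HkX & HkY & SS1 & Ps1 & Ps2 & WN1 & WN2 & NN).
    destruct SS1 as [_ WX1 WY1 SX1 SY1 SE1 SA1 SPQ1].
    destruct (M_serve e (setD x D1) (setD y D2) i N WE WX1 WY1 SPQ1 Hi Es WN2 NN)
      as (m' & q' & WE' & WY' & S2 & HPQ).
    set (p1 := Pr (tp x) (inst (aapF (tA x i)) (V (len e)))) in *.
    set (x' := extS e (setD x D1) D1 N (tds x) p1) in *.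
    set (y' := extS e (setD y D2) D2 N (tds y) q') in *.
    assert (WX' : wfs (extE e m' false) x').
    { apply wfs_ext; auto; [apply (w_D _ _ WX1)| |apply (w_ds _ _ WX1)].
      apply pok_Pr; [apply pok_S; apply (w_p _ _ WX1)|]. apply pok_instV.
      - apply aapF_dwt, (wfs_A_GA _ _ _ WX1); auto.
      - intros z Hz. apply aapF_nf in Hz. rewrite <- Es. apply (w_n _ _ WX i Hi); auto. }
    assert (SS'' : St (extE e m' false) x' y' (es ++ ks) s').
    { split; auto; try (apply pok_S; auto; fail).
      simpl. intros j Hj. destruct (Nat.eq_dec j (len e)) as [->|]; upds; auto. intros. apply SA; auto. lia. }
    assert (Hi' : i < len (extE e m' false)) by (simpl; lia).
    assert (EA' : tA x' i = tA x i) by (simpl; apply upd_lt; auto).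
    assert (EH' : tH x' i = tH x i) by (simpl; apply upd_lt; auto).
    assert (EAy' : tA y' i = tA y i) by (simpl; apply upd_lt; auto).
    assert (EHy' : tH y' i = tH y i) by (simpl; apply upd_lt; auto).
    assert (EN : tH x' (len e) = vsub (tH x) N) by (simpl; apply upd_eq).
    assert (ENy : tH y' (len e) = vsub (tH y) N) by (simpl; apply upd_eq).
    assert (Es1 : vsub (tH x') s' = vsub (tH x) s') by (eapply H_old; apply Ps1).
    assert (Es2 : vsub (tH y') s' = vsub (tH y) s') by (eapply H_old; apply Ps2).
    assert (Ep : vsub (tH x') (tp x) = vsub (tH x) (tp x)) by (eapply H_old; apply WP).
    assert (Eq : vsub (tH y') (tp y) = vsub (tH y) (tp y)) by (eapply H_old; apply (w_p _ _ WY)).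
    assert (Fs : forall z, wfs e z -> (forall k i, In k ks -> ~ nf k (tH z i)) -> forall k, In k ks -> ~ nf k (vsub (tH z) (tp z))).
    { intros z Wz HH k Hik. apply nf_vsub_H; auto. apply (disj_12 (tp z) true); [apply (w_p _ _ Wz)|auto]. }
    assert (Tx : tp x' = p1) by reflexivity. assert (Ty : tp y' = q') by reflexivity.
    assert (Dx : tds x' = tds x) by reflexivity. assert (Dy : tds y' = tds y) by reflexivity.
    assert (S2' : ws (vsub (tH y') (Pr (tp y) (inst (aapF (tA y i)) (V (len e))))) (vsub (tH y') q')) by exact S2.
    clear S2 HPQ WY'. pose proof (s_y _ _ _ _ _ SS'') as WY'. clearbody x' y'.
    rewrite cvsub_cpr, cvsub_cnus, cpr_cnus in Ht by auto.
    rewrite cap_cnus in Ht by (intros k Hk; eapply body_nf; eauto). simpl cap in Ht.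
    apply nus_tr_inv in Ht as (r0 & Ht & -> & _). rewrite rnus_app.
    edestruct (Pend_intro n i (extE e m' false) x' s' l r0 _ _ (tA x i) WA ltac:(simpl; lia) Ht) as (r' & HP & HR).
    + intros U EU. rewrite Tx. unfold p1. simpl vsub. rewrite vsub_inst.
      change (vsub (tH x') (V (len e))) with (tH x' (len e)). rewrite EN, Es1, Ep.
      rewrite EU. change (aapF (La U)) with U. rewrite <- (body_La (extE e m' false) x' i U); auto; [|rewrite EA'; auto]. rewrite EH'.
      eapply fw_trans; [apply fw_assoc|]. apply fw_pr; [apply fw_comm|constructor].
    + intros j EV. assert (Ej : body (tH x' j) = body (tH x i)).
      { rewrite <- (body_V (extE e m' false) x' i j), EH'; auto. rewrite EA'; auto. }
      exists (cpl (cpr (tp x) (CB (V (len e)) N0)) s'). rewrite Tx. split.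
      * apply (call_pl p1 s' j (cpr (tp x) (CB (V (len e)) N0))). unfold p1.
        apply (call_pr (tp x) _ j (CB (V (len e)) N0)). rewrite EV. apply (call_v j (V (len e))).
      * rewrite Ej. simpl cpr. simpl cpl. simpl cvsub. simpl cap. change (vsub (tH x') (V (len e))) with (tH x' (len e)).
        rewrite EN, Es1, Ep. apply fw_pr; [constructor|]. apply fw_pr; [apply fw_nil'|constructor].
    + eapply Ans_ws; [|eapply Ans_req; [|eapply Pend_Ans in HP; eauto]].
      * unfold rep. rewrite Dy, Ty. apply ws_nus. rewrite nus_app. apply ws_nus.
        simpl vsub. rewrite Es2.
        rewrite (call_dsc _ _ _ Hc' _ _ (tH_body _ _ _ WY Hi)), cvsub_cnus, cap_cnus; auto.
        2: { intros k Hk; eapply body_nf; eauto. }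
        rewrite <- nus_prr by auto. apply ws_nus. simpl cap. rewrite dsc_assoc. apply ws_pl.
        eapply ws_dsc_l; [exact S2'|]. simpl vsub. rewrite Eq, <- EAy'.
        rewrite (call_inst _ _ _ (V (len e)) WY' Hi'). rewrite EHy'.
        change (vsub (tH y') (V (len e))) with (tH y' (len e)). rewrite ENy. reflexivity.
      * rewrite Dx. apply rnus_req, rnus_req, req_sym. auto.
  - (* the environment calls its own abstraction *)
    assert (Ei : tA x i = tA y i) by auto.
    set (s' := cap C (aapF (tA x i))).
    assert (SS' : St e x y es s').
    { apply (St_s _ _ _ _ s); auto; unfold s'; rewrite <- Es.
      - eapply pok_self; eauto. rewrite Es; auto.
      - rewrite Ei. eapply pok_self; eauto. rewrite Es; auto. }
    edestruct (Pend_intro n i e x s' l r _ _ (tA x i) WA (Nat.lt_le_incl _ _ Hi) Ht) as (r' & HP & HR).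
    + intros U EU. simpl. unfold s'. rewrite cvsub_cpr, cvsub_cap, (body_La _ _ _ _ WX Hi EU), EU. apply fw_cap_cpr.
    + intros j EV. exists (cpr (tp x) (cn0 C)). simpl. split.
      * constructor. unfold s'. rewrite EV. apply call_cap_var.
      * rewrite !cvsub_cpr, <- (body_V _ _ _ _ WX Hi EV).
        eapply fw_trans; [apply fw_cap_cpr|]. eapply fw_trans; [|apply fw_cpr_cap].
        apply fw_pr; [constructor|apply fw_cn0].
    + eapply Ans_ws; [|eapply Ans_req; [apply rnus_req, rnus_req, req_sym; exact HR|eapply Pend_Ans in HP; eauto]].
      apply ws_refl. unfold rep. simpl. unfold s'. rewrite Ei.
      rewrite <- (call_resolve e y s i C); auto. reflexivity.
Qed.

(** Lexicographic induction on beta count and index. Leaving a plain transition through [tr_abs_inv]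
    lowers the count strictly and allows any index; [CallAt_step] does not raise the count and
    either lowers the index or returns to a plain transition. *)
Lemma St_answers n : AnswersAt n /\ forall i, AnswersCallAt n i.
Proof.
  induction n as [n IH] using lt_wf_ind.
  assert (M : AnswersAt n).
  { intros e x y es s l r SS Hl Ht. pose proof SS as [WE WX WY SX SY SE SA SPQ].
    assert (WPs : dwt (tD x) (GA (len e)) (Pr (tp x) s) TProc).
    { constructor; [apply (w_p _ _ WX)|apply SX]. }
    destruct (tr_abs_inv _ _ _ _ Ht (len e) (tD x) (Pr (tp x) s) (tH x) (fun i => body (tH x i)) eq_refl WPs)
      as [(m & r0 & Ht0 & ->)|(i & C & Hc & n' & r' & Hn & Ht' & HR)].
    { intros i Hi. apply tH_body with (e := e); auto. }
    - pose proof (tr_dwt _ _ _ _ Ht0 _ _ _ WPs) as K.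
      destruct l as [|[a|]|a], r0; simpl in K; try tauto.
      + eapply St_answers_tau; eauto.
      + eapply St_answers_in; eauto.
      + simpl. auto.
      + eapply St_answers_out; eauto.
    - destruct (call_dwt _ _ _ Hc _ _ _ WPs) as [Hi _]. apply GA_nth in Hi as [_ Hi].
      eapply Ans_req; [apply rnus_req, rnus_req, req_sym; exact HR|].
      eapply (proj2 (IH n' Hn)); eauto. }
  split; auto. induction i as [i IHi] using lt_wf_ind. apply CallAt_step.
  - intros n' Hn. destruct (Nat.eq_dec n' n) as [->|]; auto. apply IH. lia.
  - intros j n' Hj Hn. destruct (Nat.eq_dec n' n) as [->|]; auto. apply IH. lia.
Qed.

Lemma Rel_Ans U W n l r : Rel U W -> tr n U l r -> lok l -> Ans l r W.
Proof.
  intros (e & x & y & es & s & SS & EU & EW) Ht Hl.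
  eapply harmony in Ht as (m & r' & Ht & HR); eauto.
  apply nus_tr_inv in Ht as (r1 & Ht & -> & _). apply nus_tr_inv in Ht as (r2 & Ht & -> & _).
  eapply Ans_ws; [apply ws_refl; exact EW|]. eapply Ans_req; [apply req_sym; exact HR|].
  eapply (proj1 (St_answers m)); eauto.
Qed.

(** * Normal bisimilarity implies context bisimilarity *)

(** Puts all names of the original terms in class 0 and leaves the other classes for private names
    and triggers. *)
Definition quad x := x * 4.
Lemma quad_inj : inj quad.
Proof. intros x y H. unfold quad in H. lia. Qed.
Lemma quad_mod x : quad x mod 4 = 0.
Proof. unfold quad. apply Nat.Div0.mod_mul. Qed.

(** [quad] is not surjective, while [NB] asks for a bijection; agreement on finitely many names is
    enough. Each further name is corrected by composing with a transposition. *)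
Lemma bij_ext L : exists f g : nat -> nat, (forall x, g (f x) = x) /\ (forall x, f (g x) = x) /\
  forall x, In x L -> f x = quad x.
Proof.
  induction L as [|y L (f & g & gf & fg & H)].
  - exists (fun x => x), (fun x => x). repeat split; auto. intros x [].
  - destruct (in_dec Nat.eq_dec y L) as [Hy|Hy].
    { exists f, g. repeat split; auto. intros x [<-|?]; auto. }
    set (t := fun z => if z =? f y then quad y else if z =? quad y then f y else z).
    assert (tt : forall z, t (t z) = z).
    { intros z. unfold t. destruct (z =? f y) eqn:E1.
      - apply Nat.eqb_eq in E1. subst. destruct (quad y =? f y) eqn:E2; [apply Nat.eqb_eq in E2; auto|].
        rewrite Nat.eqb_refl. auto.
      - destruct (z =? quad y) eqn:E2; [rewrite Nat.eqb_refl; apply Nat.eqb_eq in E2; auto|].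
        rewrite E1, E2; auto. }
    exists (fun x => t (f x)), (fun x => g (t x)). repeat split.
    + intros x. rewrite tt; auto.
    + intros x. rewrite fg, tt; auto.
    + intros x [<-|Hx].
      * unfold t. rewrite Nat.eqb_refl. auto.
      * rewrite (H x Hx). unfold t. destruct (quad x =? f y) eqn:E1.
        -- apply Nat.eqb_eq in E1. rewrite <- (H x Hx) in E1. apply (g_inj f g gf) in E1. subst. contradiction.
        -- destruct (quad x =? quad y) eqn:E2; auto. apply Nat.eqb_eq, quad_inj in E2. subst; contradiction.
Qed.

Notation qt P := (nren quad (tl0 P)).

Lemma quad_nf T z : nf z (nren quad T) -> z mod 4 = 0.
Proof. intros H. apply nf_nren in H as (y & _ & ->). apply quad_mod. Qed.
Lemma quad_dwt G T s : dwt D0 G T s -> dwt D0 G (nren quad T) s.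
Proof. intros H. eapply dwt_nren; eauto. Qed.
Lemma bij_qt f T : (forall x, In x (fn T) -> f x = quad x) -> nren f (tl0 T) = qt T.
Proof. intros H. rewrite !tl_nren. apply tl_ext; auto. Qed.

(** Nothing has been exchanged yet. The trigger map is constantly 3 because [wfe] demands class 3
    even beyond the length of the list. *)
Lemma init_side P (e := Env 0 (fun _ => 3) (fun _ => true)) (x := Side D0 (fun _ => N0) (fun _ => N0) [] (qt P)) :
  proc P -> wfs e x /\ (forall fl, dsc (pf e fl x) (qt P)) /\ dsc (rep x [] N0) (qt P).
Proof.
  intros HP. apply proc_dwt in HP. assert (W : dwt D0 [] (qt P) TProc) by (apply quad_dwt; auto).
  split; [|split].
  - split; simpl; auto; try lia; try (intros; lia); try (intros d []).
    split; auto. intros z Hz. left. eapply quad_nf; eauto.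
  - intros fl. unfold pf. simpl. rewrite (dwt_closed _ _ _ _ W). apply dsc_nil.
  - unfold rep. simpl. rewrite (dwt_closed _ _ _ _ W). apply dsc_nil.
Qed.

Lemma normal_Rel P Q : proc P -> proc Q -> normal_bisimilar P Q -> Rel (qt P) (qt Q).
Proof.
  intros HP HQ (R & HR & H). destruct (bij_ext (fn P ++ fn Q)) as (f & g & gf & fg & Hf).
  destruct (init_side P HP) as (WP & EP & RP_). destruct (init_side Q HQ) as (WQ & EQ & RQ_).
  set (e := Env 0 (fun _ => 3) (fun _ => true)) in *.
  exists e, (Side D0 (fun _ => N0) (fun _ => N0) [] (qt P)), (Side D0 (fun _ => N0) (fun _ => N0) [] (qt Q)), [], N0.
  split; [|split; symmetry; auto]. split; auto.
  - split; simpl; auto. intros; lia.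
  - split; [constructor|]. intros z [].
  - split; [constructor|]. intros z [].
  - intros d [].
  - exists (fun _ => true), (fun _ => true). exists R, P, Q, f, g.
    split; [exact HR|]. split; [exact H|]. split; [exact gf|]. split; [exact fg|]. split.
    + etransitivity; [apply EP|]. rewrite (bij_qt f); [reflexivity|]. intros; apply Hf; auto with datatypes.
    + etransitivity; [apply EQ|]. rewrite (bij_qt f); [reflexivity|]. intros; apply Hf; auto with datatypes.
Qed.

Lemma ws_qt_inv Q W : proc Q -> ws (qt Q) W -> exists Q', tau_star Q Q' /\ proc Q' /\ dsc W (qt Q').
Proof.
  intros HQ H. apply proc_dwt in HQ. apply ws_nren_inv in H as (T & HT & E); [|apply quad_inj].
  eapply ws_tau_star in HT as (Q' & ? & E' & W'); [|apply id_inj|reflexivity|exact HQ].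
  exists Q'. split; auto. split; [apply proc_dwt; auto|]. rewrite E, E'. reflexivity.
Qed.

Lemma upd_Vfun X : upd (fun x => vren S (V x)) X (V 0) = (fun x => V (upd S X 0 x)).
Proof. extensionality x. unfold upd. destruct (x =? X); auto. Qed.
Definition ctx_tl r X E := tl r (upd (fun x => vren S (V x)) X (V 0)) E.
Lemma ctx_tl_fresh c r X E : ~ In c (fn E) -> ctx_tl (upd (fun x => S (r x)) c 0) X E = nren S (ctx_tl r X E).
Proof.
  intros H. unfold ctx_tl. rewrite upd_Vfun. apply (tl_res_fresh c E r (fun x => V (upd S X 0 x))). auto.
Qed.
Lemma news_ctx cs A P' X E : (forall c, In c cs -> ~ In c (fn E)) -> subst_safe A E -> forall r,
  tl r V (news cs (Par (subst A X E) P')) = cap (tlc r V cs A P') (ctx_tl r X E).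
Proof.
  intros Hc Hs. induction cs as [|c cs IH]; intros r.
  - simpl. rewrite tl_subst by auto. unfold ctx_tl. rewrite (tl_inst X E A r V). reflexivity.
  - change (Nu (tl (upd (fun x => S (r x)) c 0) V (news cs (Par (subst A X E) P'))) =
      Nu (cap (tlc (upd (fun x => S (r x)) c 0) V cs A P') (nren S (ctx_tl r X E)))).
    rewrite IH by auto with datatypes. rewrite ctx_tl_fresh by auto with datatypes. reflexivity.
Qed.
Lemma ctx_tl_dwt X E : context X E -> dwt D0 [TAbs] (ctx_tl (fun x => x) X E) TProc.
Proof.
  intros [H1 H2]. eapply wt_dwt; eauto. intros Y HY. apply H1 in HY. subst. upds. constructor. auto.
Qed.
Lemma news_out_cwt cs a A P : forall r D, ~ In a cs -> dwt D [] (tl r V (news cs (Out a A P))) TProc ->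
  cwt D [] (D (r a)) (tlc r V cs A P).
Proof.
  induction cs as [|c cs IH]; simpl; intros r D Ha H; inv H.
  - auto.
  - match goal with H : dwt (scons ?s _) _ _ _ |- _ => exists s; change (nup V) with V in *; apply IH in H; [|tauto];
      rewrite upd_neq in H by (intros ->; tauto); exact H end.
Qed.
Lemma cws_tlc_inv ds B Q : forall r D t X, inj r -> cwt D [] t (tlc r V ds B Q) -> cws (tlc r V ds B Q) X ->
  exists Q', tau_star Q Q' /\ ceq X (tlc r V ds B Q') /\ cwt D [] t (tlc r V ds B Q').
Proof.
  induction ds as [|d ds IH]; simpl; intros r D t X Hi Hw Hx; inv Hx.
  - destruct Hw as [HB HQ].
    match goal with H : ws _ _ |- _ => eapply ws_tau_star in H as (Q' & ? & E & ?); [|exact Hi|reflexivity|exact HQ] end.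
    exists Q'. repeat split; auto. constructor; [reflexivity|symmetry; auto].
  - destruct Hw as [s Hw]. change (nup V) with V in *.
    match goal with H : cws _ _ |- _ => eapply IH in H as (Q' & ? & E & ?); [|apply upd_inj; auto|exact Hw] end.
    exists Q'. split; auto. split; [constructor; auto|eauto].
Qed.

Definition ctx_rel P Q := proc P /\ proc Q /\ Rel (qt P) (qt Q).

Lemma ctx_rel_bisimulation : ctx_bisimulation ctx_rel.
Proof.
  split; [|split].
  - intros P Q (? & ? & H). split; auto. split; auto. apply Rel_sym; auto.
  - intros P Q (? & ? & _); auto.
  - intros P Q (HP & HQ & HR). split; [|split].
    + intros P' St HP'. apply step_tr with (r := fun x => x) (e := V) in St as (n & T1 & Ht & E).
      apply (tr_nren _ _ _ _) with (f := quad) in Ht.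
      destruct (Rel_Ans _ _ _ _ _ HR Ht) as (W & HW & HR'); [intros a Ha; discriminate|].
      apply ws_qt_inv in HW as (Q' & ? & ? & EW); auto. exists Q'. split; auto. split; auto. split; auto.
      rewrite <- E, <- EW. auto.
    + intros a A P' [EA WA] St HP'. apply step_tr with (r := fun x => x) (e := V) in St as (n & F & Ht & E).
      apply (tr_nren _ _ _ _) with (f := quad) in Ht.
      assert (WA' : dwt D0 [] (tl0 A) TAbs) by (eapply wt_dwt; eauto; rewrite EA; simpl; tauto).
      destruct (Rel_Ans _ _ _ _ _ HR Ht) with (A := qt A) as (W1 & k & G & W' & S1 & T1 & S2 & HR').
      { simpl. intros b Hb. injection Hb as <-. apply quad_mod. }
      { apply quad_dwt; auto. }
      { apply quad_nf. }
      apply ws_qt_inv in S1 as (Q1 & TS1 & HQ1 & E1); auto.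
      eapply harmony_i in T1 as (k1 & G1 & T1 & EG); eauto.
      destruct (tr_nren_inv _ _ _ _ T1 quad _ quad_inj eq_refl) as (l' & r' & T2 & El & Er).
      destruct l' as [|[a'|]|]; try discriminate. destruct r' as [|G2|]; try discriminate.
      injection El as El. apply quad_inj in El. subst a'. injection Er as ->.
      apply proc_dwt in HQ1 as WQ1.
      destruct (tr_step_in _ _ _ _ T2 _ _ eq_refl eq_refl _ Q1 D0 eq_refl WQ1 A EA) as (a0 & Q2 & <- & St2 & E2).
      assert (HQ2 : proc Q2).
      { apply proc_dwt. rewrite E2. apply dwt_inst with TAbs; auto. apply (tr_dwt_i _ _ _ _ _ _ _ T2 WQ1). }
      assert (S2' : ws (qt Q2) W').
      { eapply ws_dsc_l; [exact S2|]. rewrite E2, nren_inst, EG. reflexivity. }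
      apply ws_qt_inv in S2' as (Q' & TS2 & HQ' & EW); auto.
      exists Q'. split; [exists Q1, Q2; auto|]. split; auto. split; auto.
      rewrite <- E, <- EW, nren_inst. auto.
    + intros cs a A P' St HPo. apply step_out_subj in St as Ha. simpl in Ha. apply proc_dwt in HPo.
      apply news_out_cwt in HPo as WC; auto.
      apply step_tr with (r := fun x => x) (e := V) in St as (n & C & Ht & E).
      apply (tr_nren _ _ _ _) with (f := quad) in Ht.
      destruct (Rel_Ans _ _ _ _ _ HR Ht) as (W1 & k & C1 & C4 & S1 & T1 & S4 & HR').
      { simpl. intros b Hb. injection Hb as <-. apply quad_mod. }
      apply ws_qt_inv in S1 as (Q1 & TS1 & HQ1 & E1); auto.
      eapply harmony_o in T1 as (k1 & C2 & T1 & EC); eauto.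
      destruct (tr_nren_inv _ _ _ _ T1 quad _ quad_inj eq_refl) as (l' & r' & T2 & El & Er).
      destruct l' as [|[a'|]|a']; try discriminate. destruct r' as [| |C3]; try discriminate.
      injection El as El. apply quad_inj in El. subst a'. injection Er as ->.
      apply proc_dwt in HQ1 as WQ1.
      destruct (tr_step_out _ _ _ _ T2 _ _ eq_refl eq_refl _ Q1 D0 eq_refl WQ1 [] [])
        as (ds & a0 & B & Q2 & <- & St2 & _ & _ & E3 & W3).
      assert (EC' : ceq C1 (cnren quad (tlc (fun x => x) V ds B Q2))).
      { rewrite EC. apply ceq_nren; auto. }
      destruct (proj1 (ceq_cws _ _ EC') _ S4) as (X & SX & EX).
      apply cws_nren_inv in SX as (C5 & S5 & E5); [|apply quad_inj].
      eapply cws_tlc_inv in S5 as (Q' & TS2 & E6 & W6); [|apply id_inj|exact W3].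
      exists ds, B, Q'. split; [exists Q1, Q2; auto|].
      intros Y E0 HE Hfr SA SB. pose proof (ctx_tl_dwt _ _ HE) as WE.
      assert (L1 := news_ctx cs A P' Y E0 ltac:(intros; apply Hfr; auto) SA (fun x => x)).
      assert (L2 := news_ctx ds B Q' Y E0 ltac:(intros; apply Hfr; auto) SB (fun x => x)).
      split; [|split].
      * apply proc_dwt. rewrite L1. eapply cwt_cap; eauto.
      * apply proc_dwt. rewrite L2. eapply cwt_cap; eauto.
      * rewrite L1, L2, !cnren_cap.
        rewrite <- (ceq_cap _ _ (ceq_nren _ _ E quad) _ _ (reflexivity _)).
        rewrite <- (ceq_cap _ _ (ceq_nren _ _ E6 quad) _ _ (reflexivity _)).
        rewrite <- (ceq_cap _ _ E5 _ _ (reflexivity _)), <- (ceq_cap _ _ EX _ _ (reflexivity _)).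
        apply HR'; [apply quad_dwt; auto|apply quad_nf].
Qed.

(** * Context bisimilarity implies normal bisimilarity *)

(** Steps absorb a congruence but the empty sequence cannot, hence the disjunction. *)
Lemma tau_star_scong Q Q0 Q' : scong Q Q0 -> tau_star Q0 Q' -> Q0 = Q' \/ tau_star Q Q'.
Proof.
  intros HS H. apply clos_rt_rt1n in H. inv H; auto. right.
  eapply rt_trans; [apply rt_step; eapply step_scong; eauto|]. apply clos_rt1n_rt; auto.
Qed.
Lemma weak_scong Q Q0 l Q' : scong Q Q0 -> weak Q0 l Q' -> weak Q l Q'.
Proof.
  intros HS (P1 & P2 & T1 & St & T2). destruct (tau_star_scong _ _ _ HS T1) as [<-|T1'].
  - exists Q, P2. split; [apply rt_refl|]. split; auto. eapply step_scong; eauto.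
  - exists P1, P2. auto.
Qed.

(** One context has to serve both objects, whereas [rep_trig] derives its private channel from the
    object. Here [c] is a parameter, to be taken fresh for both, and variable 2 is the hole. *)
Definition rep_ctx c m : term :=
  let Qc := Inp c 1 (Par (Inp m 0 (Par (Var 1) (App (Var 2) (Var 0)))) (Out c (Var 1) Nil)) in
  Res c (Par Qc (Out c Qc Nil)).

Lemma rename_notin A c d : ~ In c (names A) -> rename_name c d A = A.
Proof.
  induction A; simpl; rewrite ?in_app_iff; intros H; auto.
  - destruct (n =? c) eqn:E; [apply Nat.eqb_eq in E; exfalso; auto|]. f_equal; tauto.
  - destruct (n =? c) eqn:E; [apply Nat.eqb_eq in E; exfalso; auto|]. f_equal; tauto.
  - f_equal; tauto.
  - destruct (n =? c) eqn:E; [auto|]. f_equal; tauto.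
  - f_equal; tauto.
  - f_equal; tauto.
Qed.

Lemma rep_ctx_alpha c m A : c <> m -> ~ In c (names A) ->
  scong (rep_trig m A) (subst A 2 (rep_ctx c m)) /\
  forall r, tl r V (rep_trig m A) = tl r V (subst A 2 (rep_ctx c m)).
Proof.
  intros Hm HA. set (c' := fresh_for (m :: names A)).
  destruct (Nat.eq_dec c c') as [->|Hc].
  { split; [apply sc_refl|reflexivity]. }
  pose proof (fresh_for_notin (m :: names A)) as Hf. fold c' in Hf.
  set (T := Par (Inp c 1 (Par (Inp m 0 (Par (Var 1) (App A (Var 0)))) (Out c (Var 1) Nil)))
             (Out c (Inp c 1 (Par (Inp m 0 (Par (Var 1) (App A (Var 0)))) (Out c (Var 1) Nil))) Nil)).
  assert (E : rep_trig m A = Res c' (rename_name c c' T)).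
  { unfold rep_trig, T. fold c'. simpl. rewrite !Nat.eqb_refl.
    assert (Em : m =? c = false) by (apply Nat.eqb_neq; auto). rewrite Em.
    rewrite rename_notin by auto. reflexivity. }
  assert (HT : ~ In c' (names T)).
  { unfold T. simpl. simpl in Hf. rewrite !in_app_iff. simpl. rewrite !in_app_iff. simpl.
    intros K. apply Hf. repeat match goal with K : _ \/ _ |- _ => destruct K as [K|K] end; try contradiction; auto. }
  change (subst A 2 (rep_ctx c m)) with (Res c T). rewrite E. split.
  - apply sc_sym, sc_alpha_res; auto.
  - intros r. apply tl_alpha_res; auto.
Qed.

Lemma rep_ctx_fn c m x : In x (fn (rep_ctx c m)) -> x = m.
Proof.
  unfold rep_ctx. cbn [fn]. rewrite in_remove_iff. simpl. intuition congruence.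
Qed.
Lemma wt_var_eq D G X s : G X = s -> wt D G (Var X) s.
Proof. intros <-. constructor. Qed.
Lemma rep_ctx_context c m : c <> m -> context 2 (rep_ctx c m).
Proof.
  intros Hm. split.
  - unfold rep_ctx. simpl. intuition congruence.
  - unfold rep_ctx. apply wt_res with TProc.
    assert (Ec : upd D0 c TProc c = TProc) by apply upd_eq.
    assert (Em : upd D0 c TProc m = TAbs) by (rewrite upd_neq by auto; reflexivity).
    assert (W : wt (upd D0 c TProc) (upd G0 2 TAbs)
      (Inp c 1 (Par (Inp m 0 (Par (Var 1) (App (Var 2) (Var 0)))) (Out c (Var 1) Nil))) TProc).
    { constructor. rewrite Ec. constructor.
      - constructor. rewrite Em. constructor; [apply wt_var_eq; reflexivity|].
        constructor; apply wt_var_eq; reflexivity.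
      - constructor; [rewrite Ec; apply wt_var_eq; reflexivity|constructor]. }
    constructor; auto. constructor; [rewrite Ec; auto|constructor].
Qed.

Lemma fv_news cs T : fv (news cs T) = fv T.
Proof. induction cs; simpl; auto. Qed.
Lemma scong_news cs T T' : scong T T' -> scong (news cs T) (news cs T').
Proof. intros H. induction cs; simpl; auto. apply sc_res; auto. Qed.
Lemma news_dwt_impl cs T T' :
  (forall r D, dwt D [] (tl r V T) TProc -> dwt D [] (tl r V T') TProc) ->
  forall r D, dwt D [] (tl r V (news cs T)) TProc -> dwt D [] (tl r V (news cs T')) TProc.
Proof.
  intros H. induction cs as [|c cs IH]; simpl; intros r D Hw; auto. inv Hw.
  econstructor. apply IH. eauto.
Qed.

(** Congruence need not preserve typing, so [proc] is transported through the translations: those of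
    the two servers are equal. *)
Lemma news_rep_trig cs c m A P : c <> m -> ~ In c (names A) ->
  let U := news cs (Par (subst A 2 (rep_ctx c m)) P) in
  let W := news cs (Par P (rep_trig m A)) in scong W U /\ (proc U -> proc W).
Proof.
  intros Hm HA U W. destruct (rep_ctx_alpha c m A Hm HA) as [S E]. split.
  - apply scong_news. eapply sc_trans; [apply sc_par_r, S|apply sc_par_comm].
  - rewrite !proc_dwt. apply news_dwt_impl. intros r D Hw. cbn [tl] in *. rewrite E.
    inv Hw. constructor; auto.
Qed.

Lemma rep_ctx_safe c m A : fv A = [] -> ~ In c (names A) -> subst_safe A (rep_ctx c m).
Proof.
  intros EA HA. split.
  - intros x Hx K. simpl in Hx. destruct Hx as [<-|[]]. apply HA, fn_names; auto.
  - rewrite EA. auto.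
Qed.
Lemma app_nil_l_inv {T} (l l' : list T) : l ++ l' = [] -> l = [].
Proof. intros H. apply app_eq_nil in H. tauto. Qed.

(** Closure under congruence absorbs the order of the parallel components and the choice of the
    private channel of the server. *)
Definition normal_rel (R : term -> term -> Prop) P Q := proc P /\ proc Q /\ exists P0 Q0, R P0 Q0 /\ scong P P0 /\ scong Q Q0.

Lemma normal_rel_intro R P Q : ctx_bisimulation R -> R P Q -> normal_rel R P Q.
Proof.
  intros HR H. destruct (proj1 (proj2 HR) _ _ H). split; auto. split; auto.
  exists P, Q. split; auto. split; apply sc_refl.
Qed.

Lemma normal_rel_bisimulation R : ctx_bisimulation R -> normal_bisimulation (normal_rel R).
Proof.
  intros HR. pose proof HR as (Hs & Hp & Hb). split; [|split].
  - intros P Q (? & ? & P0 & Q0 & ? & ? & ?). split; auto. split; auto. exists Q0, P0. auto.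
  - intros P Q (? & ? & _). auto.
  - intros P Q (HP & HQ & P0 & Q0 & H & EP & EQ). destruct (Hb _ _ H) as (Ht & Hi & Ho).
    split; [|split].
    + intros P' St HP'. destruct (Ht P') as (Q' & TS & H'); auto.
      { eapply step_scong; [apply sc_sym, EP|auto]. }
      destruct (tau_star_scong _ _ _ EQ TS) as [<-|TS'].
      * exists Q. split; [apply rt_refl|]. split; auto. split; auto. exists P', Q0.
        split; auto. split; [apply sc_refl|auto].
      * exists Q'. split; auto. apply normal_rel_intro; auto.
    + intros a m P' _ _ St HP'. destruct (Hi a (trig m) P') as (Q' & Wk & H'); auto.
      { split; [reflexivity|]. repeat constructor. apply wt_var_eq. reflexivity. }
      { eapply step_scong; [apply sc_sym, EP|auto]. }
      exists Q'. split; [eapply weak_scong; eauto|apply normal_rel_intro; auto].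
    + intros cs a A P' St HPo. destruct (Ho cs a A P') as (ds & B & Q' & Wk & HE); auto.
      { eapply step_scong; [apply sc_sym, EP|auto]. }
      exists ds, B, Q'. split; [eapply weak_scong; eauto|].
      assert (EA : fv A = []).
      { destruct HPo as [F _]. rewrite fv_news in F. apply app_nil_l_inv in F. auto. }
      (* The context applying its hole to itself places [B] in a term related by [R], and [R]
         relates closed terms only. *)
      assert (EB : fv B = []).
      { assert (K : R (news cs (Par (App A A) P')) (news ds (Par (App B B) Q'))).
        { apply (HE 0 (App (Var 0) (Var 0))).
          - split; [simpl; intuition|]. constructor; apply wt_var_eq; reflexivity.
          - simpl. auto.
          - split; simpl; tauto.
          - split; simpl; tauto. }
        apply Hp in K as [_ [F _]]. rewrite fv_news in F. apply app_nil_l_inv in F.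
        apply app_nil_l_inv in F. auto. }
      intros m Hm. pose proof (fresh_for_notin (m :: names A ++ names B)) as Hc.
      set (c := fresh_for (m :: names A ++ names B)) in *. simpl in Hc. rewrite in_app_iff in Hc.
      assert (K : R (news cs (Par (subst A 2 (rep_ctx c m)) P')) (news ds (Par (subst B 2 (rep_ctx c m)) Q'))).
      { apply HE.
        - apply rep_ctx_context. intuition.
        - intros x Hx Hf. apply rep_ctx_fn in Hf. subst x. apply Hm. simpl. rewrite !in_app_iff. tauto.
        - apply rep_ctx_safe; tauto.
        - apply rep_ctx_safe; tauto. }
      destruct (Hp _ _ K) as [KP KQ].
      destruct (news_rep_trig cs c m A P') as [SA PA]; [intuition|tauto|].
      destruct (news_rep_trig ds c m B Q') as [SB PB]; [intuition|tauto|].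
      split; [auto|]. split; [auto|]. eauto.
Qed.

Theorem theorem1 : forall P Q : term, proc P -> proc Q ->
  (normal_bisimilar P Q <-> ctx_bisimilar P Q).
Proof.
  intros P Q HP HQ. split.
  - intros H. exists ctx_rel. split; [apply ctx_rel_bisimulation|]. split; auto. split; auto. apply normal_Rel; auto.
  - intros (R & HR & H). exists (normal_rel R). split; [apply normal_rel_bisimulation; auto|apply normal_rel_intro; auto].
Qed.
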